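(* Let $n\ge3$, $\ell\ge2$, let $\lambda=[d_1,\ldots,d_r]$ be a partition of $d$ with $r\ge2$ parts, and let $s=d_2+\cdots+d_r$. Then: (a) If $d_1<s$ (and hence $r\ge3$) and $2\ell\le n$, then $\sigma_\ell(\mathbb X_{n-1,\lambda})$ is not defective. (b) If $d_1\ge s$ and $2\ell\le n$, then $\sigma_\ell(\mathbb X_{n-1,\lambda})$ is defective if and only if it does not fill its ambient space. (c) If $\ell\ge n$ and $d_1\ge(n-1)(s-1)$, then $\sigma_\ell(\mathbb X_{n-1,\lambda})$ always fills its ambient space, while if $2\ell\le n$, then $\sigma_\ell(\mathbb X_{n-1,\lambda})$ fills its ambient space if and only if one of the following conditions is satisfied: (i) $n=4$, $\ell=2$, and $\lambda\in\{[1,1],[2,1],[1,1,1]\}$; or (ii) $n=2\ell\ge6$ and $\lambda=[1,1]$.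
   Context: Let $\mathbb K$ be an algebraically closed field of characteristic zero and $S=\mathbb K[x_1,\ldots,x_n]=\bigoplus_{i\ge0}[S]_i$ the standard graded polynomial ring. A partition $\lambda=[d_1,\ldots,d_r]$ of $d$ consists of integers $d_1\ge d_2\ge\cdots\ge d_r\ge1$ with $d=d_1+\cdots+d_r$. Put $N=\binom{d+n-1}{n-1}$. The variety of $\lambda$-reducible forms is $$\mathbb X_{n-1,\lambda}=\{[F]\in\mathbb P([S]_d)=\mathbb P^{N-1}\mid F=F_1\cdots F_r,\ 0\ne F_i\in[S]_{d_i}\},$$ and $\dim\mathbb X_{n-1,\lambda}=\sum_{i=1}^r\binom{d_i+n-1}{n-1}-r$. For $\ell\le N$, the $(\ell-1)$-secant variety $\sigma_\ell(\mathbb X_{n-1,\lambda})$ is the Zariski closure in $\mathbb P^{N-1}$ of the union of the linear spans of all subsets of $\ell$ distinct points of $\mathbb X_{n-1,\lambda}$; for $\ell\ge N$ it is $\mathbb P^{N-1}$. It ''fills its ambient space'' if it equals $\mathbb P^{N-1}$. Its expected dimension is $\min\{N-1,\ \ell\cdot\dim\mathbb X_{n-1,\lambda}+\ell-1\}$; its defect $\delta_\ell\ge0$ is the expected dimension minus the actual dimension; it is called defective if $\delta_\ell>0$. *)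

(* Defs.v *)
From HB Require Import structures.
From mathcomp Require Import all_boot all_order all_algebra.
From mathcomp.multinomials Require Import mpoly.
From Stdlib Require Import ClassicalEpsilon.

Set Implicit Arguments.
Unset Strict Implicit.
Unset Printing Implicit Defensive.

Import GRing.Theory.
Local Open Scope ring_scope.

Section ProjectiveSpaceOfForms.
Variables (K : closedFieldType) (n d : nat).

(* [pset] is the type of subsets of P([S]_d). A point [F] of P([S]_d) is
   handled through its representatives: the nonzero forms of degree d (the zero
   polynomial is d-homogeneous for every d, hence the condition F != 0). The
   sets built below are stable under nonzero scaling. *)
Definition pset := {mpoly K[n]} -> Prop.

Definition ppoint : pset := fun F => F != 0 /\ F \is d.-homog.

Definition psubset (A B : pset) := forall F, A F -> B F.

Definition monom_of_deg := {m : 'X_{1..n < d.+1} | mdeg m == d}.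

(* The homogeneous coordinates of [F] are its coefficients, so that the
   number of coordinates #|{: monom_of_deg}| is 'C(d + n - 1, n - 1) when
   n >= 1. *)
Definition pcoord (F : {mpoly K[n]}) : 'I_#|{: monom_of_deg}| -> K :=
  fun i => F@_(val (enum_val i)).

Definition zariski_closed (Z : pset) :=
  exists G : {mpoly K[#|{: monom_of_deg}|]} -> Prop,
    (forall g, G g -> exists e : nat, g \is e.-homog) /\
    (forall F, Z F <-> ppoint F /\ forall g, G g -> g.@[pcoord F] = 0).

Definition zariski_closure (A : pset) : pset := fun F =>
  ppoint F /\ forall Z, zariski_closed Z -> psubset A Z -> Z F.

Definition irreducible_pset (A : pset) :=
  (exists F, A F) /\
  forall Z1 Z2, zariski_closed Z1 -> zariski_closed Z2 ->
    (forall F, A F -> Z1 F \/ Z2 F) -> psubset A Z1 \/ psubset A Z2.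

Definition closed_in (A B : pset) :=
  exists2 Z, zariski_closed Z & forall F, B F <-> A F /\ Z F.

(* C 0 < C 1 < ... < C k *)
Definition krull_chain (A : pset) (k : nat) :=
  exists C : nat -> pset,
    (forall i, (i <= k)%N -> closed_in A (C i) /\ irreducible_pset (C i)) /\
    (forall i, (i < k)%N ->
       psubset (C i) (C i.+1) /\ exists2 F, C i.+1 F & ~ C i F).

Definition has_pdim (A : pset) (k : nat) :=
  krull_chain A k /\ forall j, krull_chain A j -> (j <= k)%N.

(* Krull dimension of A for the topology induced by P([S]_d). The value is
   unspecified for empty A, which has no dimension in the sense of [has_pdim]. *)
Definition pdim (A : pset) : nat := epsilon (inhabits 0%N) (has_pdim A).

Definition distinct_points (l : nat) (P : 'I_l -> {mpoly K[n]}) :=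
  forall i j, i != j -> forall c : K, P i <> c *: P j.

Definition pspan (l : nat) (P : 'I_l -> {mpoly K[n]}) : pset := fun F =>
  ppoint F /\ exists c : 'I_l -> K, F = \sum_(i < l) c i *: P i.

Definition nforms := 'C(d + n - 1, n - 1)%N.

Definition secant_variety (l : nat) (A : pset) : pset :=
  if (l < nforms)%N then
    zariski_closure (fun F =>
      exists P : 'I_l -> {mpoly K[n]},
        [/\ forall i, A (P i), distinct_points P & pspan P F])
  else ppoint.

Definition fills (A : pset) := forall F, A F <-> ppoint F.

Definition expected_dim (l : nat) (A : pset) : nat :=
  minn (nforms - 1)%N (l * pdim A + l - 1)%N.

Definition defect (l : nat) (A : pset) : nat :=
  (expected_dim l A - pdim (secant_variety l A))%N.

Definition defective (l : nat) (A : pset) : bool := (0 < defect l A)%N.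

End ProjectiveSpaceOfForms.

Definition is_partition (lam : seq nat) :=
  sorted geq lam && all (leq 1) lam.

Definition reducible_forms (K : closedFieldType) (n : nat) (lam : seq nat) :
    pset K n := fun F =>
  exists2 G : 'I_(size lam) -> {mpoly K[n]},
    forall i, G i != 0 /\ G i \is (nth 0%N lam i).-homog
    & F = \prod_(i < size lam) G i.
Arguments reducible_forms K n lam : clear implicits.

(* Main.v *)
Require Import Defs.
From HB Require Import structures.
From mathcomp Require Import all_boot all_order all_algebra.
From mathcomp Require Import zify ring.
From mathcomp.multinomials Require Import mpoly.
From Stdlib Require Import ClassicalEpsilon Classical.

(** Dimensions are measured by counting forms.  Call [k] forms of degree [e]
    independent on [A] if no nontrivial combination of them vanishes on [A].
    Multiplying by powers of a form that vanishes on the smaller of two nested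
    irreducible closed sets shows that a chain of length [k] in [A] forces at
    least [(e+1)^k] independent forms of degree [O(e)].  When [A] lies in the
    closure of a polynomial family, this gives an upper bound for its dimension,
    in which the parameters can be restricted to a coordinate slice as soon as
    polynomial vector fields transverse to the slice at one point preserve the
    generic member up to scaling.  Conversely a family whose value and partial
    derivatives are independent at one point contains a chain whose length is
    the number of parameters, made of the closures of its coordinate subfamilies.

    The secant set is the set of nonzero sums of [l] products.  For the lower
    bounds, the [j]-th product is specialised to powers of linear forms in its
    own pair of variables: its tangent space is supported on monomials of degree
    at least [s] in that pair, so the tangent spaces are independent when
    [d1 < s].  When [s <= d1] the syzygy [x0^(d1-s) B_1 . A_0 - x0^(d1-s) B_0 . A_1]
    lowers the dimension by one.  Grouping the factors as [A_j B_j], the Koszul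
    fields at the point where the [A_j] and [B_j] are powers of distinct
    variables show that the secant set is dense if and only if these powers
    divide all monomials of degree [d], which is a condition on [n], [l], [d]. *)

Set Implicit Arguments.
Unset Strict Implicit.
Unset Printing Implicit Defensive.

Import GRing.Theory.
Local Open Scope ring_scope.

(** * Polynomials as functions *)

(** An upper bound for a Krull dimension must hold for chains of closed sets about which nothing
    else is known. Comparing the growth of two counts in [e] sees only exponents, so constants in
    the degrees are harmless. The obstacle is the fibres of the parametrisation: a sum of [l]
    products has [l * (forms_dim + r)] coefficients, but its factors can be rescaled against each
    other. A field that scales the generic member gives a first-order linear equation for every
    pulled-back form; its Taylor coefficients are then determined by those on the slice. Redundant
    parameters thus disappear without a study of fibres, and the base point may be degenerate.
    Defectivity in (b) never requires the true dimension: it suffices to lie strictly below both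
    terms of the expected one. In (c), sums for any partition are sums of products of two forms of
    degrees [d1] and [s]; counting monomials leaves only degree two, or degree three with [l = 2],
    where the chain from (a) for [[1, 1, 1]] already has the length of the ambient space. *)

Lemma digits_inj (B M : nat) (f g : 'I_M -> nat) :
  (forall i, f i < B)%N -> (forall i, g i < B)%N ->
  (\sum_i f i * B ^ i = \sum_i g i * B ^ i)%N -> f =1 g.
Proof.
elim: M f g => [|M IH] f g fB gB; first by move=> _ [].
rewrite !big_ord_recl !muln1.
have split_head (h : 'I_M.+1 -> nat) :
    (\sum_(i < M) h (lift ord0 i) * B ^ lift ord0 i =
     (\sum_(i < M) h (lift ord0 i) * B ^ i) * B)%N.
  rewrite big_distrl /=; apply: eq_bigr => i _.
  by rewrite /bump /= add1n expnS [(B * _)%N]mulnC mulnA.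
rewrite !split_head => E.
have B0 : (0 < B)%N by rewrite (leq_ltn_trans _ (fB ord0)).
have E0 : f ord0 = g ord0.
  have := congr1 (modn^~ B) E.
  by rewrite ![(_ + _ * B)%N]addnC !modnMDl !modn_small ?fB ?gB.
have E1 : (fun i => f (lift ord0 i)) =1 (fun i => g (lift ord0 i)).
  apply: IH => // ; move: E; rewrite E0 => /addnI /eqP.
  by rewrite eqn_pmul2r // => /eqP.
by move=> i; case: (unliftP ord0 i) => [j ->|->]; [apply: E1|].
Qed.

(* Kronecker substitution t_i = x ^ (B ^ i) reduces to one variable. *)
Lemma meval_eq0 (K : closedFieldType) (M : nat) (p : {mpoly K[M]}) :
  (forall t, p.@[t] = 0) -> p = 0.
Proof.
move=> p0; pose B := msize p.
pose w (m : 'X_{1..M}) := (\sum_i m i * B ^ i)%N.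
pose P : {poly K} := \sum_(m <- msupp p) p@_m *: 'X^(w m).
have P0 : P = 0.
  apply: contraTeq isT => /closed_nonrootP[x /negP[]]; apply/eqP.
  transitivity (p.@[fun i => x ^+ (B ^ i)]); last exact: p0.
  rewrite /P horner_sum mevalE.
  apply: eq_bigr => m _; rewrite hornerZ hornerXn expr_sum.
  by congr (_ * _); apply: eq_bigr => i _; rewrite -exprM mulnC.
have le_deg (m : 'X_{1..M}) i : m \in msupp p -> (m i < B)%N.
  move=> /msize_mdeg_lt; apply: leq_ltn_trans.
  by rewrite mdegE (bigD1 i) //= leq_addr.
apply/mpolyP => m; rewrite mcoeff0.
case: (boolP (m \in msupp p)) => [mp|/memN_msupp_eq0 //].
have : P`_(w m) = 0 by rewrite P0 coef0.
rewrite /P coef_sum (bigD1_seq m) ?msupp_uniq //= coefZ coefXn eqxx mulr1.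
rewrite big1_seq ?addr0 // => m' /andP[ne m'p].
rewrite coefZ coefXn; case: eqP => [/esym E|]; last by rewrite mulr0.
case/negP: ne; apply/eqP/mnmP; apply: (@digits_inj B) => //.
- by move=> i; apply: le_deg.
- by move=> i; apply: le_deg.
Qed.

(** These are the monomials that survive when the variables outside [W] are set to zero, so
    coefficients on [msub W] describe the restriction to a coordinate subspace. *)
Definition msub (M : nat) (W : {set 'I_M}) (m : 'X_{1..M}) : bool :=
  [forall j, (j \notin W) ==> (m j == 0%N)].

Lemma msubP (M : nat) (W : {set 'I_M}) (m : 'X_{1..M}) :
  reflect (forall j, j \notin W -> m j = 0%N) (msub W m).
Proof.
apply: (iffP forallP) => H j; first by move=> /(implyP (H j)) /eqP.
by apply/implyP => /H ->.
Qed.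

Lemma msubD (M : nat) (W : {set 'I_M}) (m1 m2 : 'X_{1..M}) :
  msub W (m1 + m2)%MM = msub W m1 && msub W m2.
Proof.
apply/msubP/andP => [H|[/msubP H1 /msubP H2] j jW]; last first.
  by rewrite mnmDE H1 // H2.
split; apply/msubP => j /H /eqP; rewrite mnmDE addn_eq0 => /andP[/eqP ? /eqP ?] //.
Qed.

Lemma meval_restrict (K : closedFieldType) (M : nat) (W : {set 'I_M})
    (p : {mpoly K[M]}) (t : 'I_M -> K) :
  (forall j, j \notin W -> t j = 0) ->
  p.@[t] = (\sum_(m <- msupp p | msub W m) p@_m *: 'X_[m]).@[t].
Proof.
move=> tW; rewrite mevalE raddf_sum /= (bigID (msub W)) /=.
rewrite [X in _ + X]big1 ?addr0 => [|m /forallPn[j]]; last first.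
  rewrite negb_imply => /andP[jW mj].
  by rewrite (bigD1 j) //= tW // expr0n (negbTE mj) mul0r mulr0.
by apply: eq_bigr => m _; rewrite mevalZ mevalX.
Qed.

Lemma mcoeff_restrict (K : closedFieldType) (M : nat) (W : {set 'I_M})
    (p : {mpoly K[M]}) m :
  (\sum_(m <- msupp p | msub W m) p@_m *: 'X_[m])@_m =
  if msub W m then p@_m else 0.
Proof.
rewrite raddf_sum /=; case: ifP => mW.
  case: (boolP (m \in msupp p)) => mp; last first.
    rewrite (memN_msupp_eq0 mp) big1_seq // => m' /andP[_ m'p].
    rewrite mcoeffZ mcoeffX; case: eqP => [E|]; last by rewrite mulr0.
    by rewrite -E m'p in mp.
  rewrite -big_filter (bigD1_seq m) ?filter_uniq ?msupp_uniq //=; last first.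
    by rewrite mem_filter mW mp.
  rewrite mcoeffZ mcoeffX eqxx mulr1 big1 ?addr0 // => m' ne.
  by rewrite mcoeffZ mcoeffX (negbTE ne) mulr0.
rewrite big1 // => m' m'W; rewrite mcoeffZ mcoeffX.
by case: eqP => [E|]; [rewrite -E m'W in mW|rewrite mulr0].
Qed.

Lemma meval_eq0_on (K : closedFieldType) (M : nat) (W : {set 'I_M})
    (p : {mpoly K[M]}) :
  (forall t, (forall j, j \notin W -> t j = 0) -> p.@[t] = 0) ->
  forall m, msub W m -> p@_m = 0.
Proof.
move=> p0 m mW; pose q := \sum_(m <- msupp p | msub W m) p@_m *: 'X_[m].
have q0 : q = 0.
  apply: meval_eq0 => t; pose t' j := if j \in W then t j else 0.
  have -> : q.@[t] = q.@[t'].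
    rewrite /q !raddf_sum /=; apply: eq_bigr => m' /msubP m'W.
    rewrite !mevalZ !mevalX; congr (_ * _); apply: eq_bigr => j _.
    by rewrite /t'; case: ifP => // /negbT /m'W ->.
  rewrite -meval_restrict ?p0 // => j; rewrite /t'; last by move/negbTE->.
  by move/negbTE->.
by have := mcoeff_restrict W p m; rewrite mW -/q q0 mcoeff0.
Qed.

Lemma meval_mcoeff0_on (K : closedFieldType) (M : nat) (W : {set 'I_M})
    (p : {mpoly K[M]}) :
  (forall m, msub W m -> p@_m = 0) ->
  forall t, (forall j, j \notin W -> t j = 0) -> p.@[t] = 0.
Proof.
move=> p0 t tW; rewrite (meval_restrict p tW) raddf_sum big1 //= => m mW.
by rewrite p0 // scale0r meval0.
Qed.

(** Restrictions to a coordinate subspace multiply in an integral domain. This lets finitely many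
    nonvanishing conditions hold at one common point of the subspace. *)
Lemma msub_nzM (K : closedFieldType) (M : nat) (W : {set 'I_M})
    (p q : {mpoly K[M]}) :
  (exists2 m, msub W m & p@_m != 0) -> (exists2 m, msub W m & q@_m != 0) ->
  exists2 m, msub W m & (p * q)@_m != 0.
Proof.
move=> [mp mpW pm] [mq mqW qm]; apply: NNPP => H.
have pq0 t : (forall j, j \notin W -> t j = 0) -> p.@[t] * q.@[t] = 0.
  move=> tW; rewrite -mevalM; apply: (meval_mcoeff0_on _ tW) => m mW.
  by apply/eqP; apply: contraT => nz; case: H; exists m.
pose r (f : {mpoly K[M]}) := \sum_(m <- msupp f | msub W m) f@_m *: 'X_[m].
have rE f t : (r f).@[t] = f.@[fun j => if j \in W then t j else 0].
  rewrite [RHS](@meval_restrict _ _ W) => [|j /negbTE->] //.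
  rewrite /r !raddf_sum /=; apply: eq_bigr => m' /msubP m'W.
  rewrite !mevalZ !mevalX; congr (_ * _); apply: eq_bigr => j _.
  by case: ifP => // /negbT /m'W ->.
have /eqP : r p * r q = 0.
  by apply: meval_eq0 => t; rewrite mevalM !rE pq0 // => j /negbTE->.
rewrite mulf_eq0 => /orP[] /eqP E.
  by move: pm; have := mcoeff_restrict W p mp; rewrite mpW -/(r p) E mcoeff0 => <-; rewrite eqxx.
by move: qm; have := mcoeff_restrict W q mq; rewrite mqW -/(r q) E mcoeff0 => <-; rewrite eqxx.
Qed.

Lemma meval_neq0_on (K : closedFieldType) (M : nat) (W : {set 'I_M})
    (p : {mpoly K[M]}) :
  (exists2 m, msub W m & p@_m != 0) ->
  exists2 t, (forall j, j \notin W -> t j = 0) & p.@[t] != 0.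
Proof.
move=> [m mW pm]; apply: NNPP => H; move/eqP: pm; apply.
apply: (meval_eq0_on _ mW) => t tW; apply/eqP; apply: contraT => nz.
by case: H; exists t.
Qed.

(** * Degree bounds and pull-back of forms along a family *)

Section DegreeBound.
Variables (R : comNzRingType) (M : nat).
Implicit Types (p q : {mpoly R[M]}) (k l : nat).

Definition deg_le p k := forall m, p@_m != 0 -> (mdeg m <= k)%N.

Lemma deg_le0 k : deg_le 0 k.
Proof. by move=> m; rewrite mcoeff0 eqxx. Qed.

Lemma deg_leD p q k : deg_le p k -> deg_le q k -> deg_le (p + q) k.
Proof.
move=> Hp Hq m; rewrite mcoeffD.
case: (eqVneq p@_m 0) => [->|/Hp //]; rewrite add0r; exact: Hq.
Qed.

Lemma deg_leZ c p k : deg_le p k -> deg_le (c *: p) k.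
Proof.
by move=> Hp m; rewrite mcoeffZ => H; apply: Hp; apply: contraNneq H => ->; rewrite mulr0.
Qed.

Lemma deg_leM p q k l : deg_le p k -> deg_le q l -> deg_le (p * q) (k + l).
Proof.
move=> Hp Hq m; apply: contraNT; rewrite -ltnNge => lt; rewrite mcoeffM.
rewrite big1 // => -[a b] /= /eqP /(congr1 mdeg); rewrite mdegD => E.
case: (eqVneq p@_a 0) => [->|/Hp la]; first by rewrite mul0r.
case: (eqVneq q@_b 0) => [->|/Hq lb]; first by rewrite mulr0.
by have := leq_add la lb; rewrite -E leqNgt lt.
Qed.

Lemma deg_le1 : deg_le 1 0.
Proof.
by move=> m; rewrite mcoeff1; case: (eqVneq m 0%MM) => [-> _|_]; rewrite ?mdeg0 ?eqxx.
Qed.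

Lemma deg_leX p k e : deg_le p k -> deg_le (p ^+ e) (k * e).
Proof.
move=> Hp; elim: e => [|e IH]; first by rewrite muln0 expr0; apply: deg_le1.
by rewrite exprS mulnS; apply: deg_leM.
Qed.

Lemma deg_le_prod (I : Type) (r : seq I) (F : I -> {mpoly R[M]}) (k : I -> nat) :
  (forall i, deg_le (F i) (k i)) -> deg_le (\prod_(i <- r) F i) (\sum_(i <- r) k i).
Proof.
move=> H; elim: r => [|i r IH]; first by rewrite !big_nil; apply: deg_le1.
by rewrite !big_cons; apply: deg_leM.
Qed.

Lemma deg_le_sum (I : eqType) (r : seq I) (F : I -> {mpoly R[M]}) k :
  (forall i, i \in r -> deg_le (F i) k) -> deg_le (\sum_(i <- r) F i) k.
Proof.
elim: r => [|i r IH] H; first by rewrite !big_nil; apply: deg_le0.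
rewrite !big_cons; apply: deg_leD; first by apply: H; rewrite mem_head.
by apply: IH => j jr; apply: H; rewrite in_cons jr orbT.
Qed.

Lemma deg_le_msize p : deg_le p (msize p).
Proof. by move=> m; rewrite -mcoeff_msupp => /msize_mdeg_lt /ltnW. Qed.

Lemma deg_leW p k l : (k <= l)%N -> deg_le p k -> deg_le p l.
Proof. by move=> kl H m /H /leq_trans; apply. Qed.

End DegreeBound.

Section Pull.
Variables (K : closedFieldType) (N M : nat) (Q : 'I_N -> {mpoly K[M]}).

(** Composition of [g] with the parametrisation whose [i]-th homogeneous coordinate is [Q i]. *)
Definition pull (g : {mpoly K[N]}) : {mpoly K[M]} := g \mPo [tuple Q i | i < N].

Lemma pull_eval g t : (pull g).@[t] = g.@[fun i => (Q i).@[t]].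
Proof.
rewrite /pull comp_mpoly_meval; apply: meval_eq => i.
by rewrite tnth_mktuple.
Qed.

Lemma pullE g : pull g = \sum_(m <- msupp g) g@_m *: \prod_i Q i ^+ m i.
Proof.
rewrite /pull comp_mpolyE; apply: eq_bigr => m _; congr (_ *: _).
by apply: eq_bigr => i _; rewrite tnth_mktuple.
Qed.

Lemma pull_sum (I : finType) (c : I -> K) (g : I -> {mpoly K[N]}) :
  pull (\sum_a c a *: g a) = \sum_a c a *: pull (g a).
Proof. by rewrite /pull raddf_sum /=; apply: eq_bigr => a _; rewrite comp_mpolyZ. Qed.

Lemma pullM g h : pull (g * h) = pull g * pull h.
Proof. exact: rmorphM. Qed.

Lemma pullXn g k : pull (g ^+ k) = pull g ^+ k.
Proof. exact: rmorphXn. Qed.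

Lemma pull_prod (I : finType) (g : I -> {mpoly K[N]}) :
  pull (\prod_a g a) = \prod_a pull (g a).
Proof. exact: rmorph_prod. Qed.

Lemma pullXU i : pull 'X_i = Q i.
Proof. by rewrite /pull comp_mpolyXU -tnth_nth tnth_mktuple. Qed.

Lemma pull_deg c e g : (forall i, deg_le (Q i) c) -> g \is e.-homog ->
  deg_le (pull g) (c * e).
Proof.
move=> HQ /dhomogP He; rewrite pullE; apply: deg_le_sum => m mg.
apply: deg_leZ; have /= <- := He m mg.
rewrite mdegE big_distrr /=.
by apply: deg_le_prod => i; apply: deg_leX.
Qed.

End Pull.

(** * Dimension through counting of forms *)

Lemma growth_exponent_le a k D :
  (forall e, e.+1 ^ k <= (a * e).+1 ^ D)%N -> (k <= D)%N.
Proof.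
move=> H; rewrite leqNgt; apply/negP => lt.
(* For this [e] the constant [a.+1 ^ D] is smaller than one further factor [e.+1]. *)
pose e := (a.+1 ^ D)%N.
have := H e; rewrite leqNgt => /negP; apply.
have le1 : ((a * e).+1 ^ D <= a.+1 ^ D * e.+1 ^ D)%N.
  rewrite -expnMn; have [->//|D0] := posnP D; rewrite leq_exp2r //; nia.
have lt2 : (a.+1 ^ D * e.+1 ^ D < e.+1 ^ D.+1)%N.
  by rewrite expnS ltn_pmul2r ?expn_gt0.
apply: leq_ltn_trans le1 (leq_trans lt2 _).
by apply: leq_pexp2l.
Qed.

Section Topology.
Variables (K : closedFieldType) (n d : nat).
Local Notation N := #|{: monom_of_deg n d}|.
Local Notation pcoord := (@pcoord K n d).
Implicit Types (A B C : pset K n) (g h : {mpoly K[N]}).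

Definition vanish A g := forall F, A F -> g.@[pcoord F] = 0.

Lemma ppoint_coord F : ppoint d F -> exists i : 'I_N, pcoord F i != 0.
Proof.
move=> [nz hom]; apply: NNPP => noi; case/eqP: nz; apply/mpolyP => m.
rewrite mcoeff0; apply/eqP; apply: contraT => mF; case: noi.
have mdm : mdeg m = d by apply: (dhomog_mf hom); rewrite mcoeff_msupp.
have mlt : (mdeg m < d.+1)%N by rewrite mdm.
have Pm : mdeg (BMultinom mlt) == d by apply/eqP.
exists (enum_rank (exist _ (BMultinom mlt) Pm : monom_of_deg n d)).
by rewrite /Defs.pcoord enum_rankK.
Qed.

Lemma closed_zeros e g : g \is e.-homog ->
  zariski_closed d (fun F : {mpoly K[n]} => ppoint d F /\ g.@[pcoord F] = 0).
Proof.
move=> gh; exists (fun g' => g' = g); split=> [g' ->|F]; first by exists e.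
split=> [[H1 H2]|[H1 H2]]; split=> //; last exact: H2.
by move=> g' ->.
Qed.

(** The Zariski closure, tested against single forms instead of closed sets. *)
Definition hull A : pset K n := fun F =>
  ppoint d F /\ forall e g, g \is e.-homog -> vanish A g -> g.@[pcoord F] = 0.

Lemma hull_closed A : zariski_closed d (hull A).
Proof.
exists (fun g => (exists e, g \is e.-homog) /\ vanish A g); split=> [g []//|F].
split=> [[pF H]|[pF H]]; split=> //.
  by move=> g [[e gh] Ag]; apply: H gh Ag.
by move=> e g gh Ag; apply: H; split=> //; exists e.
Qed.

Lemma sub_hull A : psubset A (ppoint d) -> psubset A (hull A).
Proof. by move=> Ap F AF; split; [apply: Ap | move=> e g _; apply]. Qed.

Lemma hullP A F : psubset A (ppoint d) -> zariski_closure d A F <-> hull A F.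
Proof.
move=> Ap; split=> -[pF H]; split=> //.
  move=> e g gh Ag.
  pose Z (F : {mpoly K[n]}) := ppoint d F /\ g.@[pcoord F] = 0.
  have [] // : Z F by apply: H; [apply: closed_zeros gh | move=> F' AF'; split; auto].
move=> Z [G [Gh ZG]] AZ; apply/ZG; split=> // g Gg.
have [e gh] := Gh g Gg; apply: H gh _ => F' /AZ /ZG[_]; exact.
Qed.

Lemma vanish_hull A e g : g \is e.-homog -> vanish A g -> vanish (hull A) g.
Proof. by move=> gh Ag F [_ H]; apply: H gh Ag. Qed.

(** The homogeneous ideal of an irreducible set is prime: the zero loci of the two factors are
    closed and cover [C]. *)
Lemma irr_vanishM C e1 e2 g h : irreducible_pset d C -> psubset C (ppoint d) ->
  g \is e1.-homog -> h \is e2.-homog -> vanish C (g * h) ->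
  vanish C g \/ vanish C h.
Proof.
move=> [_ irrC] Cp gh hh Cgh.
have := irrC _ _ (closed_zeros gh) (closed_zeros hh).
case=> [F CF|H|H]; last 2 first.
- by left=> F /H[].
- by right=> F /H[].
have /eqP := Cgh F CF; rewrite mevalM mulf_eq0 => /orP[] /eqP E.
- by left; split=> //; apply: Cp.
- by right; split=> //; apply: Cp.
Qed.

Lemma irr_vanishX C e g h e2 k : irreducible_pset d C -> psubset C (ppoint d) ->
  g \is e.-homog -> h \is e2.-homog -> ~ vanish C g -> vanish C (g ^+ k * h) ->
  vanish C h.
Proof.
move=> irrC Cp gh hh Cg; elim: k => [|k IH]; first by rewrite expr0 mul1r.
rewrite exprS -mulrA => H.
have gkh : g ^+ k * h \is (e * k + e2).-homog by apply: dhomogM => //; apply: dhomogMn.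
by case: (irr_vanishM irrC Cp gh gkh H).
Qed.

(** In other words, the Hilbert function of the closure of [A] is at least [#|I|] in degree [e]. *)
Definition indep A (e : nat) (I : finType) := exists g : I -> {mpoly K[N]},
  (forall a, g a \is e.-homog) /\
  forall c : I -> K, vanish A (\sum_a c a *: g a) -> forall a, c a = 0.

Lemma indep_sub A B e I : psubset A B -> indep A e I -> indep B e I.
Proof.
move=> AB [g [gh gi]]; exists g; split=> // c Bc; apply: gi => F /AB; exact: Bc.
Qed.

Lemma indep_point A F : A F -> indep A 0 unit.
Proof.
move=> AF; exists (fun _ => 1); split=> [_|c]; first exact: dhomog1.
move=> /(_ F AF); rewrite (bigD1 tt) //= big1 => [|[]//].
by rewrite addr0 mevalZ meval1 mulr1 => c0 [].
Qed.

(** The new forms are [g0 ^ j * y ^ ((e - j) * q) * g b] with [j <= e], where [g0], of degree [q],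
    vanishes on [C'] but not on [C], and the coordinate [y], not identically zero on [C'], equalises
    the degrees. In a vanishing combination the least power of [g0] cancels because the ideal of [C]
    is prime; restriction to [C'] kills the higher powers and leaves a relation among the [g b]. *)
Lemma indep_step A C C' a :
  psubset A (ppoint d) -> closed_in d A C' -> irreducible_pset d C' ->
  irreducible_pset d C -> psubset C A -> psubset C' C ->
  (exists2 F, C F & ~ C' F) ->
  exists q, forall e (I : finType), indep C' (a * e) I ->
    indep C ((a + q) * e) (I * 'I_e.+1)%type.
Proof.
move=> Ap [Z [G [Gh ZG]] C'Z] irrC' irrC CA C'C [F0 CF0 nC'F0].
have [g0 [Gg0 g0F]] : exists g, G g /\ g.@[pcoord F0] <> 0.
  apply: NNPP => H; apply: nC'F0; apply/C'Z; split; first exact: CA.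
  apply/ZG; split; first exact/Ap/CA.
  by move=> g Gg; apply: NNPP => g0; apply: H; exists g.
have [q g0h] := Gh _ Gg0.
have C'g0 : vanish C' g0 by move=> F /C'Z[_ /ZG[_]]; apply.
have nCg0 : ~ vanish C g0 by move=> /(_ _ CF0).
have Cp : psubset C (ppoint d) by move=> F /CA/Ap.
have C'p : psubset C' (ppoint d) by move=> F /C'C/Cp.
have [F1 C'F1] := irrC'.1.
have [i /eqP F1i] := ppoint_coord (C'p _ C'F1).
pose y : {mpoly K[N]} := 'X_i.
have yh : y \is 1.-homog by rewrite dhomogX /= mdeg1.
have ykh k : y ^+ k \is k.-homog by have := dhomogMn k yh; rewrite mul1n.
have nC'y : ~ vanish C' y by move=> /(_ _ C'F1); rewrite mevalXU.
exists q => e' I' [g [gh gi]].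
pose P (c : I' * 'I_e'.+1 -> K) (j : 'I_e'.+1) :=
  y ^+ ((e' - j) * q) * \sum_b c (b, j) *: g b.
have sumh c (j : 'I_e'.+1) : \sum_b c (b, j) *: g b \is (a * e').-homog.
  by apply: rpred_sum => b _; apply: rpredZ; apply: gh.
have Ph c j : P c j \is ((e' - j) * q + a * e').-homog.
  by apply: dhomogM.
exists (fun bj : I' * 'I_e'.+1 => g0 ^+ bj.2 * (y ^+ ((e' - bj.2) * q) * g bj.1)).
split=> [[b j] /=|c].
  have -> : ((a + q) * e' = q * j + ((e' - j) * q + a * e'))%N.
    have := ltn_ord j; rewrite ltnS => ?.
    rewrite addnA [(q * j)%N]mulnC -mulnDl subnKC //; ring.
  apply: dhomogM; first exact: dhomogMn.
  by apply: dhomogM.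
pose T := \sum_(j < e'.+1) g0 ^+ j * P c j.
have -> : \sum_bj c bj *: (g0 ^+ bj.2 * (y ^+ ((e' - bj.2) * q) * g bj.1)) = T.
  rewrite /T (eq_bigr (fun j : 'I_e'.+1 => \sum_b c (b, j) *:
      (g0 ^+ j * (y ^+ ((e' - j) * q) * g b)))).
    by rewrite exchange_big pair_bigA; apply: eq_bigr => -[].
  move=> j _; rewrite /P !mulr_sumr; apply: eq_bigr => b _.
  by rewrite -!scalerAr.
move=> CT.
suff H (j : nat) (jl : (j < e'.+1)%N) b : c (b, Ordinal jl) = 0.
  by move=> -[b [j jl]]; apply: H.
elim/ltn_ind: j jl b => j IH jl.
have Pz (k : 'I_e'.+1) : (k < j)%N -> P c k = 0.
  case: k => k kl /= kj; rewrite /P big1 ?mulr0 // => b _.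
  by rewrite IH // scale0r.
pose T' := \sum_(k < e'.+1 | (j <= k)%N) g0 ^+ (k - j) * P c k.
have TE : T = g0 ^+ j * T'.
  rewrite /T (bigID (fun k : 'I_e'.+1 => (j <= k)%N)) /= [X in _ + X]big1 ?addr0.
    rewrite /T' mulr_sumr; apply: eq_bigr => k jk.
    by rewrite mulrA -exprD subnKC.
  by move=> k; rewrite -ltnNge => /Pz ->; rewrite mulr0.
have T'h : T' \is (q * (e' - j) + a * e').-homog.
  apply: rpred_sum => k jk.
  have -> : (q * (e' - j) + a * e' = q * (k - j) + ((e' - k) * q + a * e'))%N.
    have := ltn_ord k; rewrite ltnS; nia.
  by apply: dhomogM => //; apply: dhomogMn.
have CT' : vanish C T' by apply: (irr_vanishX (k := j) irrC Cp g0h T'h) => //; rewrite -TE.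
have C'P : vanish C' (P c (Ordinal jl)).
  move=> F C'F; have := CT' F (C'C _ C'F).
  rewrite /T' (bigD1 (Ordinal jl)) //= subnn expr0 mul1r mevalD.
  rewrite [X in _ + X]raddf_sum /= [X in _ + X]big1 ?addr0 // => k /andP[jk ne].
  rewrite mevalM rmorphXn /= C'g0 // expr0n subn_eq0 leqNgt ltn_neqAle jk andbT.
  by rewrite (_ : (j : nat) != k) ?mul0r //; apply: contraNneq ne => E; apply/eqP/val_inj.
rewrite /P /= exprM in C'P; apply: (gi (fun b => c (b, Ordinal jl))).
rewrite -exprM in C'P.
by apply: (irr_vanishX irrC' C'p yh _ nC'y C'P); apply: sumh.
Qed.

Lemma chain_growth A k : psubset A (ppoint d) -> krull_chain d A k ->
  exists a, forall e, exists2 I : finType, #|I| = (e.+1 ^ k)%N & indep A (a * e) I.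
Proof.
move=> Ap [C [HC1 HC2]].
have {}HC1 i : (i <= k)%N -> [/\ closed_in d A (C i), irreducible_pset d (C i) & psubset (C i) A].
  move=> /HC1[c ir]; split=> //; case: c => Z _ HZ F /HZ[] //.
suff H i : (i <= k)%N -> exists a, forall e,
    exists2 I : finType, #|I| = (e.+1 ^ i)%N & indep (C i) (a * e) I.
  have [a Ha] := H k (leqnn k); exists a => e; have [I cI iI] := Ha e.
  by exists I => //; apply: indep_sub iI; have [] := HC1 k (leqnn k).
elim: i => [|i IH] ik.
  have [_ [[F CF] _] _] := HC1 0%N ik; exists 0%N => e; exists unit.
    by rewrite card_unit expn0.
  exact: indep_point CF.
have [a Ha] := IH (ltnW ik).
have [c1 i1 s1] := HC1 _ (ltnW ik); have [c2 i2 s2] := HC1 _ ik.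
have [CC nCC] := HC2 _ ik.
have [q Hq] := indep_step a Ap c1 i1 i2 s2 CC nCC.
exists (a + q)%N => e; have [I cI iI] := Ha e.
exists (I * 'I_e.+1)%type; last exact: Hq.
by rewrite card_prod cI card_ord expnSr.
Qed.

(** The functionals [L _ b] detect vanishing on [A], so with more than [#|B|] forms a kernel vector
    of the matrix of their values is a forbidden relation. *)
Lemma indep_card_le A e (I B : finType) (L : {mpoly K[N]} -> B -> K) :
  (forall b (c : I -> K) (G : I -> {mpoly K[N]}), L (\sum_a c a *: G a) b = \sum_a c a * L (G a) b) ->
  (forall g, g \is e.-homog -> (forall b, L g b = 0) -> vanish A g) ->
  indep A e I -> (#|I| <= #|B|)%N.
Proof.
move=> Llin Lvan [g [gh gi]]; rewrite leqNgt; apply/negP => lt.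
pose X := \matrix_(i < #|I|, j < #|B|) L (g (enum_val i)) (enum_val j).
have /rowV0Pn[v vk v0] : kermx X != 0.
  by rewrite kermx_eq0 /row_free neq_ltn (leq_ltn_trans (rank_leq_col X) lt).
have vX : v *m X = 0 by apply/sub_kermxP.
pose c a := v 0 (enum_rank a).
case/eqP: v0; apply/rowP => i; rewrite mxE -[i]enum_valK -/(c _).
apply: gi; apply: Lvan => [|b]; first by apply: rpred_sum => a _; apply: rpredZ; apply: gh.
rewrite Llin; have /rowP/(_ (enum_rank b)) := vX; rewrite !mxE => vXb.
rewrite -[RHS]vXb (reindex (fun i : 'I_#|I| => enum_val i)) /=; last first.
  by apply: onW_bij; exact: enum_val_bij.
by apply: eq_bigr => j _; rewrite !mxE enum_rankK /c enum_valK.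
Qed.

Section Upper.
Variables (M : nat) (Q : 'I_N -> {mpoly K[M]}) (W : {set 'I_M}) (A : pset K n).
Hypothesis vanishA : forall e g, g \is e.-homog ->
  (forall m, msub W m -> (pull Q g)@_m = 0) -> vanish A g.

(** A form of degree [e] pulls back to degree at most [c * e]. Its vanishing on [A] is decided by
    monomials supported on [W] with exponents at most [c * e], and [(c * e).+1 ^ #|W|] exponent
    vectors cover these. *)
Lemma indep_le_growth : exists c, forall e (I : finType),
  indep A e I -> (#|I| <= (c * e).+1 ^ #|W|)%N.
Proof.
pose c := (\max_i msize (Q i))%N; exists c => e I iI.
have HQ i : deg_le (Q i) c.
  apply: deg_leW (@deg_le_msize _ _ (Q i)); exact: leq_bigmax.
pose B := {ffun {j | j \in W} -> 'I_(c * e).+1}.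
have <- : #|{: B}| = ((c * e).+1 ^ #|W|)%N by rewrite card_ffun card_ord card_sig.
pose mB (b : B) : 'X_{1..M} :=
  [multinom (if insub j is Some w then val (b w) else 0%N) | j < M].
apply: (@indep_card_le A e I B (fun g b => (pull Q g)@_(mB b))) iI.
  move=> b k g; rewrite pull_sum raddf_sum /=.
  by apply: eq_bigr => a _; rewrite mcoeffZ.
move=> g gh g0; apply: (vanishA gh) => m mW.
have := pull_deg HQ gh; move: (pull Q g) g0 => p g0 pd.
case: (leqP (mdeg m) (c * e)) => [md|]; last first.
  by rewrite ltnNge => /negP md; apply/eqP; apply: contraT => /pd.
have lt j : (m j < (c * e).+1)%N.
  by rewrite ltnS (leq_trans _ md) // mdegE (bigD1 j) //= leq_addr.
rewrite -(g0 [ffun w => Ordinal (lt (val w))]); congr (_@_ _).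
apply/mnmP => j; rewrite mnmE; case: insubP => [w _ <-|jW].
  by rewrite ffunE.
exact: (msubP _ _ mW).
Qed.

Lemma chain_le k : psubset A (ppoint d) -> krull_chain d A k -> (k <= #|W|)%N.
Proof.
move=> Ap /(chain_growth Ap)[a Ha]; have [c Hc] := indep_le_growth.
apply: (@growth_exponent_le (c * a)) => e; have [I <- /Hc] := Ha e.
by rewrite mulnA.
Qed.
End Upper.
End Topology.

(** * Vector fields *)

Section VectorFields.
Variables (K : closedFieldType) (charK0 : [pchar K] =i pred0).
Variables (M : nat) (W : {set 'I_M}).
Implicit Types (G : {mpoly K[M]}).

Let zdeg (m : 'X_{1..M}) := (\sum_(j | j \notin W) m j)%N.

Let zdegD m1 m2 : zdeg (m1 + m2)%MM = (zdeg m1 + zdeg m2)%N.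
Proof. by rewrite /zdeg -big_split; apply: eq_bigr => j _; rewrite mnmDE. Qed.

Let zdegU j : zdeg U_(j)%MM = (j \notin W).
Proof.
rewrite /zdeg; case: (boolP (j \in W)) => jW /=.
  rewrite big1 // => i iW; rewrite mnm1E; case: eqP => // E.
  by rewrite -E jW in iW.
rewrite (bigD1 j) //= mnm1E eqxx big1 // => i /andP[_ ne].
by rewrite mnm1E eq_sym (negbTE ne).
Qed.

(* Induction on the order of vanishing along the coordinate subspace spanned
   by W, then on the order at the origin within it. *)
Lemma vector_fields_eq0 (v : 'I_M -> 'I_M -> {mpoly K[M]}) (ev : 'I_M -> K) G :
  (forall a b, a \notin W -> b \notin W -> (v a b)@_0 = (a == b)%:R) ->
  (forall a, a \notin W -> \sum_b v a b * G^`M(b) = ev a *: G) ->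
  (forall m, msub W m -> G@_m = 0) -> G = 0.
Proof.
move=> v0 vG G0; apply/mpolyP => m; rewrite mcoeff0.
move: {2}(zdeg m) (erefl (zdeg m)) => k; elim/ltn_ind: k m => k IHk m.
move: {2}(mdeg m) (erefl (mdeg m)) => l; elim/ltn_ind: l m => l IHl m ml mk.
case: (boolP (msub W m)) => [/G0 //|/forallPn[a]].
rewrite negb_imply => /andP[aW ma].
pose w b := v a b - (a == b)%:R.
have eqG : G^`M(a) + \sum_b w b * G^`M(b) = ev a *: G.
  rewrite -vG // [in RHS](bigD1 a) //= [X in _ + X](bigD1 a) //= addrA; congr (_ + _).
    by rewrite /w eqxx mulrBl mul1r addrC subrK.
  by apply: eq_bigr => b ne; rewrite /w eq_sym (negbTE ne) subr0.
have mE : (m - U_(a) + U_(a))%MM = m by rewrite submK // lep1mP.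
have zm : zdeg m = (zdeg (m - U_(a))%MM).+1 by rewrite -{1}mE zdegD zdegU aW addn1.
have dm : mdeg m = (mdeg (m - U_(a))%MM).+1 by rewrite -{1}mE mdegD mdeg1 addn1.
have := congr1 (mcoeff (m - U_(a))%MM) eqG.
rewrite mcoeffD mcoeffZ mcoeff_mderiv mE raddf_sum /=.
rewrite [ev a * _](_ : _ = 0); last first.
  by rewrite (IHk _ _ (m - U_(a))%MM erefl) ?mulr0 // -mk zm.
rewrite big1 => [|b _].
  rewrite addr0 => /eqP; rewrite -mulr_natr mulf_eq0 => /orP[/eqP //|].
  by rewrite ((charf0P K).1 charK0).
rewrite mcoeffM big1 // => -[u u'] /= /eqP E.
rewrite mcoeff_mderiv.
have zE : zdeg m = (zdeg u + zdeg u').+1 by have := congr1 zdeg E; rewrite zdegD => <-.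
have dE : mdeg m = (mdeg u + mdeg u').+1 by have := congr1 (@mdeg M) E; rewrite mdegD => <-.
suff [->|->] : (w b)@_u = 0 \/ G@_(u' + U_(b)) = 0 by rewrite ?mul0r // mul0rn mulr0.
case: (boolP (b \in W)) => bW.
  right; apply: (IHk _ _ _ erefl).
  by rewrite zdegD zdegU bW addn0 -mk zE ltnS leq_addl.
case: (posnP (zdeg u)) => zu; last first.
  right; apply: (IHk _ _ _ erefl).
  by rewrite zdegD zdegU bW addn1 -mk zE ltnS -add1n leq_add2r.
case: (posnP (mdeg u)) => du; last first.
  right; apply: (IHl _ _ _ erefl); last by rewrite zdegD zdegU bW addn1 -mk zE zu.
  by rewrite mdegD mdeg1 addn1 -ml dE ltnS -add1n leq_add2r.
left; move/eqP: du; rewrite mdeg_eq0 => /eqP ->.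
rewrite /w mcoeffB v0 //; case: eqP => _; rewrite ?mcoeff1 ?eqxx ?mcoeff0 ?subrr //.
Qed.

End VectorFields.

(** * Chains from parametrised families *)

Lemma mpolyX_neq0 (R : nzRingType) n (m : 'X_{1..n}) : 'X_[m] != 0 :> {mpoly R[n]}.
Proof.
apply/eqP => /(congr1 (mcoeff m)); rewrite mcoeffX eqxx mcoeff0.
by move/eqP; rewrite oner_eq0.
Qed.

Section Chains.
Variables (K : closedFieldType) (n d : nat).
Local Notation N := #|{: monom_of_deg n d}|.
Local Notation pcoord := (@pcoord K n d).
Implicit Types (A B C : pset K n) (g : {mpoly K[N]}).

Definition form_of (t : 'I_N -> K) : {mpoly K[n]} :=
  \sum_i t i *: 'X_[val (val (enum_val i))].

Lemma pcoord_form_of t i : pcoord (form_of t) i = t i.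
Proof.
rewrite /Defs.pcoord /form_of raddf_sum /= (bigD1 i) //= mcoeffZ mcoeffX eqxx mulr1.
rewrite big1 ?addr0 // => j ne; rewrite mcoeffZ mcoeffX.
case: eqP => [E|]; last by rewrite mulr0.
by case/eqP: ne; apply/enum_val_inj/val_inj/val_inj.
Qed.

Lemma form_of_homog t : form_of t \is d.-homog.
Proof.
apply: rpred_sum => i _; apply: rpredZ; rewrite dhomogX /=.
exact: (valP (enum_val i)).
Qed.

Lemma form_of_ppoint t : (exists i, t i != 0) -> ppoint d (form_of t).
Proof.
move=> [i ti]; split; last exact: form_of_homog.
apply: contraNneq ti => E; rewrite -(pcoord_form_of t i) E.
by rewrite /Defs.pcoord mcoeff0.
Qed.

(** The zero vector represents no point; multiplication by a coordinate makes the polynomial vanish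
    there as well. *)
Lemma vanish_ppoint (i0 : 'I_N) g : vanish (ppoint d) g -> g = 0.
Proof.
move=> g0; suff /eqP : g * 'X_i0 = 0.
  by by rewrite mulf_eq0 (negbTE (mpolyX_neq0 _ _)) orbF => /eqP.
apply: meval_eq0 => t; rewrite mevalM mevalXU.
have [->|ti0] := eqVneq (t i0) 0; first by rewrite mulr0.
have := g0 _ (form_of_ppoint (ex_intro _ i0 ti0)).
by rewrite (meval_eq _ (v2 := t)) => [->|i]; rewrite ?mul0r ?pcoord_form_of.
Qed.

Lemma ppoint_irr (i0 : 'I_N) : irreducible_pset d (@ppoint K n d).
Proof.
split.
  by exists (form_of (fun=> 1)); apply: form_of_ppoint; exists i0; rewrite oner_neq0.
move=> Z1 Z2 [G1 [Gh1 ZG1]] [G2 [Gh2 ZG2]] ZZ.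
case: (classic (forall g, G1 g -> g = 0)) => H1.
  by left=> F pF; apply/ZG1; split=> // g /H1 ->; rewrite meval0.
case: (classic (forall g, G2 g -> g = 0)) => H2.
  by right=> F pF; apply/ZG2; split=> // g /H2 ->; rewrite meval0.
have [g1 Gg1 g10] : exists2 g, G1 g & g <> 0.
  by apply: NNPP => H; apply: H1 => g Gg; apply: NNPP => g0; apply: H; exists g.
have [g2 Gg2 g20] : exists2 g, G2 g & g <> 0.
  by apply: NNPP => H; apply: H2 => g Gg; apply: NNPP => g0; apply: H; exists g.
suff /vanish_ppoint -/(_ i0)/eqP : vanish (ppoint d) (g1 * g2).
  by rewrite mulf_eq0 => /orP[] /eqP.
move=> F /ZZ[/ZG1|/ZG2] [_ H]; rewrite mevalM.
  by rewrite H ?mul0r.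
by rewrite [X in _ * X]H ?mulr0.
Qed.

Lemma ambient_chain_le (A : pset K n) k :
  psubset A (ppoint d) -> krull_chain d A k -> (k <= N.-1)%N.
Proof.
move=> Ap chA; have [a Ha] := chain_growth Ap chA.
have [C [HC _]] := chA; have [cl [[F CF] _]] := HC k (leqnn k).
have AF : A F by case: cl CF => Z _ HZ /HZ[].
have [i0 _] := ppoint_coord (Ap _ AF).
apply: (@growth_exponent_le a) => e; have [I <- iI] := Ha e.
pose B := {ffun {j : 'I_N | j != i0} -> 'I_(a * e).+1}.
have <- : #|{: B}| = ((a * e).+1 ^ N.-1)%N.
  rewrite card_ffun card_ord card_sig; congr (_ ^ _)%N.
  by have := cardC1 i0; rewrite card_ord => <-; apply: eq_card => j; rewrite !inE.
pose mB0 (b : B) : 'X_{1..N} :=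
  [multinom (if insub j is Some w then val (b w) else 0%N) | j < N].
(* The exponents off [i0] determine a monomial of degree [a * e], the one at [i0] being the
   complement; this is why the bound is [N.-1] and not [N]. *)
pose mB b : 'X_{1..N} := (mB0 b + U_(i0) *+ (a * e - mdeg (mB0 b)))%MM.
apply: (@indep_card_le _ _ _ A (a * e) I B (fun g b => g@_(mB b))) iI.
  move=> b c G; rewrite raddf_sum /=.
  by apply: eq_bigr => x _; rewrite mcoeffZ.
move=> g gh g0; suff -> : g = 0 by move=> F' _; rewrite meval0.
apply/mpolyP => m; rewrite mcoeff0; case: (eqVneq (mdeg m) (a * e)%N) => [md|]; last first.
  exact: (dhomog_nemf_coeff gh).
have lt j : (m j < (a * e).+1)%N.
  by rewrite ltnS -md mdegE (bigD1 j) //= leq_addr.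
pose b : B := [ffun w => Ordinal (lt (val w))].
have bE j : mB0 b j = if j == i0 then 0%N else m j.
  rewrite mnmE; case: insubP => [w jw <-|/negPn ->] //.
  by rewrite ffunE /= (negbTE (valP w)).
rewrite -(g0 b); congr (_@_ _); apply/mnmP => j; rewrite mnmDE bE mulmnE mnm1E.
rewrite [i0 == j]eq_sym; case: eqP => [->|_]; last by rewrite mul0n addn0.
rewrite mul1n add0n -md 2!mdegE [X in (_ - X)%N](bigD1 i0) //= bE eqxx add0n.
rewrite (bigD1 i0) //= [X in (_ - X)%N](eq_bigr m) ?addnK // => j' ne.
by rewrite bE (negbTE ne).
Qed.

(** [pdim] is chosen by [epsilon], so it has meaning only once a longest chain exists; one chain and
    a bound on all chains provide it. *)
Lemma pdim_spec (A : pset K n) k b : krull_chain d A k ->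
  (forall j, krull_chain d A j -> (j <= b)%N) -> has_pdim d A (pdim d A).
Proof.
move=> chk bound; apply: epsilon_spec.
move: {2}(b - k)%N (leqnn (b - k)) => m; elim: m k chk => [|m IH] k chk mk.
  exists k; split=> // j /bound /leq_trans; apply; lia.
case: (classic (exists2 j, krull_chain d A j & (k < j)%N)) => [[j chj kj]|H].
  by apply: (IH j chj); have := bound j chj; lia.
exists k; split=> // j chj; rewrite leqNgt; apply/negP => kj.
by apply: H; exists j.
Qed.

Lemma pdim_le (A : pset K n) k b : krull_chain d A k ->
  (forall j, krull_chain d A j -> (j <= b)%N) -> (pdim d A <= b)%N.
Proof. by move=> chk bound; have [ch _] := pdim_spec chk bound; apply: bound. Qed.

Lemma pdim_ge (A : pset K n) k : psubset A (ppoint d) -> krull_chain d A k ->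
  (k <= pdim d A)%N.
Proof.
move=> Ap chk; have [_] := pdim_spec chk (fun j => @ambient_chain_le A j Ap).
exact.
Qed.

(** The ambient space, itself irreducible, goes on top of any chain in a proper closed subset. *)
Lemma chain_extend (A : pset K n) k F : zariski_closed d A -> ppoint d F -> ~ A F ->
  krull_chain d A k -> krull_chain d (@ppoint K n d) k.+1.
Proof.
move=> [G [Gh AG]] pF nAF [C [HC1 HC2]].
have Cp i : (i <= k)%N -> psubset (C i) A.
  by move=> /HC1[[Z _ HZ] _] F' /HZ[].
have [i0 _] := ppoint_coord pF.
exists (fun i => if (i <= k)%N then C i else @ppoint K n d); split=> i.
  case: (leqP i k) => ik _; last first.
    split; last exact: ppoint_irr.
    exists (@ppoint K n d); last by move=> F'; split=> [|[]].
    exists (fun _ => False); split=> // F'; split=> [|[]//].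
    by move=> pF'; split.
  have [[Z [G' [Gh' ZG']] HZ] irr] := HC1 i ik; split=> //.
  exists (C i); last by move=> F'; split=> [CF'|[]//]; split=> //; have /AG[] := Cp _ ik _ CF'.
  exists (fun g => G g \/ G' g); split=> [g [/Gh|/Gh']//|F'].
  split=> [/HZ[/AG[p1 H1] /ZG'[p2 H2]]|[p H]].
    by split=> // g [/H1|/H2].
  apply/HZ; split; [apply/AG|apply/ZG']; split=> // g Gg; apply: H; [by left|by right].
rewrite ltnS => ik; rewrite ik; case: (ltnP i k) => ik'; first exact: HC2.
split; first by move=> F' /(Cp _ ik)/AG[].
by exists F => // /(Cp _ ik).
Qed.

End Chains.

(** * Chains made of coordinate subfamilies *)

Section Lower.
Variables (K : closedFieldType) (n d : nat).
Local Notation N := #|{: monom_of_deg n d}|.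
Local Notation pcoord := (@pcoord K n d).
Variables (M : nat) (Q : 'I_N -> {mpoly K[M]}) (D : nat) (w : 'I_D -> 'I_M).
Variables (h : {mpoly K[M]}) (A : pset K n).
Hypotheses (winj : injective w) (Ap : psubset A (ppoint d)) (h0 : h@_0 != 0).
Hypothesis AQ : forall t, h.@[t] != 0 ->
  exists2 F, A F & forall i, pcoord F i = (Q i).@[t].
Hypothesis Qfree : forall (c0 : K) (c : 'I_D -> K),
  (forall i, c0 * (Q i)@_0 + \sum_j c j * (Q i)@_(U_(w j)) = 0) ->
  c0 = 0 /\ forall j, c j = 0.

Let W (i : nat) : {set 'I_M} := [set w j | j : 'I_D & (j < i)%N].

Let S (i : nat) : pset K n := fun F => A F /\ exists t,
  [/\ forall j, j \notin W i -> t j = 0, h.@[t] != 0 & forall k, pcoord F k = (Q k).@[t]].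

(** [A] is not assumed closed, so the hull is intersected with [A] to obtain a relatively closed
    set. *)
Let C (i : nat) : pset K n := fun F => A F /\ hull d (S i) F.

Let h_nz i : exists2 m, msub (W i) m & h@_m != 0.
Proof. by exists 0%MM => //; apply/msubP => j _; rewrite mnm0E. Qed.

Let S_point i t : (forall j, j \notin W i -> t j = 0) -> h.@[t] != 0 ->
  exists2 F, S i F & forall k, pcoord F k = (Q k).@[t].
Proof.
by move=> tW ht; have [F AF FQ] := AQ ht; exists F => //; split=> //; exists t.
Qed.

Let S_vanish i g : (forall m, msub (W i) m -> (pull Q g)@_m = 0) -> vanish (S i) g.
Proof.
move=> g0 F [_ [t [tW _ FQ]]]; rewrite (meval_eq _ FQ) -pull_eval.
exact: meval_mcoeff0_on g0 _ tW.
Qed.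

(** The guard [h] ensures membership in [A]. Being nonzero at the origin, it vanishes identically on
    no slice, so a pull-back that vanishes wherever [h] does not is zero on the slice. *)
Let S_pull i g : vanish (S i) g -> forall m, msub (W i) m -> (pull Q g)@_m = 0.
Proof.
move=> Sg m mW; apply/eqP; apply: contraT => nz.
have nzg : exists2 m, msub (W i) m & (pull Q g)@_m != 0 by exists m.
have [t tW] := meval_neq0_on (msub_nzM nzg (h_nz i)).
rewrite mevalM mulf_eq0 negb_or => /andP[gt ht].
have [F SF FQ] := S_point tW ht.
by case/eqP: gt; rewrite pull_eval -(meval_eq _ FQ); apply: Sg.
Qed.

Let SC i : psubset (S i) (C i).
Proof.
move=> F SF; split; first by case: SF.
by apply: sub_hull SF => F' [/Ap].
Qed.

Let C_irr i : irreducible_pset d (C i).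
Proof.
split.
  have [t tW ht] := meval_neq0_on (h_nz i).
  by have [F /SC CF _] := S_point tW ht; exists F.
move=> Z1 Z2 [G1 [Gh1 ZG1]] [G2 [Gh2 ZG2]] ZZ.
pose bad (G : {mpoly K[N]} -> Prop) := exists2 g, G g &
  exists2 m, msub (W i) m & (pull Q g)@_m != 0.
have good Z G (Gh : forall g, G g -> exists e, g \is e.-homog)
    (ZG : forall F, Z F <-> ppoint d F /\ forall g, G g -> g.@[pcoord F] = 0) :
    ~ bad G -> psubset (C i) Z.
  move=> nb F [AF [pF HF]]; apply/ZG; split=> // g Gg.
  have [e gh] := Gh g Gg; apply: HF gh _; apply: S_vanish => m mW.
  by apply/eqP; apply: contraT => nz; case: nb; exists g => //; exists m.
case: (classic (bad G1)) => [[g1 Gg1 b1]|nb]; last by left; apply: good nb.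
case: (classic (bad G2)) => [[g2 Gg2 b2]|nb]; last by right; apply: good nb.
have [t tW] := meval_neq0_on (msub_nzM (msub_nzM b1 b2) (h_nz i)).
rewrite !mevalM !mulf_eq0 !negb_or => /andP[/andP[t1 t2] ht].
have [F /SC CF FQ] := S_point tW ht.
case: (ZZ F CF) => [/ZG1[_ /(_ g1 Gg1)]|/ZG2[_ /(_ g2 Gg2)]] /eqP.
  by rewrite (meval_eq _ FQ) -pull_eval (negbTE t1).
by rewrite (meval_eq _ FQ) -pull_eval (negbTE t2).
Qed.

(** Coefficients of linear forms dual to the value and the partial derivatives at the origin:
    [Qfree] gives their matrix full row rank, hence a right inverse. *)
Let dual : exists B : 'M[K]_(N, D.+1), forall (k k' : 'I_D.+1),
  \sum_i (if unlift ord0 k is Some j then (Q i)@_(U_(w j)) else (Q i)@_0) * B i k' =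
  (k == k')%:R.
Proof.
pose T : 'M[K]_(D.+1, N) := \matrix_(k, i)
  (if unlift ord0 k is Some j then (Q i)@_(U_(w j)) else (Q i)@_0).
suff /row_freeP[B TB] : row_free T.
  exists B => k k'; have /matrixP/(_ k k') := TB; rewrite !mxE => <-.
  by apply: eq_bigr => i _; rewrite !mxE.
apply: inj_row_free => v vT.
have [|c00 cj0] := Qfree (c0 := v 0 ord0) (c := fun j => v 0 (lift ord0 j)).
  move=> i; have /rowP/(_ i) := vT; rewrite !mxE big_ord_recl mxE unlift_none => E.
  rewrite -[RHS]E; congr (_ + _); apply: eq_bigr => j _.
  by rewrite mxE liftK.
by apply/rowP => k; rewrite mxE; case: (unliftP ord0 k) => [j|] ->.
Qed.

(* p is X^a up to terms of higher degree, as far as the variables in W i are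
   concerned. *)
Let lowest i (p : {mpoly K[M]}) (a : 'X_{1..M}) :=
  forall m, msub (W i) m -> (mdeg m <= mdeg a)%N -> p@_m = (a == m)%:R.

Let lowestM i p q a b : lowest i p a -> lowest i q b -> lowest i (p * q) (a + b)%MM.
Proof.
move=> Hp Hq m mW; rewrite mdegD => ml; rewrite -mcoeffX mpolyXD !mcoeffM.
apply: eq_bigr => -[u v] /= /eqP E.
have /andP[uW vW] : msub (W i) u && msub (W i) v by rewrite -msubD -E.
have dE : mdeg m = (mdeg u + mdeg v)%N by have := congr1 (@mdeg M) E; rewrite mdegD.
rewrite !mcoeffX.
case: (leqP (mdeg u) (mdeg a)) => ua; case: (leqP (mdeg v) (mdeg b)) => vb.
- by rewrite Hp // Hq.
- have ua' : (mdeg u < mdeg a)%N by lia.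
  rewrite Hp //; case: eqP => [E'|_]; last by rewrite !mul0r.
  by move: ua'; rewrite E' ltnn.
- have vb' : (mdeg v < mdeg b)%N by lia.
  rewrite [q@_v]Hq //; case: (b =P _) => [E'|_]; last by rewrite !mulr0.
  by move: vb'; rewrite E' ltnn.
- lia.
Qed.

Let lowest1 i : lowest i 1 0%MM.
Proof. by move=> m _ _; rewrite mcoeff1 eq_sym. Qed.

Let lowestX i p a k : lowest i p a -> lowest i (p ^+ k) (a *+ k)%MM.
Proof.
move=> Hp; elim: k => [|k IH]; first by rewrite expr0 mulm0n; exact: lowest1.
by rewrite exprS mulmS; exact: lowestM.
Qed.

Let lowest_prod i (I : finType) (P : pred I) (p : I -> {mpoly K[M]}) (a : I -> 'X_{1..M}) :
  (forall x, P x -> lowest i (p x) (a x)) ->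
  lowest i (\prod_(x | P x) p x) (\sum_(x | P x) a x)%MM.
Proof.
move=> H; elim/big_rec2: _ => [|x m q Px]; first exact: lowest1.
by apply: lowestM; apply: H.
Qed.

Let W_card i : (#|W i| <= i)%N.
Proof.
rewrite /W; apply: leq_trans (leq_imset_card _ _) _.
case: (leqP D i) => Di; first by apply: leq_trans Di; rewrite -[X in (_ <= X)%N]card_ord max_card.
by rewrite -sum1dep_card (big_ord_narrow (ltnW Di)) sum1_card card_ord.
Qed.

(** On the slice the dual linear form [Y ord0] pulls back to [1] and the others to the variables
    [w x], up to higher order. Monomials in them, homogenised to degree [j * e] by [Y ord0], have
    distinct lowest terms, so the coefficients of a relation vanish in order of increasing lowest
    degree. *)
Let C_indep j e : (j <= D)%N -> indep d (C j) (j * e) {ffun 'I_j -> 'I_e.+1}.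
Proof.
move=> jD; have [B HB] := dual.
pose Y k : {mpoly K[N]} := \sum_i B i k *: 'X_i.
have Yh k : Y k \is 1.-homog.
  by apply: rpred_sum => i _; apply: rpredZ; rewrite dhomogX /= mdeg1.
have YQ k : pull Q (Y k) = \sum_i B i k *: Q i.
  by rewrite pull_sum; apply: eq_bigr => i _; rewrite pullXU.
have Y0 k : (pull Q (Y k))@_0 = (k == ord0)%:R.
  rewrite YQ raddf_sum /= eq_sym -HB unlift_none; apply: eq_bigr => i _.
  by rewrite mcoeffZ mulrC.
have YU k x : (pull Q (Y k))@_(U_(w x)) = (k == lift ord0 x)%:R.
  rewrite YQ raddf_sum /= eq_sym -HB liftK; apply: eq_bigr => i _.
  by rewrite mcoeffZ mulrC.
have low0 : lowest j (pull Q (Y ord0)) 0%MM.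
  move=> m _; rewrite mdeg0 leqn0 mdeg_eq0 => /eqP ->.
  by rewrite Y0 !eqxx.
have lowS x : lowest j (pull Q (Y (lift ord0 x))) U_(w x)%MM.
  move=> m mW; rewrite mdeg1 leq_eqVlt ltnS leqn0 mdeg_eq0 => /orP[|/eqP ->].
    case/mdeg1P => y /eqP E; move: mW; rewrite E => /msubP mW.
    have /imsetP[x' _ ->] : y \in W j.
      by apply: contraT => /mW; rewrite mnm1E eqxx.
    by rewrite YU eq_mnm1 (inj_eq winj) (inj_eq lift_inj).
  by rewrite Y0 mnm1_eq0.
pose wd x := widen_ord jD x.
pose sz (a : {ffun 'I_j -> 'I_e.+1}) := (\sum_x a x)%N.
pose mon (a : {ffun 'I_j -> 'I_e.+1}) : 'X_{1..M} := (\sum_x U_(w (wd x)) *+ a x)%MM.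
have sz_le a : (sz a <= j * e)%N.
  have <- : (\sum_(x < j) e = j * e)%N by rewrite sum_nat_const card_ord.
  by apply: leq_sum => x _; rewrite -ltnS.
have monE a x : mon a (w (wd x)) = a x.
  rewrite mnm_sumE (bigD1 x) //= mulmnE mnm1E eqxx mul1n big1 ?addn0 // => y ne.
  rewrite mulmnE mnm1E (inj_eq winj) /wd -(inj_eq val_inj) /= (inj_eq val_inj).
  by rewrite (negbTE ne).
have mon_inj : injective mon.
  by move=> a b E; apply/ffunP => x; apply/val_inj; rewrite /= -!monE E.
have mdeg_mon a : mdeg (mon a) = sz a.
  by rewrite mdeg_sum; apply: eq_bigr => x _; rewrite mdegMn mdeg1 mul1n.
have monW a : msub (W j) (mon a).
  apply/msubP => y yW; rewrite mnm_sumE big1 // => x _; rewrite mulmnE mnm1E.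
  case: eqP => // E; case/negP: yW; rewrite -E; apply: imset_f.
  by rewrite inE /=.
pose g (a : {ffun 'I_j -> 'I_e.+1}) : {mpoly K[N]} :=
  Y ord0 ^+ (j * e - sz a) * \prod_x Y (lift ord0 (wd x)) ^+ a x.
have YXh k c : Y k ^+ c \is c.-homog by have := dhomogMn c (Yh k); rewrite mul1n.
have gh a : g a \is (j * e).-homog.
  rewrite -(subnK (sz_le a)); apply: dhomogM => //.
  rewrite /sz; elim/big_rec2: _ => [|x q c _ IH]; first exact: dhomog1.
  exact: dhomogM.
have glow a : lowest j (pull Q (g a)) (mon a).
  have m0 : (0 *+ (j * e - sz a) = 0 :> 'X_{1..M})%MM.
    by apply/mnmP => x; rewrite mulmnE mnm0E.
  rewrite /g pullM pullXn pull_prod -[mon a]add0m -m0.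
  apply: lowestM; first exact: lowestX.
  by apply: lowest_prod => x _; rewrite pullXn; apply: lowestX.
exists g; split=> // c Cv.
have /S_pull P0 : vanish (S j) (\sum_a c a *: g a) by move=> F /SC; apply: Cv.
have {P0} eqs a : \sum_b c b * (pull Q (g b))@_(mon a) = 0.
  rewrite -[RHS](P0 _ (monW a)) pull_sum raddf_sum /=; apply: eq_bigr => b _.
  by rewrite mcoeffZ.
move=> a; move: {2}(sz a) (erefl (sz a)) => k; elim/ltn_ind: k a => k IH a ak.
have := eqs a; rewrite (bigD1 a) //= glow // eqxx mulr1 big1 ?addr0 // => b ne.
case: (ltnP (sz b) k) => bk; first by rewrite (IH _ bk _ erefl) mul0r.
by rewrite glow ?mdeg_mon ?ak // (inj_eq mon_inj) (negbTE ne) mulr0.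
Qed.

(** If [C i.+1] were contained in [C i], its [e.+1 ^ i.+1] independent forms would have to fit into
    the growth of order [i] allowed by the parameters of [C i]. *)
Lemma family_chain : krull_chain d A D.
Proof.
exists C; split=> i iD.
  split; last exact: C_irr.
  by exists (hull d (S i)) => //; apply: hull_closed.
have WW : {subset W i <= W i.+1}.
  move=> x /imsetP[j ji ->]; apply: imset_f; rewrite inE in ji.
  by rewrite inE ltnS ltnW.
have SS : psubset (S i) (S i.+1).
  move=> F [AF [t [tW ht FQ]]]; split=> //; exists t; split=> // j jW.
  by apply: tW; apply: contra jW; exact: WW.
have CC : psubset (C i) (C i.+1).
  move=> F [AF [pF HF]]; split=> //; split=> // e g gh gS.
  by apply: HF gh _ => F' /SS; apply: gS.
split=> //; apply: NNPP => H.
have CC' : psubset (C i.+1) (C i).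
  by move=> F CF; apply: NNPP => nCF; apply: H; exists F.
have [c Hc] : exists c, forall e (I : finType),
    indep d (C i) e I -> (#|I| <= (c * e).+1 ^ #|W i|)%N.
  apply: (@indep_le_growth _ _ _ _ Q) => e g gh g0 F [_ HF].
  by apply: (vanish_hull gh (S_vanish g0)).
have : (i.+1 <= #|W i|)%N; last by rewrite leqNgt ltnS W_card.
apply: (@growth_exponent_le (c * i.+1)) => e.
have := Hc _ _ (indep_sub CC' (C_indep e iD)).
by rewrite card_ffun !card_ord mulnA.
Qed.
End Lower.

(** * Families of forms with generic coefficients *)

Section Family.
Variables (K : closedFieldType) (n d : nat) (J : finType) (e : J -> nat).
Hypothesis ed : forall a, (e a <= d)%N.

(** Coordinates on the affine space of tuples of forms of degrees [e a]; the bound [d.+1] serves to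
    make the type finite. *)
Definition fvar := {x : J * 'X_{1..n < d.+1} | mdeg x.2 == e x.1}.
Definition fidx (x : fvar) : J := (val x).1.
Definition fmon (x : fvar) : 'X_{1..n} := val (val x).2.

Lemma fmon_deg x : mdeg (fmon x) = e (fidx x).
Proof. exact/eqP/(valP x). Qed.

Lemma fvar_ex a m : mdeg m = e a -> exists2 x, fidx x = a & fmon x = m.
Proof.
move=> ma; have ml : (mdeg m < d.+1)%N by rewrite ma ltnS.
have Px : mdeg (a, BMultinom ml).2 == e (a, BMultinom ml).1 by apply/eqP.
by exists (exist _ (a, BMultinom ml) Px).
Qed.

Lemma fvar_inj x y : fidx x = fidx y -> fmon x = fmon y -> x = y.
Proof.
case: x y => [[a m] Px] [[b m'] Py]; rewrite /fidx /fmon /= => E E'.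
by apply/val_inj; rewrite /= E (val_inj E').
Qed.

Local Notation M := #|{: fvar}|.
Local Notation R := {mpoly K[M]}.
Local Notation N := #|{: monom_of_deg n d}|.

Definition monc (i : 'I_N) : 'X_{1..n} := val (val (enum_val i)).

Lemma monc_ex m : mdeg m = d -> exists i, monc i = m.
Proof.
move=> md; have ml : (mdeg m < d.+1)%N by rewrite md.
have Pm : mdeg (BMultinom ml) == d by apply/eqP.
exists (enum_rank (exist _ (BMultinom ml) Pm : monom_of_deg n d)).
by rewrite /monc enum_rankK.
Qed.

Definition cvar (x : fvar) : R := 'X_(enum_rank x).

Definition cder (x : fvar) (G : R) : R := G^`M(enum_rank x).

Definition spec (t : 'I_M -> K) (P : {mpoly R[n]}) : {mpoly K[n]} :=
  map_mpoly (meval t) P.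

HB.instance Definition _ t := GRing.RMorphism.copy (spec t) (map_mpoly (meval t)).

(** The coefficients taken by [spec0] and [tang x] are in the parameters: value and [x]-derivative
    at the origin of the parameter space. *)
Definition spec0 (P : {mpoly R[n]}) : {mpoly K[n]} := map_mpoly (mcoeff 0%MM) P.

HB.instance Definition _ := GRing.RMorphism.copy spec0 (map_mpoly (mcoeff 0%MM)).

Definition tang (x : fvar) (P : {mpoly R[n]}) : {mpoly K[n]} :=
  map_mpoly (mcoeff U_(enum_rank x)%MM) P.

HB.instance Definition _ x := GRing.Additive.copy (tang x) (map_mpoly (mcoeff U_(enum_rank x)%MM)).

Lemma specE t P m : (spec t P)@_m = (P@_m).@[t].
Proof. exact: mcoeff_map_mpoly. Qed.

Lemma spec0E P m : (spec0 P)@_m = (P@_m)@_0.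
Proof. exact: mcoeff_map_mpoly. Qed.

Lemma tangE x P m : (tang x P)@_m = (P@_m)@_(U_(enum_rank x)).
Proof. exact: mcoeff_map_mpoly. Qed.

Lemma mcoeffUM (p q : R) j :
  (p * q)@_(U_(j)) = p@_(U_(j)) * q@_0 + p@_0 * q@_(U_(j)).
Proof.
have E (f : R) : f@_(U_(j)) = (f^`M(j))@_0 by rewrite mcoeff_mderiv mnm0E add0m.
by rewrite E mderivM raddfD /= !rmorphM /= -!E.
Qed.

Lemma tangM x P P' : tang x (P * P') = tang x P * spec0 P' + spec0 P * tang x P'.
Proof.
apply/mpolyP => m; rewrite mcoeffD tangE.
have /= -> := congr1 (mcoeff U_(enum_rank x)) (mcoeffM P P' m).
have E1 := mcoeffM (tang x P) (spec0 P') m.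
have E2 := mcoeffM (spec0 P) (tang x P') m.
apply: (etrans _ (esym (f_equal2 +%R E1 E2))).
rewrite (raddf_sum (mcoeff U_(enum_rank x))) -big_split.
apply: eq_bigr => -[u v] _.
apply: (etrans (mcoeffUM _ _ _)).
by rewrite /= -!tangE -!spec0E.
Qed.

Section Base.
Variable p : J -> {mpoly K[n]}.
Hypothesis ph : forall a, p a \is (e a).-homog.

(** The generic form of degree [e a], translated so that the origin of the parameter space gives the
    base form [p a]. *)
Definition gen a : {mpoly R[n]} := map_mpoly (@mpolyC M K) (p a) +
  \sum_(x : fvar | fidx x == a) cvar x *: 'X_[fmon x].

Lemma mcoeff_gen_var x : (gen (fidx x))@_(fmon x) = ((p (fidx x))@_(fmon x))%:MP + cvar x.
Proof.
rewrite /gen mcoeffD mcoeff_map_mpoly /= raddf_sum /= (bigD1 x) //= mcoeffZ mcoeffX.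
rewrite eqxx mulr1 big1 ?addr0 // => y /andP[/eqP E ne].
rewrite mcoeffZ mcoeffX; case: eqP => [E'|]; last by rewrite mulr0.
by case/eqP: ne; apply: fvar_inj.
Qed.

Lemma gen_homog a : gen a \is (e a).-homog.
Proof.
apply: rpredD.
  apply/dhomogP => m; rewrite mcoeff_msupp mcoeff_map_mpoly /=.
  rewrite mpolyC_eq0 => nz; apply: (dhomog_mf (ph a)).
  by rewrite mcoeff_msupp.
by apply: rpred_sum => x /eqP <-; apply: rpredZ; rewrite dhomogX /= fmon_deg.
Qed.

Lemma spec_gen_surj (G : J -> {mpoly K[n]}) : (forall a, G a \is (e a).-homog) ->
  exists t, forall a, spec t (gen a) = G a.
Proof.
move=> Gh; exists (fun j => (G (fidx (enum_val j)) - p (fidx (enum_val j)))@_(fmon (enum_val j))).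
move=> a; apply/mpolyP => m; rewrite specE.
case: (eqVneq (mdeg m) (e a)) => [/fvar_ex[x <- <-]|ne]; last first.
  by rewrite (dhomog_nemf_coeff (gen_homog a) ne) meval0 (dhomog_nemf_coeff (Gh a) ne).
rewrite mcoeff_gen_var mevalD mevalC /cvar mevalXU enum_rankK mcoeffB.
by rewrite addrC subrK.
Qed.

Lemma spec_gen_homog t a : spec t (gen a) \is (e a).-homog.
Proof.
apply/dhomogP => m; rewrite mcoeff_msupp specE.
by apply: contraNeq => /(dhomog_nemf_coeff (gen_homog a)) ->; rewrite meval0.
Qed.

Lemma spec0_gen a : spec0 (gen a) = p a.
Proof.
apply/mpolyP => m; rewrite spec0E.
case: (eqVneq (mdeg m) (e a)) => [/fvar_ex[x <- <-]|ne]; last first.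
  by rewrite (dhomog_nemf_coeff (gen_homog a) ne) mcoeff0 (dhomog_nemf_coeff (ph a) ne).
rewrite mcoeff_gen_var mcoeffD mcoeffC eqxx mulr1 /cvar mcoeffX mnm1_eq0.
by rewrite addr0.
Qed.

Lemma tang_gen x a : tang x (gen a) = if fidx x == a then 'X_[fmon x] else 0.
Proof.
apply/mpolyP => m; rewrite tangE.
case: (eqVneq (mdeg m) (e a)) => [/fvar_ex[y <- <-]|ne]; last first.
  rewrite (dhomog_nemf_coeff (gen_homog a) ne) mcoeff0; case: eqP => [E|_]; last by rewrite mcoeff0.
  rewrite mcoeffX; case: eqP => // E'; case/eqP: ne.
  by rewrite -E' fmon_deg E.
rewrite mcoeff_gen_var mcoeffD mcoeffC mnm1_eq0 mulr0 add0r /cvar mcoeffXU.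
rewrite (inj_eq enum_rank_inj) eq_sym.
case: (eqVneq x y) => [->|ne]; first by rewrite eqxx mcoeffX eqxx.
case: eqP => [E|_]; last by rewrite mcoeff0.
rewrite mcoeffX; case: eqP => // E'.
by case/eqP: ne; apply: fvar_inj.
Qed.

End Base.

Section Derivation.
Variable del : J -> {mpoly R[n]}.

(** The vector field on the parameter space that moves each generic form [gen a] with velocity
    [del a]. *)
Definition vf (G : R) : R := \sum_x (del (fidx x))@_(fmon x) * cder x G.

Definition der (P P' : {mpoly R[n]}) := forall m, vf P@_m = P'@_m.

Lemma vfD G G' : vf (G + G') = vf G + vf G'.
Proof.
by rewrite /vf -big_split; apply: eq_bigr => x _; rewrite /cder mderivD mulrDr.
Qed.

Lemma vf0 : vf 0 = 0.
Proof. by rewrite /vf big1 // => x _; rewrite /cder mderiv0 mulr0. Qed.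

Lemma vf_sum (I : Type) (r : seq I) (P : pred I) (F : I -> R) :
  vf (\sum_(i <- r | P i) F i) = \sum_(i <- r | P i) vf (F i).
Proof. exact: (big_morph vf vfD vf0). Qed.

Lemma vfM G G' : vf (G * G') = vf G * G' + G * vf G'.
Proof.
rewrite /vf big_distrl big_distrr -big_split; apply: eq_bigr => x _ /=.
by rewrite /cder mderivM; ring.
Qed.

Lemma vfC c : vf c%:MP = 0.
Proof. by rewrite /vf big1 // => x _; rewrite /cder mderivC mulr0. Qed.

Lemma vfZ c G : vf (c *: G) = c *: vf G.
Proof. by rewrite -mul_mpolyC vfM vfC mul0r add0r mul_mpolyC. Qed.

Lemma derM P P' Q Q' : der P P' -> der Q Q' -> der (P * Q) (P' * Q + P * Q').
Proof.
move=> HP HQ m; rewrite mcoeffD !mcoeffM vf_sum -big_split.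
by apply: eq_bigr => -[u v] /= _; rewrite vfM HP HQ.
Qed.

Lemma der_sum (I : finType) (P P' : I -> {mpoly R[n]}) :
  (forall i, der (P i) (P' i)) -> der (\sum_i P i) (\sum_i P' i).
Proof.
by move=> H m; rewrite !raddf_sum vf_sum; apply: eq_bigr => i _; rewrite H.
Qed.

Lemma der_eigenM P Q (a b : K) : der P (a%:MP *: P) -> der Q (b%:MP *: Q) ->
  der (P * Q) ((a + b)%:MP *: (P * Q)).
Proof.
move=> HP HQ m; rewrite (derM HP HQ); congr (_@__).
by rewrite -!mul_mpolyC !mpolyCD; ring.
Qed.

Lemma der1 : der 1 (0%:MP *: 1).
Proof.
move=> m; rewrite mcoeff1 mcoeffZ mul0r.
by case: eqP => _; [rewrite -mpolyC1 vfC | rewrite vf0].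
Qed.

Lemma der_eigen_prod (I : finType) (A : pred I) (P : I -> {mpoly R[n]}) (c : I -> K) :
  (forall i, A i -> der (P i) ((c i)%:MP *: P i)) ->
  der (\prod_(i | A i) P i) ((\sum_(i | A i) c i)%:MP *: \prod_(i | A i) P i).
Proof.
move=> H; elim/big_ind2: _ => [|P1 c1 P2 c2|]; [exact: der1|exact: der_eigenM|exact: H].
Qed.

Lemma der_gen p a : (forall a, p a \is (e a).-homog) -> del a \is (e a).-homog ->
  der (gen p a) (del a).
Proof.
move=> ph dh m; case: (eqVneq (mdeg m) (e a)) => [/fvar_ex[x <- <-]|ne]; last first.
  by rewrite (dhomog_nemf_coeff (gen_homog ph a) ne) vf0 (dhomog_nemf_coeff dh ne).
rewrite mcoeff_gen_var vfD vfC add0r /vf (bigD1 x) //= /cder /cvar mderivX mnm1E eqxx.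
rewrite scale1r (_ : (U_(_) - U_(_))%MM = 0%MM); last first.
  by apply/mnmP => j; rewrite mnmBE subnn mnm0E.
rewrite mpolyX0 mulr1 big1 ?addr0 // => y ne.
by rewrite mderivX mnm1E (inj_eq enum_rank_inj) eq_sym (negbTE ne) scale0r mulr0.
Qed.

(** Euler's identity along the field: once all coordinates are scaled by [c], every form in them is
    an eigenvector, so one field for the family serves all pull-backs. *)
Lemma vf_pull (Q : 'I_N -> R) (c : K) k g :
  (forall i, vf (Q i) = c *: Q i) -> g \is k.-homog ->
  vf (pull Q g) = (c * k%:R) *: pull Q g.
Proof.
move=> HQ /dhomogP gh; rewrite pullE vf_sum scaler_sumr !big_seq.
apply: eq_bigr => m mg; rewrite vfZ scalerA mulrC -scalerA; congr (_ *: _).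
have /= <- := gh m mg; rewrite mdegE natr_sum mulr_sumr.
elim/big_rec2: _ => [|i x q _ IH]; first by rewrite scale0r -mpolyC1 vfC.
rewrite vfM IH scalerDl -scalerAr; congr (_ + _).
rewrite scalerAl; congr (_ * _).
elim: (m i) => [|l IHl]; first by rewrite expr0 mulr0 scale0r -mpolyC1 vfC.
rewrite exprS vfM HQ IHl -scalerAl -scalerAr -scalerDl; congr (_ *: _).
by rewrite -natr1 mulrDr mulr1 addrC.
Qed.

End Derivation.

Lemma der_add del1 del2 P P1 P2 : der del1 P P1 -> der del2 P P2 ->
  der (fun a => del1 a + del2 a) P (P1 + P2).
Proof.
move=> H1 H2 m; rewrite mcoeffD -H1 -H2 /vf -big_split.
by apply: eq_bigr => x _; rewrite mcoeffD mulrDl.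
Qed.

Section Bounds.
Variable Psi : {mpoly R[n]}.
Hypothesis Psih : Psi \is d.-homog.
Variable W : {set fvar}.
Variable A : pset K n.
Hypothesis Ap : psubset A (ppoint d).

Let Q (i : 'I_N) : R := Psi@_(monc i).

Let pcoord_spec t i : pcoord (spec t Psi) i = (Q i).@[t].
Proof. exact: specE. Qed.

(** The parameters outside [W] are the ones to remove. Their fields are the identity matrix at the
    origin and scale [Psi], so a pull-back that vanishes on the slice [W] is zero. *)
Lemma family_chain_le (charK0 : [pchar K] =i pred0)
    (del : fvar -> J -> {mpoly R[n]}) (ev : fvar -> K) (B : pset K n) k :
  (forall x y, x \notin W -> y \notin W ->
     (spec0 (del x (fidx y)))@_(fmon y) = (x == y)%:R) ->
  (forall x, x \notin W -> der (del x) Psi ((ev x)%:MP *: Psi)) ->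
  (forall F, B F -> exists t, F = spec t Psi) -> psubset A (hull d B) ->
  krull_chain d A k -> (k <= #|W|)%N.
Proof.
move=> del0 delP surj AB; pose W' : {set 'I_M} := [set j | enum_val j \in W].
have -> : #|W| = #|W'|.
  rewrite -(card_imset _ enum_rank_inj); apply: eq_card => j; rewrite inE.
  apply/imsetP/idP => [[x xW ->]|jW]; first by rewrite enum_rankK.
  by exists (enum_val j) => //; rewrite enum_valK.
apply: (@chain_le _ _ _ _ Q) => // k' g gh g0.
suff Bg : vanish B g by move=> F /AB; apply: vanish_hull gh Bg F.
move=> F /surj[t ->].
suff -> : g.@[pcoord (spec t Psi)] = (pull Q g).@[t].
  suff -> : pull Q g = 0 by rewrite meval0.
  apply: (@vector_fields_eq0 _ charK0 _ W'
    (fun a b => (del (enum_val a) (fidx (enum_val b)))@_(fmon (enum_val b)))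
    (fun a => ev (enum_val a) * k'%:R)) => //.
  - move=> a b; rewrite !inE => aW bW.
    by have := del0 _ _ aW bW; rewrite spec0E (inj_eq enum_val_inj).
  - move=> a; rewrite inE => aW; rewrite -(@vf_pull (del (enum_val a))) //.
      rewrite /vf (reindex (fun j : 'I_M => enum_val j)) /=; last first.
        by apply: onW_bij; exact: enum_val_bij.
      by apply: eq_bigr => b _; rewrite /cder enum_valK.
    by move=> i; rewrite (delP _ aW) mcoeffZ mul_mpolyC.
by rewrite pull_eval; apply: meval_eq => i; rewrite pcoord_spec.
Qed.

Lemma family_chain_ge :
  (forall t, spec t Psi != 0 -> A (spec t Psi)) ->
  (forall (c0 : K) (c : fvar -> K), (forall x, x \notin W -> c x = 0) ->
     c0 *: spec0 Psi + \sum_x c x *: tang x Psi = 0 ->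
     c0 = 0 /\ forall x, c x = 0) ->
  krull_chain d A #|W|.
Proof.
move=> AP free.
have [m nz] : exists m, (spec0 Psi)@_m != 0.
  apply: NNPP => H; have [||/eqP] := free 1 (fun=> 0) => //.
    rewrite big1 => [|x _]; last by rewrite scale0r.
    rewrite addr0 scale1r; apply/mpolyP => m; rewrite mcoeff0; apply/eqP.
    by apply: contraT => nz; case: H; exists m.
  by rewrite oner_eq0.
have md : mdeg m = d.
  apply/eqP; apply: contraNT nz => ne.
  by rewrite spec0E (dhomog_nemf_coeff Psih ne) mcoeff0.
pose w (i : 'I_#|W|) : 'I_M := enum_rank (enum_val i).
(* The coefficient [Psi@_m], nonzero at the origin, is the guard: where it is nonzero, so is the
   specialised form, which then lies in [A]. *)
apply: (@family_chain _ _ _ _ Q _ w Psi@_m) => //.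
- by move=> i j /enum_rank_inj/enum_val_inj.
- by rewrite spec0E in nz.
- move=> t ht; exists (spec t Psi) => //; apply: AP.
  apply: contraNneq ht => E; have := congr1 (mcoeff m) E.
  by rewrite specE mcoeff0 => ->.
move=> c0 c E; pose c' x := if insub x is Some y
  then c (enum_rank_in (valP (y : {x | x \in W})) (val y)) else 0.
have c'E i : c' (enum_val i) = c i.
  rewrite /c'; case: insubP => [u _ uE|]; last by rewrite enum_valP.
  by congr c; apply: enum_val_inj; rewrite enum_rankK_in -?uE ?(valP u).
have [||-> c0'] := free c0 c' => //.
- by move=> x xW; rewrite /c' insubN.
- apply/mpolyP => m'; rewrite mcoeffD mcoeff0 mcoeffZ [(\sum_x _)@__]raddf_sum /=.
  case: (eqVneq (mdeg m') d) => [/monc_ex[i <-]|ne]; last first.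
    rewrite spec0E (dhomog_nemf_coeff Psih ne) mcoeff0 mulr0 add0r.
    rewrite big1 // => x _.
    by rewrite mcoeffZ tangE (dhomog_nemf_coeff Psih ne) mcoeff0 mulr0.
  rewrite -[RHS](E i) spec0E; congr (_ + _).
  rewrite (bigID (mem W)) /= [X in _ + X]big1 ?addr0; last first.
    by move=> x xW; rewrite /c' insubN // scale0r mcoeff0.
  rewrite big_enum_val; apply: eq_bigr => j _.
  by rewrite mcoeffZ c'E tangE.
- by split=> // i; rewrite -c'E c0'.
Qed.
End Bounds.
End Family.

(** * Secant sets of reducible forms *)

Lemma card_bmnm n d k : (k <= d)%N ->
  #|[pred m : 'X_{1..n.+1 < d.+1} | mdeg m == k]| = 'C(k + n, k).
Proof.
move=> kd; rewrite -size_basis cardE -(size_map val); apply: perm_size.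
apply: uniq_perm; first by rewrite map_inj_uniq ?enum_uniq //; apply: val_inj.
  exact: uniq_basis.
move=> m; rewrite -basis_cover; apply/mapP/idP => [[b]|mk].
  by rewrite mem_enum inE => bk ->.
have ml : (mdeg m < d.+1)%N by rewrite (eqP mk).
by exists (BMultinom ml) => //; rewrite mem_enum inE.
Qed.

Lemma card_monom_of_deg n d : (0 < n)%N -> #|{: monom_of_deg n d}| = nforms n d.
Proof.
case: n => // n _; rewrite card_sig card_bmnm // /nforms.
rewrite addnS !subn1 /=; rewrite -bin_sub ?leq_addr //.
by rewrite addKn.
Qed.

Lemma card_fvar n d (J : finType) (e : J -> nat) : (0 < n)%N ->
  (forall a, e a <= d)%N -> #|{: fvar n d e}| = (\sum_a nforms n (e a))%N.
Proof.
case: n => // n _ ed; rewrite card_sig -sum1_card.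
rewrite (eq_bigl (fun x : J * 'X_{1..n.+1 < d.+1} => mdeg x.2 == e x.1)) //.
rewrite -(pair_big_dep xpredT (fun a (m : 'X_{1..n.+1 < d.+1}) => mdeg m == e a) (fun _ _ => 1%N)) /=.
apply: eq_bigr => a _; rewrite sum1_card card_bmnm // /nforms.
rewrite addnS !subn1 /= -bin_sub ?leq_addr //.
by rewrite addKn.
Qed.

Section Secants.
Variables (K : closedFieldType) (n : nat) (lam : seq nat).
Hypotheses (n1 : (1 < n)%N) (lam0 : (0 < size lam)%N) (lam1 : all (leq 1) lam).
Local Notation d := (sumn lam).
Local Notation X := (reducible_forms K n lam).
Local Notation r := (size lam).

(** Unlike the points that span a secant, summands may vanish or be proportional. The set is
    therefore the image of a full affine space, with zero removed. *)
Definition sums (l : nat) : pset K n := fun F => F != 0 /\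
  exists2 G : 'I_l -> 'I_r -> {mpoly K[n]},
    (forall j i, G j i \is (nth 0%N lam i).-homog) & F = \sum_j \prod_i G j i.

Lemma prod_homog (G : 'I_r -> {mpoly K[n]}) :
  (forall i, G i \is (nth 0%N lam i).-homog) -> \prod_i G i \is d.-homog.
Proof.
move=> Gh; rewrite sumnE (big_nth 0%N) big_mkord.
by elim/big_rec2: _ => [|i k P _ IH]; [exact: dhomog1|exact: dhomogM].
Qed.

Lemma sums_ppoint l : psubset (sums l) (ppoint d).
Proof.
move=> F [nz [G Gh FE]]; split=> //; rewrite FE.
by apply: rpred_sum => j _; apply: prod_homog.
Qed.

Lemma reducibleP F : X F <-> sums 1 F.
Proof.
split=> [[G Gh ->]|[nz [G Gh FE]]].
  split; first by apply/prodf_neq0 => i _; have [] := Gh i.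
  exists (fun _ => G) => [j i|]; first by have [] := Gh i.
  by rewrite big_ord1.
rewrite big_ord1 in FE; exists (G ord0) => // i; split=> //.
by move: nz; rewrite FE => /prodf_neq0; apply.
Qed.

Lemma reducible_neq0 F : X F -> F != 0.
Proof. by move=> /reducibleP[]. Qed.

Lemma reducible_ppoint : psubset X (ppoint d).
Proof. by move=> F /reducibleP/sums_ppoint. Qed.

Let x0 : 'I_n := Ordinal (ltnW n1).
Let x1 : 'I_n := Ordinal n1.
(** Powers of the forms of a pencil are an infinite supply of pairwise non-proportional points of
    [X]. *)
Let pencil (c : K) : {mpoly K[n]} := 'X_x0 + c *: 'X_x1.

Let pencil_homog c : pencil c \is 1.-homog.
Proof. by apply: rpredD; [|apply: rpredZ]; rewrite dhomogX /= mdeg1. Qed.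

Let pencil_eval c c' :
  (pencil c).@[fun i => if i == x0 then - c' else (i == x1)%:R] = c - c'.
Proof.
by rewrite /pencil mevalD mevalZ !mevalXU /= ?eqxx mulr1 addrC.
Qed.

Let pencil_neq0 c : pencil c != 0.
Proof.
apply/eqP => E; have := pencil_eval c (c - 1); rewrite E meval0 opprB addrC subrK.
by move/esym/eqP; rewrite oner_eq0.
Qed.

Let pencil_reducible c : X (pencil c ^+ d).
Proof.
exists (fun i => pencil c ^+ nth 0%N lam i) => [i|].
  by split; [apply: expf_neq0|have := dhomogMn (nth 0%N lam i) (pencil_homog c); rewrite mul1n].
by rewrite sumnE (big_nth 0%N) big_mkord expr_sum.
Qed.

Let d_gt0 : (0 < d)%N.
Proof. by case: lam lam0 lam1 => //= a s _ /andP[a0 _]; rewrite addn_gt0 a0. Qed.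

Let pencil_inj c c' a : pencil c ^+ d = a *: pencil c' ^+ d -> c = c'.
Proof.
move=> /(congr1 (meval (fun i => if i == x0 then - c' else (i == x1)%:R))).
rewrite mevalZ !rmorphXn /= !pencil_eval subrr expr0n eqn0Ngt d_gt0 mulr0.
by move/eqP; rewrite expf_eq0 d_gt0 subr_eq0 => /eqP.
Qed.

Lemma field_fresh (s : seq K) : exists c, c \notin s.
Proof.
pose P : {poly K} := \prod_(a <- s) ('X - a%:P).
have /closed_nonrootP[c] : P != 0.
  by rewrite prodf_seq_neq0; apply/allP => a _; rewrite polyXsubC_eq0.
by rewrite /P root_prod_XsubC => H; exists c.
Qed.

Let fresh_point (Q : nat -> {mpoly K[n]}) k : (forall i, (i < k)%N -> X (Q i)) ->
  exists2 q, X q & forall i, (i < k)%N -> forall a, Q i <> a *: q.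
Proof.
move=> QX.
have [b Hb] : exists b : nat -> K, forall i, (i < k)%N ->
    forall c a, Q i = a *: pencil c ^+ d -> c = b i.
  have /choice[b Hb] : forall i, exists b, (i < k)%N ->
      forall c a, Q i = a *: pencil c ^+ d -> c = b.
    move=> i; case: (classic (exists c a, Q i = a *: pencil c ^+ d)); last first.
      by move=> H; exists 0 => _ c a E; case: H; exists c, a.
    move=> [c [a E]]; exists c => ik c' a' E'.
    have a0 : a' != 0.
      apply: contraTneq (reducible_neq0 (QX i ik)) => a0.
      by rewrite E' a0 scale0r eqxx.
    apply: (@pencil_inj _ _ (a'^-1 * a)).
    by rewrite -scalerA -E E' scalerA mulVf // scale1r.
  by exists b.
have [c cb] := field_fresh [seq b i | i <- iota 0 k].
exists (pencil c ^+ d) => // i ik a E; case/negP: cb; apply/mapP; exists i.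
  by rewrite mem_iota.
exact: Hb E.
Qed.

(** A zero summand, or one proportional to an earlier point, is replaced by a fresh point with
    coefficient zero, its scalar being absorbed by the earlier coefficient. The points become
    pairwise non-proportional, not linearly independent. *)
Let independent_points k (P : nat -> {mpoly K[n]}) :
  (forall i, (i < k)%N -> P i = 0 \/ X (P i)) ->
  exists (Q : nat -> {mpoly K[n]}) (c : nat -> K),
    [/\ forall i, (i < k)%N -> X (Q i),
        forall i j, (i < k)%N -> (j < k)%N -> i != j -> forall a, Q i <> a *: Q j
      & \sum_(i < k) P i = \sum_(i < k) c i *: Q i].
Proof.
elim: k P => [|k IH] P PX.
  by exists (fun=> 0), (fun=> 0); split=> //; rewrite !big_ord0.
have [Q [c [QX Qd QP]]] := IH P (fun i ik => PX i (ltnW ik)).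
have [q [c' [qX qd qP]]] : exists q (c' : nat -> K), [/\ X q,
    forall i, (i < k)%N -> forall a, Q i <> a *: q &
    \sum_(i < k.+1) P i = \sum_(i < k) c' i *: Q i + c' k *: q].
  have [q qX qf] := fresh_point QX.
  case: (PX k (ltnSn k)) => [P0|PkX].
    exists q, (fun i => if i == k then 0 else c i); split=> //.
    rewrite big_ord_recr /= P0 addr0 eqxx scale0r addr0 QP.
    by apply: eq_bigr => i _; rewrite ltn_eqF.
  case: (classic (exists2 i, (i < k)%N & exists a, P k = a *: Q i)).
    move=> [i0 i0k [a E]].
    exists q, (fun i => if i == k then 0 else c i + (i == i0)%:R * a); split=> //.
    rewrite big_ord_recr /= eqxx scale0r addr0 QP E.
    rewrite [RHS](eq_bigr (fun i : 'I_k => c i *: Q i + ((i : nat) == i0)%:R * a *: Q i)).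
      rewrite big_split /=; congr (_ + _).
      rewrite (bigD1 (Ordinal i0k)) //= eqxx mul1r big1 ?addr0 // => i.
      by rewrite -val_eqE /= => /negbTE ->; rewrite mul0r scale0r.
    by move=> i _; rewrite ltn_eqF // scalerDl.
  move=> nprop; exists (P k), (fun i => if i == k then 1 else c i); split=> //.
    move=> i ik a E; have a0 : a != 0.
      apply: contraTneq (reducible_neq0 (QX i ik)) => a0.
      by rewrite E a0 scale0r eqxx.
    by apply: nprop; exists i => //; exists a^-1; rewrite E scalerA mulVf // scale1r.
  rewrite big_ord_recr /= eqxx scale1r QP; congr (_ + _).
  by apply: eq_bigr => i _; rewrite ltn_eqF.
have qd' i : (i < k)%N -> forall a, q <> a *: Q i.
  move=> ik a E; have a0 : a != 0.
    by apply: contraTneq (reducible_neq0 qX) => a0; rewrite E a0 scale0r eqxx.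
  by apply: (qd i ik a^-1); rewrite E scalerA mulVf // scale1r.
exists (fun i => if i == k then q else Q i), c'; split.
- move=> i; rewrite ltnS leq_eqVlt => /orP[/eqP ->|ik]; first by rewrite eqxx.
  by rewrite ltn_eqF //; apply: QX.
- move=> i j; rewrite !ltnS (leq_eqVlt i) (leq_eqVlt j) => /orP[/eqP ->|ik] /orP[/eqP ->|jk] //.
  + by rewrite eqxx.
  + by move=> _ a; rewrite eqxx ltn_eqF //; apply: qd'.
  + by move=> _ a; rewrite eqxx ltn_eqF //; apply: qd.
  + by move=> ne a; rewrite !ltn_eqF //; apply: Qd.
rewrite qP big_ord_recr /= eqxx; congr (_ + _).
by apply: eq_bigr => i _; rewrite ltn_eqF.
Qed.

Definition secants (l : nat) : pset K n := fun F =>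
  exists P : 'I_l -> {mpoly K[n]},
    [/\ forall i, X (P i), distinct_points P & pspan d P F].

Lemma secantsP l F : secants l F <-> sums l F.
Proof.
split=> [[P [PX _ [[nz _] [c FE]]]]|SF].
  split=> //.
  have /choice[G HG] : forall j, exists G : 'I_r -> {mpoly K[n]},
      (forall i, G i \is (nth 0%N lam i).-homog) /\ c j *: P j = \prod_i G i.
    move=> j; have [G Gh ->] := PX j.
    pose i0 := Ordinal lam0.
    exists (fun i => if i == i0 then c j *: G i else G i); split=> [i|].
      by case: ifP => _; [apply: rpredZ|]; have [] := Gh i.
    rewrite [RHS](bigD1 i0) //= (bigD1 i0) //= -scalerAl; congr (_ *: (_ * _)).
    by apply: eq_bigr => i /negbTE ->.
  exists G => [j|]; first by have [] := HG j.
  by rewrite FE; apply: eq_bigr => j _; have [] := HG j.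
have pF := sums_ppoint SF; have [nz [G Gh FE]] := SF.
pose P k := if insub k is Some j then \prod_i G j i else 0.
have PX k : (k < l)%N -> P k = 0 \/ X (P k).
  rewrite /P; case: insubP => [j _ _ _|_ _]; last by left.
  case: (eqVneq (\prod_i G j i) 0) => [|nz']; [by left|right].
  by exists (G j) => // i; split=> //; move/prodf_neq0: nz'; apply.
have [Q [c [QX Qd QP]]] := independent_points PX.
exists (fun j => Q j); split=> [i|i j ij|]; first exact: QX.
  by move=> a; apply: Qd.
split=> //; exists (fun i => c i); rewrite -QP FE; apply: eq_bigr => j _.
by rewrite /P valK.
Qed.

Lemma secant_varietyP l F : (l < nforms n d)%N ->
  secant_variety d l X F <-> hull d (sums l) F.
Proof.
move=> ln; rewrite /secant_variety ln -/(secants l) hullP => [|F' /secantsP/sums_ppoint] //.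
split=> -[pF H]; split=> // e g gh Hg; apply: (H e g gh) => F' /secantsP; exact: Hg.
Qed.

Lemma fills_of_sums l : (forall F, ppoint d F -> sums l F) ->
  fills d (secant_variety d l X).
Proof.
move=> H; case: (boolP (l < nforms n d)%N) => [ln|/negbTE ln] F; last first.
  by rewrite /secant_variety ln.
rewrite secant_varietyP //; split=> [[]//|pF].
by apply: sub_hull (H _ pF); apply: sums_ppoint.
Qed.

End Secants.

(** * Tangent spaces at products of powers of linear forms *)

Lemma meval_delta (R : comNzRingType) n (u : 'I_n) k (G : {mpoly R[n]}) :
  G \is k.-homog -> G.@[fun i => (i == u)%:R] = G@_(U_(u) *+ k)%MM.
Proof.
move=> /dhomogP Gk; rewrite mevalE.
have val m : m \in msupp G ->
    \prod_i ((i == u)%:R : R) ^+ m i = (m == (U_(u) *+ k)%MM)%:R.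
  move=> /Gk /= mk; case: eqP => [->|ne].
    rewrite (bigD1 u) //= eqxx expr1n mul1r big1 // => i ne.
    by rewrite (negbTE ne) mulmnE mnm1E eq_sym (negbTE ne) mul0n expr0.
  have [i iu mi] : exists2 i, i != u & m i != 0%N.
    apply: NNPP => H; apply: ne; apply/mnmP => i; rewrite mulmnE mnm1E.
    have m0 j : j != u -> m j = 0%N.
      by move=> ju; apply/eqP; apply: contraT => mj; case: H; exists j.
    case: eqP => [<-|/eqP iu]; last by rewrite mul0n m0 // eq_sym.
    by rewrite mul1n -mk mdegE (bigD1 u) //= big1 ?addn0 // => j /m0.
  by rewrite (bigD1 i) //= (negbTE iu) expr0n (negbTE mi) mul0r.
case: (boolP ((U_(u) *+ k)%MM \in msupp G)) => uG; last first.
  rewrite (memN_msupp_eq0 uG) big1_seq // => m /andP[_ mG]; rewrite val //.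
  by case: eqP => [E|]; [rewrite -E mG in uG|rewrite mulr0].
rewrite (bigD1_seq (U_(u) *+ k)%MM) ?msupp_uniq //= val // eqxx mulr1.
rewrite big1_seq ?addr0 // => m /andP[ne mG].
by rewrite val // (negbTE ne) mulr0.
Qed.

Section LinearForms.
Variables (K : closedFieldType) (n : nat) (u v : 'I_n).
Hypothesis uv : u != v.
Implicit Types (a b : K) (G H : {mpoly K[n]}).

Definition lin a : {mpoly K[n]} := 'X_u - a *: 'X_v.

Lemma lin_homog a : lin a \is 1.-homog.
Proof. by apply: rpredB; [|apply: rpredZ]; rewrite dhomogX /= mdeg1. Qed.

(** Reduction modulo [lin a]; it sends every other [lin b] to a nonzero multiple of ['X_v]. *)
Let res a G : {mpoly K[n]} :=
  G \mPo [tuple (if i == u then a *: 'X_v else 'X_i) | i < n].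

Let resM a G H : res a (G * H) = res a G * res a H.
Proof. exact: rmorphM. Qed.

Let res_lin a b : res a (lin b) = (a - b) *: 'X_v.
Proof.
rewrite /res /lin comp_mpolyB comp_mpolyZ !comp_mpolyXU -!tnth_nth !tnth_mktuple.
by rewrite eqxx eq_sym (negbTE uv) scalerBl.
Qed.

Lemma lin_neq0 a : lin a != 0.
Proof.
apply/eqP => /(congr1 (res (a + 1))); rewrite res_lin /res comp_mpoly0 => /eqP.
by rewrite addrAC subrr add0r scale1r; apply/negP; exact: mpolyX_neq0.
Qed.

Let res_rem a G : exists q, G = res a G + lin a * q.
Proof.
pose P (f g : {mpoly K[n]}) := exists q, f = g + lin a * q.
have PM f g f' g' : P f g -> P f' g' -> P (f * f') (g * g').
  move=> [q ->] [q' ->]; exists (g * q' + q * g' + lin a * q * q').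
  by ring.
have PX i : P 'X_i (if i == u then a *: 'X_v else 'X_i).
  case: eqP => [->|_]; last by exists 0; rewrite mulr0 addr0.
  by exists 1; rewrite mulr1 addrC subrK.
rewrite {1}(mpolyE G) /res comp_mpolyE.
elim/big_rec2: _ => [|m f g _ [q ->]]; first by exists 0; rewrite mulr0 addr0.
have [q' E] : P 'X_[m] (\prod_i (tnth [tuple (if i == u then a *: 'X_v else 'X_i) | i < n] i) ^+ m i).
  rewrite mpolyXE_id.
  elim/big_rec2: _ => [|i f' g' _ IH]; first by exists 0; rewrite mulr0 addr0.
  apply: (PM) IH; rewrite tnth_mktuple.
  elim: (m i) => [|k IH]; first by exists 0; rewrite mulr0 addr0.
  by rewrite !exprS; apply: PM.
by exists (G@_m *: q' + q); rewrite E scalerDr mulrDr -scalerAr; ring.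
Qed.

(** The kernel of [res a] is generated by [lin a], which is thus prime; the powers are split off one
    at a time. *)
Lemma linX_dvd a G H q k : res a H != 0 -> G * H = lin a ^+ k * q ->
  exists q', G = lin a ^+ k * q'.
Proof.
move=> rH; elim: k G q => [|k IH] G q E; first by exists G; rewrite mul1r.
have rG : res a G = 0.
  have /eqP := congr1 (res a) E; rewrite exprS -mulrA !resM res_lin subrr scale0r mul0r.
  by rewrite mulf_eq0 (negbTE rH) orbF => /eqP.
have [q1] := res_rem a G; rewrite rG add0r => E1.
have [q2 E2] : exists q2, q1 = lin a ^+ k * q2.
  apply: (IH q1 q); apply: (mulfI (lin_neq0 a)).
  by rewrite mulrA -E1 E exprS mulrA.
by exists q2; rewrite E1 E2 exprS mulrA.
Qed.

Lemma msize_homog k G : G != 0 -> G \is k.-homog -> msize G = k.+1.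
Proof.
move=> G0 Gk; have := dhomog_uniq G0 Gk (dhomog_msize Gk).
by move=> ->; rewrite prednK // lt0n msize_poly_eq0.
Qed.

(** Distinct forms of a pencil are coprime, so the whole power divides [G], and equality of degrees
    leaves a constant. *)
Lemma linX_prod_dvd (I : finType) (A : pred I) (b : I -> K) (e : I -> nat) a k G q :
  (forall i, A i -> b i != a) -> G \is k.-homog ->
  G * \prod_(i | A i) lin (b i) ^+ e i = lin a ^+ k * q ->
  exists c : K, G = c *: lin a ^+ k.
Proof.
move=> ba Gk E; have [] := @linX_dvd a G _ q k _ E.
  rewrite /res rmorph_prod; apply/prodf_neq0 => i /ba ne.
  rewrite rmorphXn expf_neq0 //= -/(res a _) res_lin.
  by rewrite scaler_eq0 subr_eq0 eq_sym (negbTE ne) mpolyX_neq0.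
move=> q' E'; case: (eqVneq G 0) => [->|G0]; first by exists 0; rewrite scale0r.
have q0 : q' != 0 by apply: contraNneq G0 => q0; rewrite E' q0 mulr0.
have Lk : lin a ^+ k \is k.-homog by have := dhomogMn k (lin_homog a); rewrite mul1n.
have L0 : lin a ^+ k != 0 by rewrite expf_neq0 ?lin_neq0.
have := msizeM L0 q0; rewrite -E' (msize_homog G0 Gk) (msize_homog L0 Lk) => sz.
have /msize_poly1P[c _ qc] : msize q' == 1%N.
  by apply/eqP/(@addnI k); rewrite addn1 sz addSn.
by exists c; rewrite E' qc mulrC mul_mpolyC.
Qed.

Lemma mcoeff_linX a k : (lin a ^+ k)@_(U_(u) *+ k)%MM = 1.
Proof.
have Lk : lin a ^+ k \is k.-homog by have := dhomogMn k (lin_homog a); rewrite mul1n.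
rewrite -(meval_delta u Lk) rmorphXn /= /lin mevalB mevalZ !mevalXU.
by rewrite eqxx eq_sym (negbTE uv) mulr0 subr0 expr1n.
Qed.

End LinearForms.

(** * The generic sum of l reducible forms *)

Section SumFamily.
Variables (K : closedFieldType) (n : nat) (lam : seq nat) (l : nat).
Local Notation d := (sumn lam).
Local Notation r := (size lam).
Local Notation J := ('I_l * 'I_r)%type.

Definition fdeg (a : J) : nat := nth 0%N lam a.2.

Lemma nth_le_sumn i : (nth 0%N lam i <= sumn lam)%N.
Proof.
elim: lam i => [|x s IH] [|i] //=; first exact: leq_addr.
by apply: leq_trans (IH i) _; apply: leq_addl.
Qed.

Lemma fdeg_le a : (fdeg a <= d)%N.
Proof. exact: nth_le_sumn. Qed.

Local Notation R := {mpoly K[#|{: fvar n d fdeg}|]}.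
Local Notation fv := (fvar n d fdeg).

(** Dimension of the product of the projective spaces of the factors, which turns out to be that of
    [X]. *)
Definition forms_dim := (\sum_(i < r) (nforms n (nth 0%N lam i) - 1))%N.

Lemma nforms_gt0 k : (0 < n)%N -> (0 < nforms n k)%N.
Proof. by move=> n0; rewrite /nforms bin_gt0; case: n n0 => // m _; rewrite addnS !subn1 leq_addl. Qed.

Lemma card_sum_fvar : (0 < n)%N -> #|{: fv}| = (l * (forms_dim + r))%N.
Proof.
move=> n0; rewrite card_fvar //; last exact: fdeg_le.
rewrite -(pair_big xpredT xpredT (fun (_ : 'I_l) (i : 'I_r) => nforms n (nth 0%N lam i))) /=.
rewrite sum_nat_const card_ord; congr (_ * _)%N.
transitivity (forms_dim + \sum_(i < r) 1)%N; last by rewrite sum1_card card_ord.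
rewrite -big_split; apply: eq_bigr => i _ /=.
by rewrite subnK // nforms_gt0.
Qed.

Section Psi.
Variable p : J -> {mpoly K[n]}.
Hypothesis ph : forall a, p a \is (fdeg a).-homog.

Definition Psi : {mpoly R[n]} := \sum_j \prod_i gen d fdeg p (j, i).

Lemma Psi_homog : Psi \is d.-homog.
Proof.
apply: rpred_sum => j _; rewrite [X in _ \is X.-homog]sumnE (big_nth 0%N) big_mkord.
elim/big_rec2: _ => [|i k P _ IH]; first exact: dhomog1.
by apply: dhomogM => //; have := gen_homog d ph (j, i).
Qed.

Lemma spec_Psi t : spec t Psi = \sum_j \prod_i spec t (gen d fdeg p (j, i)).
Proof. by rewrite /Psi rmorph_sum; apply: eq_bigr => j _; rewrite rmorph_prod. Qed.

Lemma spec_Psi_sums t : spec t Psi != 0 -> sums lam l (spec t Psi).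
Proof.
move=> nz; split=> //; exists (fun j i => spec t (gen d fdeg p (j, i))) => [j i|].
  exact: (spec_gen_homog ph t (j, i)).
exact: spec_Psi.
Qed.

Lemma sums_spec_Psi F : sums lam l F -> exists t, F = spec t Psi.
Proof.
move=> [_ [G Gh ->]].
have [t tG] := spec_gen_surj fdeg_le ph (G := fun a => G a.1 a.2) (fun a => Gh a.1 a.2).
exists t; rewrite spec_Psi; apply: eq_bigr => j _; apply: eq_bigr => i _.
by rewrite tG.
Qed.

Lemma spec0_Psi : spec0 Psi = \sum_j \prod_i p (j, i).
Proof.
rewrite /Psi rmorph_sum; apply: eq_bigr => j _; rewrite rmorph_prod.
by apply: eq_bigr => i _; apply: (spec0_gen fdeg_le ph).
Qed.

Lemma tang_prod0 (x : fv) (I : finType) (A : pred I) (P : I -> {mpoly R[n]}) :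
  (forall i, A i -> tang x (P i) = 0) -> tang x (\prod_(i | A i) P i) = 0.
Proof.
move=> P0; elim/big_ind: _ => [|P1 P2 E1 E2|]; last exact: P0.
  apply/mpolyP => m; rewrite tangE mcoeff1 mcoeff0; case: eqP => _; last by rewrite mcoeff0.
  by rewrite mcoeff1 mnm1_eq0.
by rewrite tangM E1 E2 mul0r mulr0 addr0.
Qed.

(** Leibniz rule at the base point: only the factor that carries the parameter [x] varies. *)
Lemma tang_Psi (x : fv) : tang x Psi =
  'X_[fmon x] * \prod_(i | i != (fidx x).2) p ((fidx x).1, i).
Proof.
rewrite /Psi raddf_sum (bigD1 (fidx x).1) //= [X in _ + X]big1 ?addr0 => [|j ne]; last first.
  apply: tang_prod0 => i _; rewrite (tang_gen fdeg_le ph).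
  by case: eqP => // E; case/eqP: ne; rewrite E.
rewrite (bigD1 (fidx x).2) //= tangM (tang_gen fdeg_le ph) -surjective_pairing eqxx.
rewrite [tang x (\prod_(_ | _) _)]tang_prod0 => [|i ne]; last first.
  rewrite (tang_gen fdeg_le ph); case: eqP => // E.
  by case/eqP: ne; rewrite E.
rewrite mulr0 addr0 rmorph_prod; congr (_ * _); apply: eq_bigr => i _.
exact: (spec0_gen fdeg_le ph).
Qed.

End Psi.
End SumFamily.

(** * Lower bound for sums of products *)

Section LowerBound.
Variables (K : closedFieldType) (charK0 : [pchar K] =i pred0).
Variables (n l : nat) (lam : seq nat).
Hypotheses (ln : (2 * l <= n)%N) (l0 : (0 < l)%N) (lam0 : (0 < size lam)%N).
Hypothesis lam_head : forall i, (nth 0%N lam i <= head 0%N lam)%N.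
Hypothesis sep : l = 1%N \/ (head 0%N lam < sumn (behead lam))%N.
Local Notation d := (sumn lam).
Local Notation r := (size lam).
Local Notation J := ('I_l * 'I_r)%type.
Local Notation fv := (fvar n d (@fdeg lam l)).

Let u_lt (j : 'I_l) : (2 * j < n)%N.
Proof. by have := ltn_ord j; lia. Qed.
Let v_lt (j : 'I_l) : ((2 * j).+1 < n)%N.
Proof. by have := ltn_ord j; lia. Qed.
Let u j : 'I_n := Ordinal (u_lt j).
Let v j : 'I_n := Ordinal (v_lt j).
Let uv j : u j != v j.
Proof. by apply/eqP => /(congr1 val) /=; lia. Qed.

Let a (i : 'I_r) : K := (i : nat)%:R.
Let a_inj : injective a.
Proof.
move=> i j; wlog ij : i j / (i <= j)%N => [H E|].
  by case: (leqP i j) => ij; [apply: H|apply/esym/H => //; apply: ltnW].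
move=> E; apply/val_inj/eqP; rewrite /= eqn_leq ij /= -subn_eq0.
by rewrite -((charf0P K).1 charK0) natrB // -/(a i) E subrr.
Qed.

(** The slopes [a i] are distinct in characteristic zero, which makes the factors of one summand
    pairwise coprime. *)
Let p (x : J) : {mpoly K[n]} := lin (u x.1) (v x.1) (a x.2) ^+ fdeg x.
Let ph x : p x \is (fdeg x).-homog.
Proof. by have := dhomogMn (fdeg x) (lin_homog (u x.1) (v x.1) (a x.2)); rewrite mul1n. Qed.

Let i0 : 'I_r := Ordinal lam0.
Let j0 : 'I_l := Ordinal l0.

(** The coefficient of the top power of [u] normalises a factor. It is frozen for all factors but
    the [i0]-th, since factors can be rescaled against each other, and once more at [(j0, i0)] for
    the scaling of the whole form. This removes [l * (r - 1) + 1] of the [l * (forms_dim + r)]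
    parameters. *)
Let W : {set fv} := [set x | ~~ ((fmon x == (U_(u (fidx x).1) *+ fdeg (fidx x))%MM) &&
  (((fidx x).2 != i0) || ((fidx x).1 == j0)))].

Let cardW : (0 < n)%N -> #|W| = (l * forms_dim n lam + l - 1)%N.
Proof.
move=> n0; pose S : {set J} := [set x | (x.2 != i0) || (x.1 == j0)].
have cS : (#|S| + (l - 1) = l * r)%N.
  have -> : (l - 1 = #|~: S|)%N.
    have -> : ~: S = setX [set~ j0] [set i0].
      by apply/setP => -[j i]; rewrite !inE negb_or negbK andbC.
    by rewrite cardsX cards1 muln1 cardsC1 card_ord subn1.
  by rewrite cardsC card_prod !card_ord.
have cW : #|~: W| = #|S|.
  have inj : {in ~: W &, injective (@fidx n d _ (@fdeg lam l))}.
    move=> x y; rewrite !inE !negbK => /andP[/eqP Ex _] /andP[/eqP Ey _] E.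
    by apply: fvar_inj => //; rewrite Ex Ey E.
  rewrite -(card_in_imset inj); apply: eq_card => -[j i]; apply/imsetP/idP.
    by move=> [x]; rewrite !inE negbK => /andP[_ H] ->.
  move=> jiS; have [|x xi xm] := @fvar_ex n d _ _ (@fdeg_le lam l) (j, i) (U_(u j) *+ fdeg (j, i))%MM.
    by rewrite mdegMn mdeg1 mul1n.
  by exists x => //; move: jiS; rewrite !inE negbK xi xm eqxx.
have := cardsC W; rewrite cW (card_sum_fvar lam l n0) mulnDr; lia.
Qed.

Let blk j k (P : {mpoly K[n]}) := forall m, P@_m != 0 -> (k <= m (u j) + m (v j))%N.

Let blkD j k P Q : blk j k P -> blk j k Q -> blk j k (P + Q).
Proof.
move=> HP HQ m; rewrite mcoeffD; case: (eqVneq P@_m 0) => [->|/HP //].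
by rewrite add0r; apply: HQ.
Qed.

Let blk_sum j k (I : finType) (P : I -> {mpoly K[n]}) :
  (forall i, blk j k (P i)) -> blk j k (\sum_i P i).
Proof.
move=> H; elim/big_ind: _ => [m|P1 P2|i _] //; first by rewrite mcoeff0 eqxx.
exact: blkD.
Qed.

Let blkM j k k' P Q : blk j k P -> blk j k' Q -> blk j (k + k') (P * Q).
Proof.
move=> HP HQ m nz.
have [[x y] /= /eqP E] : exists2 xy : 'X_{1..n < (mdeg m).+1, (mdeg m).+1},
    m == (xy.1 + xy.2)%MM & P@_xy.1 * Q@_xy.2 != 0.
  apply: NNPP => H; case/eqP: nz; rewrite mcoeffM big1 // => xy E.
  by apply/eqP; apply: contraT => nz; case: H; exists xy.
rewrite mulf_eq0 negb_or => /andP[/HP Px /HQ Qy].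
have Eu : m (u j) = (x (u j) + y (u j))%N by have := congr1 (fun z : 'X_{1..n} => z (u j)) E; rewrite mnmDE.
have Ev : m (v j) = (x (v j) + y (v j))%N by have := congr1 (fun z : 'X_{1..n} => z (v j)) E; rewrite mnmDE.
by rewrite Eu Ev addnACA leq_add.
Qed.

Let blk0 j P : blk j 0 P.
Proof. by []. Qed.

Let blk_lin j b : blk j 1 (lin (u j) (v j) b).
Proof.
move=> m; rewrite /lin mcoeffB mcoeffZ !mcoeffX.
case: (eqVneq U_(u j)%MM m) => [<- _|_]; first by rewrite mnm1E eqxx.
case: (eqVneq U_(v j)%MM m) => [<- _|_]; first by rewrite !mnm1E eqxx addn1.
by rewrite mulr0 subr0 eqxx.
Qed.

Let blkX j P k : blk j 1 P -> blk j k (P ^+ k).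
Proof.
move=> HP; elim: k => [|k IH]; first exact: blk0.
by rewrite exprS -add1n; apply: blkM.
Qed.

Let blk_prod j (i : 'I_r) : blk j (d - nth 0%N lam i) (\prod_(i' | i' != i) p (j, i')).
Proof.
have -> : (d - nth 0 lam i = \sum_(i' < r | i' != i) nth 0 lam i')%N.
  rewrite sumnE (big_nth 0%N) big_mkord (bigD1 i) //= addKn //.
elim/big_rec2: _ => [|i' P k _ IH]; first exact: blk0.
by apply: blkM IH; apply: blkX; apply: blk_lin.
Qed.

Lemma sums_chain (A : pset K n) : psubset A (ppoint d) -> psubset (sums lam l) A ->
  krull_chain d A (l * forms_dim n lam + l - 1).
Proof.
move=> Ap SA; rewrite -cardW; last by apply: leq_ltn_trans (u_lt j0).
apply: (family_chain_ge (Psi_homog ph) (W := W) Ap).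
  by move=> t nz; apply/SA/spec_Psi_sums.
move=> c0 c cW E.
pose H j i := \sum_(x : fv | fidx x == (j, i)) c x *: 'X_[fmon x] : {mpoly K[n]}.
pose T j := c0 *: (\prod_i p (j, i)) + \sum_i H j i * \prod_(i' | i' != i) p (j, i').
have sumT : \sum_j T j = 0.
  rewrite -[RHS]E (spec0_Psi ph) big_split /= scaler_sumr; congr (_ + _).
  rewrite (partition_big (@fidx _ _ _ _) xpredT) //= pair_bigA /=.
  apply: eq_bigr => -[j i] _ /=; rewrite /H mulr_suml; apply: eq_bigr => x /eqP xE.
  by rewrite (tang_Psi ph) xE /= -scalerAl.
have Hh j i : H j i \is (fdeg (j, i)).-homog.
  apply: rpred_sum => x /eqP <-; apply: rpredZ; rewrite dhomogX /=.
  by rewrite fmon_deg.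
have Th j : T j \is d.-homog.
  apply: rpredD; first by apply: rpredZ; apply: (prod_homog (fun i => ph (j, i))).
  apply: rpred_sum => i _.
  have := prod_homog (G := fun i' => if i' == i then H j i else p (j, i')) (lam := lam).
  rewrite (bigD1 i) //= eqxx (eq_bigr (fun i' => p (j, i'))) => [|i' /negbTE -> //].
  by apply=> i'; case: eqP => [->|_]; [apply: Hh | apply: (ph (j, i'))].
(* With [s] the sum of the tail, monomials of [T j] have degree at least [s] in the [j]-th pair, so
   one shared by two summands would have degree at least [2 s > d]. For [l = 1] nothing has to be
   separated. *)
have T0 j : T j = 0.
  case: (ltngtP l 1) => [|l1|l1]; first by rewrite ltnS leqNgt l0.
    case: sep => [E1|sd]; first by rewrite E1 ltnn in l1.
    have Tblk j' : blk j' (sumn (behead lam)) (T j').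
      have Bw k P : (sumn (behead lam) <= k)%N -> blk j' k P -> blk j' (sumn (behead lam)) P.
        by move=> sk Pb m /Pb; apply: leq_trans.
      have ds (i : 'I_r) : (sumn (behead lam) <= d - nth 0 lam i)%N.
        have -> : (sumn (behead lam) = d - head 0 lam)%N by case: (lam) lam0 => //= *; rewrite addKn.
        by apply: leq_sub2l.
      apply: blkD.
        rewrite (bigD1 i0) //= scalerAl; apply: (Bw (0 + (d - nth 0 lam i0))%N); first exact: ds.
        exact (blkM (@blk0 j' (c0 *: p (j', i0))) (@blk_prod j' i0)).
      apply: blk_sum => i; apply: (Bw (0 + (d - nth 0 lam i))%N); first exact: ds.
      exact (blkM (@blk0 j' (H j' i)) (@blk_prod j' i)).
    apply/mpolyP => m; rewrite mcoeff0; apply/eqP; apply: contraT => nz.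
    have := congr1 (mcoeff m) sumT; rewrite raddf_sum /= (bigD1 j) //= mcoeff0.
    rewrite big1 ?addr0; first by move/eqP; rewrite (negbTE nz).
    move=> j' ne; apply/eqP; apply: contraT => nz'.
    have md : mdeg m = d by apply: (dhomog_mf (Th j)); rewrite mcoeff_msupp.
    have h1 := Tblk _ _ nz; have h2 := Tblk _ _ nz'.
    have : (m (u j) + m (v j) + (m (u j') + m (v j')) <= mdeg m)%N.
      rewrite mdegE (bigD1 (u j)) //= (bigD1 (v j)) //=; last by rewrite eq_sym.
      rewrite (bigD1 (u j')) /=; last first.
        have nej : (j : nat) != j' by rewrite val_eqE eq_sym.
        by apply/andP; split; apply/eqP => /(congr1 val) /=; lia.
      rewrite (bigD1 (v j')) /=; first lia.
      have nej : (j : nat) != j' by rewrite val_eqE eq_sym.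
      by rewrite -!andbA; apply/and3P; split; apply/eqP => /(congr1 val) /=; lia.
    have dE : d = (head 0 lam + sumn (behead lam))%N by case: (lam) lam0.
    by rewrite md dE; lia.
  have Ej (j' : 'I_l) : j' = j0 by apply/val_inj => /=; have := ltn_ord j'; lia.
  move: sumT; rewrite (bigD1 j) //= [X in _ + X]big1 ?addr0 // => j' /negP[].
  by apply/eqP; rewrite (Ej j') (Ej j).
(* The factors of each summand are pairwise coprime, so a syzygy is a multiple
   of the factors themselves. *)
pose H' j i := H j i + (if i == i0 then c0 *: p (j, i) else 0).
have H'T j : \sum_i H' j i * \prod_(i' | i' != i) p (j, i') = 0.
  rewrite -[RHS](T0 j) /T addrC (eq_bigr (fun i => H j i * (\prod_(i' | i' != i) p (j, i')) +
     (if i == i0 then c0 *: p (j, i) else 0) * (\prod_(i' | i' != i) p (j, i')))).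
    rewrite big_split /=; congr (_ + _).
    rewrite (bigD1 i0) //= [X in _ + X]big1 ?addr0; last by move=> i /negbTE ->; rewrite mul0r.
    by rewrite -scalerAl [in RHS](bigD1 i0).
  by move=> i _; rewrite /H' mulrDl.
have H'p j i : exists k, H' j i = k *: p (j, i).
  have [q E'] : exists q, H' j i * \prod_(i' | i' != i) p (j, i') = p (j, i) * q.
    have := H'T j; rewrite (bigD1 i) //= => /eqP; rewrite addr_eq0 => /eqP ->.
    exists (- \sum_(i' | i' != i) H' j i' * \prod_(i'' | (i'' != i') && (i'' != i)) p (j, i'')).
    rewrite mulrN; congr (- _); rewrite mulr_sumr; apply: eq_bigr => i' ne.
    rewrite (bigD1 i) //=; last by rewrite eq_sym.
    by rewrite mulrCA.
  have := @linX_prod_dvd _ _ _ _ (uv j) _ (fun i' => i' != i) a (fun i' => fdeg (j, i')) (a i) (fdeg (j, i)) (H' j i) q _ _ E'.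
  apply.
    by move=> i' ne; apply/eqP => /(@a_inj i' i) /eqP; apply/negP.
  apply: rpredD; first exact: Hh.
  by case: (i == i0); [apply: rpredZ; apply: ph | apply: rpred0].
have leadH j i x : fidx x = (j, i) -> fmon x = (U_(u j) *+ fdeg (j, i))%MM ->
    (H j i)@_(U_(u j) *+ fdeg (j, i))%MM = c x.
  move=> xi xm; rewrite /H raddf_sum (bigD1 x) /=; last by rewrite xi.
  rewrite mcoeffZ mcoeffX xm eqxx mulr1 big1 ?addr0 // => y /andP[/eqP yi ne].
  rewrite mcoeffZ mcoeffX; case: eqP => [ym|]; last by rewrite mulr0.
  by case/eqP: ne; apply: fvar_inj; rewrite ?yi ?xi // ym xm.
have lead0 j i : (i != i0) || (j == j0) -> (H j i)@_(U_(u j) *+ fdeg (j, i))%MM = 0.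
  move=> ij; have [|x xi xm] := @fvar_ex n d _ _ (@fdeg_le lam l) (j, i) (U_(u j) *+ fdeg (j, i))%MM.
    by rewrite mdegMn mdeg1 mul1n.
  by rewrite (leadH _ _ _ xi xm) cW // inE negbK xi xm eqxx.
have leadp j i : (p (j, i))@_(U_(u j) *+ fdeg (j, i))%MM = 1.
  exact: mcoeff_linX.
have H0 j i : i != i0 -> H j i = 0.
  move=> ne; have [k] := H'p j i; rewrite /H' (negbTE ne) addr0 => Hk.
  have := lead0 j i; rewrite ne => /(_ isT).
  by rewrite Hk mcoeffZ leadp mulr1 => ->; rewrite scale0r.
have H'0 j : H' j i0 = 0.
  have := H'T j; rewrite (bigD1 i0) //= [X in _ + X]big1 ?addr0; last first.
    by move=> i ne; rewrite /H' (negbTE ne) addr0 H0 // mul0r.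
  have nz : \prod_(i | i != i0) p (j, i) != 0.
    by apply/prodf_neq0 => i _; rewrite expf_neq0 ?lin_neq0.
  by move/eqP; rewrite mulf_eq0 (negbTE nz) orbF => /eqP.
have c00 : c0 = 0.
  have := congr1 (mcoeff (U_(u j0) *+ fdeg (j0, i0))%MM) (H'0 j0).
  by rewrite /H' eqxx mcoeffD lead0 ?eqxx ?orbT // mcoeffZ leadp mulr1 add0r mcoeff0.
have Hz j i : H j i = 0.
  case: (eqVneq i i0) => [->|/H0 //]; have := H'0 j.
  by rewrite /H' eqxx c00 scale0r addr0.
split=> // x; have := congr1 (mcoeff (fmon x)) (Hz (fidx x).1 (fidx x).2).
rewrite mcoeff0 /H raddf_sum (bigD1 x) /=; last by rewrite -surjective_pairing.
rewrite mcoeffZ mcoeffX eqxx mulr1 big1 ?addr0 // => y /andP[/eqP yi ne].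
rewrite mcoeffZ mcoeffX; case: eqP => [ym|]; last by rewrite mulr0.
by case/eqP: ne; apply: fvar_inj; rewrite ?yi -?surjective_pairing.
Qed.

End LowerBound.

(** * Upper bounds from scaling fields and a syzygy *)

Section UpperBound.
Variables (K : closedFieldType) (charK0 : [pchar K] =i pred0).
Variables (n l : nat) (lam : seq nat) (x0 : 'I_n).
Local Notation d := (sumn lam).
Local Notation r := (size lam).
Local Notation J := ('I_l * 'I_r)%type.
Local Notation fd := (@fdeg lam l).
Local Notation fv := (fvar n d fd).
Local Notation R := {mpoly K[#|{: fv}|]}.

Definition lead (b : J) : 'X_{1..n} := (U_(x0) *+ fd b)%MM.
Variable kap : J -> K.
(** All base forms are powers of one variable up to a scalar, which may be zero: the fields only
    have to be triangulated at this point, however degenerate it is. *)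
Definition pbase (b : J) : {mpoly K[n]} := kap b *: 'X_[lead b].
Let p := pbase.

Lemma pbase_homog b : p b \is (fd b).-homog.
Proof. by apply: rpredZ; rewrite dhomogX /= /lead mdegMn mdeg1 mul1n. Qed.
Let ph := pbase_homog.

(** For each factor in [S] one field eliminates the coefficient of the pure power of [x0]. At the
    base point its components elsewhere are constrained only at the pure powers of factors in
    [S]. *)
Lemma sums_chain_le (S : {set J}) (del : J -> J -> {mpoly R[n]}) (ev : J -> K)
    (A : pset K n) k :
  {in S &, forall a b, (spec0 (del a b))@_(lead b) = (a == b)%:R} ->
  {in S, forall a, der (del a) (Psi p) ((ev a)%:MP *: Psi p)} ->
  psubset A (hull d (sums lam l)) ->
  krull_chain d A k -> (k + #|S| <= l * (forms_dim n lam + r))%N.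
Proof.
move=> delS delP AS chA; pose W : {set fv} := [set x | ~~ ((fmon x == lead (fidx x)) && (fidx x \in S))].
have xW x : x \notin W -> fmon x = lead (fidx x) /\ fidx x \in S.
  by rewrite inE negbK => /andP[/eqP].
have cW : #|~: W| = #|S|.
  have inj : {in ~: W &, injective (@fidx n d _ fd)}.
    move=> x y; rewrite !in_setC => /xW[Ex _] /xW[Ey _] E.
    by apply: fvar_inj => //; rewrite Ex Ey E.
  rewrite -(card_in_imset inj); apply: eq_card => b; apply/imsetP/idP.
    by move=> [x]; rewrite in_setC => /xW[_ H] ->.
  move=> bS; have [|x xi xm] := @fvar_ex n d _ _ (@fdeg_le lam l) b (lead b).
    by rewrite /lead mdegMn mdeg1 mul1n.
  by exists x => //; rewrite !inE negbK xi xm eqxx bS.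
rewrite -(card_sum_fvar lam l (leq_ltn_trans (leq0n x0) (ltn_ord x0))) -(cardsC W) cW.
rewrite leq_add2r.
have Ap : psubset A (ppoint d) by move=> F /AS[].
apply: (@family_chain_le _ _ _ _ _ (Psi p) W A Ap charK0
  (fun x => del (fidx x)) (fun x => ev (fidx x)) (sums lam l) k) => //.
- move=> x y /xW[Ex xS] /xW[Ey yS]; rewrite Ey delS //; congr (_%:R).
  congr nat_of_bool; apply/eqP/eqP => [E|-> //].
  by apply: fvar_inj => //; rewrite Ex Ey E.
- by move=> x /xW[_ xS]; apply: delP.
- by move=> F; apply: (sums_spec_Psi ph).
Qed.

Definition scalef (w : J -> K) (b : J) : {mpoly R[n]} := (w b)%:MP *: gen d fd p b.

Lemma scalef_der w b : der (scalef w) (gen d fd p b) ((w b)%:MP *: gen d fd p b).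
Proof. by apply: (der_gen (@fdeg_le lam l)) => //; apply: rpredZ; apply: gen_homog. Qed.

(** Infinitesimal rescaling with weights [w] multiplies a summand by the sum of its weights, so
    these sums must agree over all summands. *)
Lemma scalef_Psi w c : (forall j, \sum_i w (j, i) = c) ->
  der (scalef w) (Psi p) (c%:MP *: Psi p).
Proof.
move=> wc; rewrite /Psi scaler_sumr; apply: der_sum => j.
by rewrite -(wc j); apply: der_eigen_prod => i _; apply: scalef_der.
Qed.

Lemma scalef0 w b : (spec0 (scalef w b))@_(lead b) = w b * kap b.
Proof.
rewrite /scalef spec0E mcoeffZ rmorphM /= -spec0E (spec0_gen (@fdeg_le lam l) ph).
by rewrite mcoeffC eqxx mulr1 mcoeffZ mcoeffX eqxx mulr1.
Qed.

Section Elimination.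
Variables (i0 : 'I_r) (j0 j1 : 'I_l) (k : nat).
Hypotheses (j01 : j0 != j1) (kE : (k + (d - nth 0 lam i0) = nth 0 lam i0)%N).

Let cof j : {mpoly R[n]} := \prod_(i | i != i0) gen d fd p (j, i).

(* The syzygy x0^k B_1 * A_0 - x0^k B_0 * A_1 between the summands A_0 B_0 and
   A_1 B_1. *)
Definition elimf (b : J) : {mpoly R[n]} :=
  if b == (j0, i0) then 'X_[U_(x0) *+ k] * cof j1
  else if b == (j1, i0) then - ('X_[U_(x0) *+ k] * cof j0) else 0.

Let rest_sum : (d - nth 0 lam i0 = \sum_(i' < r | i' != i0) nth 0 lam i')%N.
Proof. by rewrite sumnE (big_nth 0%N) big_mkord (bigD1 i0) //= addKn. Qed.

Let cof_homog j : cof j \is (d - nth 0 lam i0).-homog.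
Proof.
rewrite rest_sum /cof; elim/big_rec2: _ => [|i' P m _ IH]; first exact: dhomog1.
by apply: dhomogM => //; have := gen_homog d ph (j, i').
Qed.

Lemma elimf_homog b : elimf b \is (fd b).-homog.
Proof.
have H j : 'X_[U_(x0) *+ k] * cof j \is (nth 0 lam i0).-homog.
  rewrite -[X in _ \is X.-homog]kE; apply: dhomogM => //.
  by rewrite dhomogX /= mdegMn mdeg1 mul1n.
rewrite /elimf; case: eqP => [->|_]; first exact: H.
case: eqP => [->|_]; last exact: rpred0.
by rewrite rpredN; exact: H.
Qed.

(** The field moves the [i0]-factors and no cofactor, so the derivative of [Psi] is the syzygy
    itself. *)
Lemma elimf_Psi : der elimf (Psi p) 0.
Proof.
have cof0 j : der elimf (cof j) 0.
  have H : forall i, i != i0 -> der elimf (gen d fd p (j, i)) ((0 : K)%:MP *: gen d fd p (j, i)).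
    move=> i ne m; rewrite (der_gen (@fdeg_le lam l) ph (elimf_homog _)).
    rewrite /elimf; do 2![case: eqP => [[_ /eqP]|_]; first by rewrite (negbTE ne)].
    by rewrite mcoeffZ mul0r mcoeff0.
  move=> m; have -> := der_eigen_prod (A := fun i => i != i0) (c := fun=> 0) H m.
  by rewrite big1 // mcoeffZ mul0r mcoeff0.
have E : \sum_j (elimf (j, i0) * cof j + gen d fd p (j, i0) * 0) = 0.
  rewrite (eq_bigr (fun j => elimf (j, i0) * cof j)) => [|j _]; last by rewrite mulr0 addr0.
  rewrite (bigD1 j0) //= (bigD1 j1) //=; last by rewrite eq_sym.
  rewrite [X in _ + (_ + X)]big1 ?addr0.
    rewrite /elimf eqxx (negbTE (_ : (j1, i0) != (j0, i0))) ?eqxx ?mulNr; last first.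
      by apply: contra j01 => /eqP[->].
    by rewrite -mulrA [cof j1 * _]mulrC mulrA subrr.
  move=> j /andP[n0 n1]; rewrite /elimf.
  do 2![case: eqP => [[/eqP]|_]; first by rewrite ?(negbTE n0) ?(negbTE n1)].
  by rewrite mul0r.
rewrite -E /Psi; apply: der_sum => j.
rewrite (bigD1 i0) //=; apply: derM (cof0 j).
by apply: (der_gen (@fdeg_le lam l) ph); apply: elimf_homog.
Qed.

Lemma elimf0 b : (forall i, i != i0 -> kap (j0, i) = 1 /\ kap (j1, i) = 1) ->
  (spec0 (elimf b))@_(lead b) = (b == (j0, i0))%:R - (b == (j1, i0))%:R.
Proof.
move=> kap1.
have cofE j : (j == j0) || (j == j1) -> spec0 ('X_[U_(x0) *+ k] * cof j) = 'X_[U_(x0) *+ nth 0%N lam i0].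
  move=> jj; rewrite rmorphM rmorph_prod /=.
  have -> : spec0 ('X_[U_(x0) *+ k] : {mpoly R[n]}) = 'X_[U_(x0) *+ k] by exact: map_mpolyX.
  rewrite (eq_bigr (fun i : 'I_r => 'X_[U_(x0) *+ nth 0%N lam i])) => [|i ne]; last first.
    rewrite (spec0_gen (@fdeg_le lam l) ph) /p /pbase.
    have [k0 k1] := kap1 i ne; case/orP: jj => /eqP ->; rewrite ?k0 ?k1 scale1r //.
  have <- := big_morph (fun m => 'X_[m] : {mpoly K[n]}) (@mpolyXD n K) (@mpolyX0 n K).
  rewrite -mpolyXD; congr ('X_[_]).
  rewrite -kE rest_sum.
  apply/mnmP => i; rewrite mnmDE mnm_sumE !mulmnE mulnDr big_distrr; congr (_ + _)%N.
  by apply: eq_bigr => i' _; rewrite mulmnE.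
rewrite /elimf; case: (eqVneq b (j0, i0)) => [->|_].
  rewrite cofE ?eqxx ?orbT // mcoeffX eqxx.
  by rewrite (_ : (_, _) == _ = false) ?subr0 //; apply/negbTE; apply: contra j01 => /eqP[->].
case: (eqVneq b (j1, i0)) => [->|_].
  by rewrite rmorphN /= cofE ?eqxx // mcoeffN mcoeffX eqxx sub0r.
by rewrite rmorph0 mcoeff0 subrr.
Qed.

End Elimination.
End UpperBound.

Section Dimensions.
Variables (K : closedFieldType) (charK0 : [pchar K] =i pred0).
Variables (n : nat) (lam : seq nat).
Hypotheses (n0 : (0 < n)%N) (lam0 : (0 < size lam)%N).
Local Notation d := (sumn lam).
Local Notation r := (size lam).
Local Notation X := (reducible_forms K n lam).
Local Notation D := (forms_dim n lam).
Let x0 : 'I_n := Ordinal n0.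
Let i0 : 'I_r := Ordinal lam0.

Lemma sum_indicator l (b : 'I_l * 'I_r) j : \sum_i (((j, i) == b)%:R : K) = (j == b.1)%:R.
Proof.
case: b => jb ib /=; rewrite (bigD1 ib) //= xpair_eqE eqxx andbT big1 ?addr0 // => i ne.
by rewrite xpair_eqE (negbTE ne) andbF.
Qed.

Lemma reducible_chain_le k : krull_chain d X k -> (k <= D)%N.
Proof.
move=> chX; pose kap (b : 'I_1 * 'I_r) : K := 1.
have := @sums_chain_le K charK0 n 1 lam x0 kap [set: 'I_1 * 'I_r]
  (fun a => scalef x0 kap (fun b => (b == a)%:R)) (fun=> 1) X k.
rewrite cardsT card_prod !card_ord !mul1n leq_add2r; apply => //.
- by move=> a b _ _; rewrite scalef0 mulr1 eq_sym.
- move=> a _; apply: scalef_Psi => j; rewrite sum_indicator.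
  by rewrite (_ : j == a.1) //; apply/eqP/val_inj; case: j a.1 => [[|//] ?] [[|//] ?].
move=> F /reducibleP; apply: sub_hull; exact: sums_ppoint.
Qed.

(** Of the [l * (D + r)] parameters, [l * (r - 1) + 2] are removed: one for each factor off [i0],
    one by the common scaling, and one by the syzygy with [k = d1 - s]. The result is one below the
    parameter count [l * D + l - 1]. *)
Lemma hull_sums_chain_le l (A : pset K n) k : (2 <= l)%N ->
  (sumn (behead lam) <= head 0 lam)%N -> psubset A (hull d (sums lam l)) ->
  krull_chain d A k -> (k + 2 <= l * D + l)%N.
Proof.
move=> l2 sd AS chA.
have j0P : (0 < l)%N by apply: leq_trans l2.
pose j0 : 'I_l := Ordinal j0P; pose j1 : 'I_l := Ordinal l2.
have j01 : j0 != j1 by [].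
have j01' : (j0 == j1) = false by [].
have j10 : (j1 == j0) = false by [].
(* A zero base form at [(j0, i0)] suppresses the components of all scalings there. *)
pose kap (b : 'I_l * 'I_r) : K := (b != (j0, i0))%:R.
have kE : (head 0 lam - sumn (behead lam) + (d - nth 0 lam i0) = nth 0 lam i0)%N.
  have dE : d = (head 0 lam + sumn (behead lam))%N by case: (lam) lam0.
  by rewrite nth0 dE addKn subnK.
(* Outside [S] lie the [i0]-factors of the remaining summands, which can absorb balancing
   weights. *)
pose S : {set 'I_l * 'I_r} := [set b | (b.2 != i0) || (b.1 == j0) || (b.1 == j1)].
have cS : (#|S| + (l - 2) = l * r)%N.
  have -> : (l - 2 = #|~: S|)%N.
    have -> : ~: S = setX (~: [set j0; j1]) [set i0].
      by apply/setP => -[j i]; rewrite !inE !negb_or negbK /= -andbA andbC.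
    rewrite cardsX cards1 muln1; have := cardsC [set j0; j1].
    by rewrite cards2 j01 card_ord => E; apply/eqP; rewrite -(eqn_add2l 2) E subnKC.
  by rewrite cardsC card_prod !card_ord.
(* A factor [a] off [i0] is balanced by the [i0]-factor of its own summand, with eigenvalue [0]. In
   summand [j1] that factor has a nonzero base form and lies in [S], so the other summands are
   scaled along instead, with eigenvalue [1]. At [i0] all [i0]-factors are scaled together. *)
pose wt (a b : 'I_l * 'I_r) : K :=
  if a.2 == i0 then (b.2 == i0)%:R else
  if a.1 == j1 then (b == a)%:R + ((b.2 == i0) && (b.1 != j1))%:R
  else (b == a)%:R - (b == (a.1, i0))%:R.
pose ev (a : 'I_l * 'I_r) : K := ((a.2 == i0) || (a.1 == j1))%:R.
(* The common scaling has components [0] at [(j0, i0)] and [1] at [(j1, i0)]; the syzygy contributes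
   [1] and [-1], so the sum is dual to [(j0, i0)]. *)
pose del (a b : 'I_l * 'I_r) := scalef x0 kap (wt a) b +
  (if a == (j0, i0) then elimf x0 kap i0 j0 j1 (head 0 lam - sumn (behead lam)) b else 0).
have simp := (mul1r, mul0r, subr0, sub0r, addr0, subrr, mulr1, mulr0, add0r).
have sum_i0 (j : 'I_l) : \sum_(i : 'I_r) ((i == i0)%:R : K) = 1.
  by rewrite (bigD1 i0) //= big1 ?addr0 // => i /negbTE ->.
have := @sums_chain_le K charK0 n l lam x0 kap S del ev A k.
have -> : (k + 2 <= l * D + l)%N = (k + #|S| <= l * (D + r))%N.
  by rewrite mulnDr; apply/idP/idP; lia.
apply => //.
- move=> a b aS bS; rewrite /del spec0E mcoeffD [(_ + _)@_0]mcoeffD -!spec0E scalef0.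
  have -> : (spec0 (if a == (j0, i0) then elimf x0 kap i0 j0 j1
      (head 0 lam - sumn (behead lam)) b else 0))@_(lead x0 b) =
      (a == (j0, i0))%:R * ((b == (j0, i0))%:R - (b == (j1, i0))%:R) :> K.
    case: eqP => _; last by rewrite rmorph0 mcoeff0 mul0r.
    rewrite elimf0 ?mul1r // => i ne.
    by rewrite /kap !xpair_eqE (negbTE ne) !andbF.
  move: aS bS; rewrite !inE /wt /kap.
  case: a b => [ja ia] [jb ib] /=; rewrite !xpair_eqE.
  case: (eqVneq ia i0) => [ia0|ia0] /=; case: (eqVneq ib i0) => [ib0|ib0] /=; rewrite ?eqxx ?andbT ?andbF /=.
  + rewrite ia0 ib0 eqxx andbT.
    by move=> /orP[] /eqP -> /orP[] /eqP ->; rewrite !(eqxx, j10, j01') /= ?simp.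
  + by move=> _ _; rewrite ia0 [i0 == ib]eq_sym (negbTE ib0) andbF !simp.
  + rewrite ib0 (negbTE ia0) [i0 == ia]eq_sym (negbTE ia0) !andbF => _.
    move=> /orP[] /eqP ->; rewrite !(eqxx, j10, j01') /= !simp //.
    by case: (eqVneq ja j1) => _ //=; rewrite mulr0n oppr0.
  + move=> _ _; rewrite [ib == ia]eq_sym [jb == ja]eq_sym !simp.
    by case: ifP => _; rewrite ?simp.
- move=> a aS.
  have H1 : der (scalef x0 kap (wt a)) (Psi (pbase x0 kap)) ((ev a)%:MP *: Psi (pbase x0 kap)).
    apply: scalef_Psi => j; rewrite /wt /ev.
    case: (eqVneq a.2 i0) => [_|a2] /=; first exact: sum_i0.
    case: (eqVneq a.1 j1) => [a1|a1] /=.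
      rewrite big_split /= sum_indicator a1.
      case: (eqVneq j j1) => /= _; first by rewrite big1 ?addr0 // => i _; rewrite andbF.
      rewrite add0r; under eq_bigr do rewrite andbT; exact: sum_i0.
    by rewrite sumrB !sum_indicator subrr.
  have H2 : der (fun b => if a == (j0, i0) then elimf x0 kap i0 j0 j1
      (head 0 lam - sumn (behead lam)) b else 0) (Psi (pbase x0 kap)) 0.
    case: eqP => _; first exact: elimf_Psi.
    move=> m; rewrite mcoeff0 /vf big1 // => x _; by rewrite mcoeff0 mul0r.
  by have := der_add H1 H2; rewrite addr0.
Qed.
End Dimensions.

(** * Sums of l products of two forms *)

Section Full.
Variables (K : closedFieldType) (n d : nat).

(** In the family of all forms, the coefficient of the base monomial is frozen because its tangent
    direction is the value itself. *)
Lemma full_chain (A : pset K n) : (0 < n)%N -> psubset A (ppoint d) ->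
  psubset (ppoint d) A -> krull_chain d A (nforms n d - 1).
Proof.
move=> n0 Ap pA; pose e (_ : unit) := d.
have ed a : (e a <= d)%N by [].
have utt (a : unit) : a = tt by case: a.
pose m0 : 'X_{1..n} := (U_(Ordinal n0) *+ d)%MM.
pose p (_ : unit) : {mpoly K[n]} := 'X_[m0].
have ph a : p a \is (e a).-homog by rewrite dhomogX /= mdegMn mdeg1 mul1n.
have [x0 _ x0m] : exists2 x : fvar n d e, fidx x = tt & fmon x = m0.
  by apply: fvar_ex => //; rewrite mdegMn mdeg1 mul1n.
pose W : {set fvar n d e} := [set~ x0].
have -> : (nforms n d - 1 = #|W|)%N.
  by rewrite cardsC1 card_fvar // (big_pred1 tt) ?subn1 //; case.
apply: (family_chain_ge (gen_homog d ph tt) (W := W) Ap) => [t nz|c0 c cW E].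
  by apply: pA; split=> //; apply: (spec_gen_homog ph t tt).
have cE x : (c0 *: spec0 (gen d e p tt) + \sum_y c y *: tang y (gen d e p tt))@_(fmon x) =
    (x == x0)%:R * c0 + c x.
  rewrite mcoeffD mcoeffZ (spec0_gen ed ph) mcoeffX.
  have fm (y z : fvar n d e) : (fmon y == fmon z) = (y == z).
    by apply/eqP/eqP => [E'|-> //]; apply: fvar_inj => //; rewrite (utt (fidx y)) (utt (fidx z)).
  rewrite -x0m fm eq_sym mulrC; congr (_ + _).
  have tE y : (tang y (gen d e p tt))@_(fmon x) = (y == x)%:R.
    by rewrite (tang_gen ed ph) (utt (fidx y)) eqxx mcoeffX fm.
  transitivity (\sum_y c y * (y == x)%:R).
    rewrite (raddf_sum (mcoeff (fmon x))); apply: eq_bigr => y _.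
    by apply: (etrans (mcoeffZ _ _ _)); rewrite tE.
  rewrite (bigD1 x) //= eqxx mulr1 big1 ?addr0 // => y /negbTE ->.
  by rewrite mulr0.
have c00 : c0 = 0.
  have := cE x0; rewrite E mcoeff0 eqxx mul1r cW ?addr0 // !inE negbK //.
split=> // x; have := cE x.
by rewrite E mcoeff0 c00 mulr0 add0r.
Qed.

End Full.

(** * Tangent monomials at powers of distinct variables *)

Section Pairs.
Variables (K : closedFieldType) (n l d1 s d : nat).
Hypotheses (ln : (2 * l <= n)%N) (l0 : (0 < l)%N) (d10 : (0 < d1)%N) (s0 : (0 < s)%N).
Hypothesis dE : d = (d1 + s)%N.
Local Notation J := ('I_l * bool)%type.

Definition pdeg (c : J) : nat := if c.2 then s else d1.
Local Notation fv := (fvar n d pdeg).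
Local Notation R := {mpoly K[#|{: fv}|]}.
Local Notation partner c := (c.1, ~~ c.2).

Let pdeg_le c : (pdeg c <= d)%N.
Proof. by rewrite /pdeg dE; case: ifP; rewrite ?leq_addr ?leq_addl. Qed.

Let pdeg0 c : (0 < pdeg c)%N.
Proof. by rewrite /pdeg; case: ifP. Qed.

Let pdeg_partner c : (pdeg c + pdeg (partner c) = d)%N.
Proof. by rewrite /pdeg /= dE; case: c.2 => //=; rewrite addnC. Qed.

Let ix_lt (c : J) : (2 * c.1 + c.2 < n)%N.
Proof. by have := ltn_ord c.1; case: c.2 => /=; lia. Qed.
Let ix c : 'I_n := Ordinal (ix_lt c).

Let ix_inj : injective ix.
Proof.
move=> [j b] [j' b'] /(congr1 val) /= E.
have Eb : b = b' by case: b b' E => [] [] /=; lia.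
by congr (_, _) => //; apply/val_inj => /=; move: E; rewrite Eb; lia.
Qed.

Let mon c : 'X_{1..n} := (U_(ix c) *+ pdeg c)%MM.
Let mdeg_mon c : mdeg (mon c) = pdeg c.
Proof. by rewrite mdegMn mdeg1 mul1n. Qed.

Let monE c c' : mon c (ix c') = if c == c' then pdeg c else 0%N.
Proof.
rewrite mulmnE mnm1E (inj_eq ix_inj); case: eqP => _; by rewrite ?mul1n ?mul0n.
Qed.

Definition dv c (m : 'X_{1..n}) := (pdeg c <= m (ix c))%N.

Let dvD c m : dv c m -> exists2 m', m = (m' + mon c)%MM & mdeg m = (mdeg m' + pdeg c)%N.
Proof.
move=> H; have E : m = (m - mon c + mon c)%MM.
  rewrite submK //; apply/mnm_lepP => i; rewrite mulmnE mnm1E.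
  by case: eqP => [<-|_]; rewrite ?mul1n ?mul0n.
by exists (m - mon c)%MM => //; rewrite {1}E mdegD mdeg_mon.
Qed.

Let p c : {mpoly K[n]} := 'X_[mon c].
Let ph c : p c \is (pdeg c).-homog.
Proof. by rewrite dhomogX /= mdeg_mon. Qed.

Local Notation G c := (gen d pdeg p c).

Let Psi2 : {mpoly R[n]} := \sum_j G (j, false) * G (j, true).

Let Psi2_homog : Psi2 \is d.-homog.
Proof.
apply: rpred_sum => j _; rewrite [X in _ \is X.-homog]dE.
by apply: dhomogM; [apply: (gen_homog d ph (j, false))|apply: (gen_homog d ph (j, true))].
Qed.

(** The exponent of the tangent vector in the direction [x]: the varied monomial times the power
    that is the base form of the partner factor. *)
Let img (x : fv) : 'X_{1..n} := (fmon x + mon (partner (fidx x)))%MM.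

Let mdeg_img x : mdeg (img x) = d.
Proof. by rewrite mdegD fmon_deg mdeg_mon pdeg_partner. Qed.

(** Several parameters share a tangent monomial; the one kept has as partner the base power of
    largest index dividing it. Representatives thus correspond to the monomials of degree [d]
    divisible by some base power. *)
Let rep (x : fv) := [forall c, dv c (img x) ==> (ix c <= ix (partner (fidx x)))%N].

Let dv_img x : dv (partner (fidx x)) (img x).
Proof. by rewrite /dv mnmDE monE eqxx leq_addl. Qed.

Let partnerK (c : J) : partner (partner c) = c.
Proof. by case: c => j b; rewrite /= negbK. Qed.

Let partner_inj (c c' : J) : partner c = partner c' -> c = c'.
Proof. by case: c c' => [j b] [j' b'] [-> /negb_inj ->]. Qed.

Let rep_inj x y : rep x -> rep y -> img x = img y -> x = y.
Proof.
move=> /forallP rx /forallP ry E.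
have Ei : partner (fidx x) = partner (fidx y).
  apply/ix_inj/val_inj/eqP; rewrite eqn_leq.
  apply/andP; split; [apply: (implyP (ry _)); rewrite -E | apply: (implyP (rx _)); rewrite E]; exact: dv_img.
apply: fvar_inj; first exact: partner_inj.
by move: E; rewrite /img Ei => /addIm.
Qed.

Let imgm_lt x : (mdeg (img x) < d.+1)%N.
Proof. by rewrite mdeg_img. Qed.
Let imgm_deg x : mdeg (BMultinom (imgm_lt x)) == d.
Proof. exact/eqP/mdeg_img. Qed.
Let imgm x : monom_of_deg n d := exist _ (BMultinom (imgm_lt x)) (imgm_deg x).

Let j0 : 'I_l := Ordinal l0.

Let pick c : exists2 x : fv, fidx x = c & fmon x = mon c.
Proof. by apply: (fvar_ex pdeg_le); rewrite mdeg_mon. Qed.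

Let dv_two j c : dv c (mon (j, false) + mon (j, true))%MM -> c.1 = j.
Proof.
rewrite /dv mnmDE !monE; case: eqP => [<- //|_]; case: eqP => [<- //|_].
by rewrite addn0 leqNgt pdeg0.
Qed.

Let rep_base x j : fidx x = (j, false) -> fmon x = mon (j, false) -> rep x.
Proof.
move=> xi xm; apply/forallP => c; apply/implyP; rewrite /img xi xm => /dv_two cj.
by rewrite /= cj; case: c.2; rewrite leq_add2l.
Qed.

Let sum_pair (V : nmodType) (F : J -> V) :
  \sum_j (F (j, false) + F (j, true)) = \sum_c F c.
Proof.
rewrite (eq_bigr (fun c : J => F (c.1, c.2))) => [|[]//].
rewrite -(pair_bigA _ (fun j b => F (j, b))) /=; apply: eq_bigr => j _.
by rewrite big_bool addrC.
Qed.

Let spec0_Psi2 : spec0 Psi2 = \sum_j 'X_[mon (j, false) + mon (j, true)].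
Proof.
rewrite /Psi2 rmorph_sum; apply: eq_bigr => j _.
by rewrite rmorphM /= !(spec0_gen pdeg_le ph) mpolyXD.
Qed.

Let tang_Psi2 x : tang x Psi2 = 'X_[img x].
Proof.
rewrite /Psi2 (raddf_sum (tang x)).
transitivity (\sum_j (((if fidx x == (j, false) then 'X_[fmon x] else 0) * p (j, true) +
    (if fidx x == (j, true) then 'X_[fmon x] else 0) * p (j, false)) : {mpoly K[n]})).
  apply: eq_bigr => j _.
  apply: (etrans (tangM _ _ _)).
  by rewrite !(tang_gen pdeg_le ph) !(spec0_gen pdeg_le ph) [p (j, false) * _]mulrC.
rewrite (sum_pair (fun c => (if fidx x == c then 'X_[fmon x] else 0) * p (partner c))).
rewrite (bigD1 (fidx x)) //= eqxx big1 ?addr0 /img ?mpolyXD // => c ne.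
by rewrite eq_sym (negbTE ne) mul0r.
Qed.

Let spec_Psi2 t : spec t Psi2 = \sum_j spec t (G (j, false)) * spec t (G (j, true)).
Proof. by rewrite /Psi2 rmorph_sum; apply: eq_bigr => j _; rewrite rmorphM. Qed.

Section Base.
Variable x0 : fv.
Hypotheses (x0i : fidx x0 = (j0, false)) (x0m : fmon x0 = mon (j0, false)).

(** [x0] is left out because its tangent monomial already occurs in the value at the base point. *)
Let W : {set fv} := [set x | rep x && (x != x0)].

Let cardW : #|[set x | rep x]| = #|W|.+1.
Proof.
rewrite (cardsD1 x0) inE (rep_base x0i x0m) add1n; congr _.+1.
by apply: eq_card => x; rewrite !inE andbC.
Qed.

(** When every monomial is divisible by a base power, the representatives account for all
    coordinates, and distinct monomials are independent. *)
Lemma pairs_chain (A : pset K n) : psubset A (ppoint d) ->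
  (forall F, F != 0 -> (exists2 g : J -> {mpoly K[n]}, (forall c, g c \is (pdeg c).-homog)
     & F = \sum_j g (j, false) * g (j, true)) -> A F) ->
  (forall m : 'X_{1..n}, mdeg m = d -> exists c, dv c m) ->
  krull_chain d A (#|{: monom_of_deg n d}| - 1).
Proof.
move=> Ap SA hit.
have cR : #|[set x | rep x]| = #|{: monom_of_deg n d}|.
  rewrite -(card_in_imset (f := imgm)); last first.
    move=> x y; rewrite !inE => rx ry /(congr1 (fun m => val (val m))) /=.
    exact: rep_inj.
  apply: eq_card => m; rewrite [RHS]inE; apply/imsetP.
  have md : mdeg (val (val m)) = d by apply/eqP/(valP m).
  have [c0 c0m] := hit _ md.
  have [c cm cmax] : exists2 c, dv c (val (val m)) &
      forall c', dv c' (val (val m)) -> (ix c' <= ix c)%N.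
    by case: (@arg_maxnP _ c0 (fun c => dv c (val (val m))) (fun c => ix c : nat) c0m) => c cm cmax; exists c.
  have [m' mE mdE] := dvD cm.
  have [|x xi xm] := @fvar_ex n d _ _ pdeg_le (partner c) m'.
    by apply/eqP; rewrite -(eqn_add2r (pdeg c)) -mdE md addnC pdeg_partner.
  have imgx : img x = val (val m) by rewrite /img xi partnerK xm -mE.
  exists x; last by apply/val_inj/val_inj; rewrite /= imgx.
  rewrite inE; apply/forallP => c'; apply/implyP; rewrite imgx xi partnerK.
  exact: cmax.
have -> : (#|{: monom_of_deg n d}| - 1 = #|W|)%N by rewrite -cR cardW subn1.
apply: (family_chain_ge Psi2_homog (W := W) Ap) => [t nz|c0 c cW E].
  apply: SA => //; exists (fun c => spec t (G c)); last exact: spec_Psi2.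
  by move=> c; apply: spec_gen_homog.
have img0 : img x0 = (mon (j0, false) + mon (j0, true))%MM by rewrite /img x0i x0m.
have cE m : c0 * (\sum_j (mon (j, false) + mon (j, true) == m)%MM%:R) +
    \sum_y c y * (img y == m)%:R = 0.
  rewrite -[RHS](mcoeff0 K m) -E mcoeffD mcoeffZ spec0_Psi2; congr (_ * _ + _).
    by rewrite (raddf_sum (mcoeff m)); apply: eq_bigr => j _; rewrite /= mcoeffX.
  rewrite (raddf_sum (mcoeff m)); apply: eq_bigr => y _.
  by apply: (etrans _ (esym (mcoeffZ _ _ _))); rewrite tang_Psi2 mcoeffX.
have cimg x : rep x -> \sum_y c y * (img y == img x)%:R = c x.
  move=> rx; rewrite (bigD1 x) //= eqxx mulr1 big1 ?addr0 // => y ne.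
  case: (boolP (y \in W)) => [|/cW ->]; last by rewrite mul0r.
  rewrite inE => /andP[ry _]; case: eqP => [/(rep_inj ry rx) E'|]; last by rewrite mulr0.
  by rewrite E' eqxx in ne.
have c00 : c0 = 0.
  have := cE (img x0); rewrite (cimg _ (rep_base x0i x0m)) cW ?inE ?eqxx ?andbF // addr0.
  rewrite (bigD1 j0) //= img0 eqxx big1 ?addr0 ?mulr1 // => j ne.
  case: eqP => // E'; case/eqP: ne.
  have : dv (j, false) (mon (j0, false) + mon (j0, true))%MM.
    by rewrite -E' /dv mnmDE !monE eqxx leq_addr.
  by move/dv_two.
split=> // x; case: (boolP (x \in W)) => [|/cW //]; rewrite inE => /andP[rx _].
by have := cE (img x); rewrite c00 mul0r add0r cimg.
Qed.

Let derPsi2 del : (forall c, del c \is (pdeg c).-homog) ->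
  der del Psi2 (\sum_c del c * G (partner c)).
Proof.
move=> dh; rewrite -(sum_pair (fun c => del c * G (partner c))) /Psi2.
apply: der_sum => j; rewrite [del (j, true) * _]mulrC.
by apply: derM; apply: (der_gen pdeg_le ph).
Qed.

Let dead x : x \notin W -> x = x0 \/ ~~ rep x.
Proof. by rewrite inE negb_and negbK orbC => /orP[/eqP|]; [left|right]. Qed.

(** One factor of each summand is scaled, so the eigenvalue is [1]. Apart from [x], the pure powers
    that move belong to [W], where components are unconstrained. *)
Let scale_field x c0 (w : J -> bool) : fidx x = c0 -> fmon x = mon c0 -> x \notin W ->
  (forall j, (w (j, false) + w (j, true))%N = 1%N) ->
  (forall c, w c -> c <> c0 -> exists2 y, y \in W & fidx y = c /\ fmon y = mon c) ->
  w c0 ->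
  exists del : J -> {mpoly R[n]}, exists ev : K,
    der del Psi2 (ev%:MP *: Psi2) /\
    forall y, y \notin W -> (spec0 (del (fidx y)))@_(fmon y) = (x == y)%:R.
Proof.
move=> xi xm xW w1 wW wc0.
exists (fun c => (w c)%:R *: G c), 1; split.
  have := @derPsi2 (fun c => (w c)%:R *: G c); rewrite -(sum_pair (fun c => (w c)%:R *: G c * G (partner c))) /= => H.
  have <- : \sum_j ((w (j, false))%:R *: G (j, false) * G (j, true) +
      (w (j, true))%:R *: G (j, true) * G (j, false)) = 1%:MP *: Psi2.
    rewrite mpolyC1 scale1r; apply: eq_bigr => j _.
    rewrite -!scalerAl [G (j, true) * _]mulrC -scalerDl -natrD w1.
    by rewrite scale1r.
  by apply: H => c; apply: rpredZ; apply: gen_homog.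
move=> y yW; rewrite spec0E mcoeffZ rmorphM rmorph_nat /= -spec0E (spec0_gen pdeg_le ph) mcoeffX.
case: (eqVneq (mon (fidx y)) (fmon y)) => [ym|ym]; last first.
  rewrite mulr0; case: eqP => // E; move: ym; rewrite -E xi xm eqxx //.
case: (boolP (w (fidx y))) => wy; last first.
  by rewrite mul0r; case: eqP => // E; move: wy; rewrite -E xi wc0.
rewrite mulr1; case: (eqVneq (fidx y) c0) => [yi|yi].
  by rewrite (_ : x = y) ?eqxx //; apply: fvar_inj; rewrite ?xi ?yi // xm -ym yi.
have [z zW [zi zm]] := wW _ wy (elimN eqP yi).
by move: yW; rewrite (_ : y = z) ?zW //; apply: fvar_inj; rewrite ?zi // zm ym.
Qed.

Let subr_mulAC (S : comNzRingType) (u v w : S) : u * v * w - u * w * v = 0.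
Proof. by rewrite mulrAC subrr. Qed.

(** With [b] the largest index dividing [img x] and [fmon x = m + mon b], the relation
    [X^m G_b * G_a - X^m G_a * G_b = 0] moves [x] against the representative of the same tangent
    monomial. That representative lies in [W] unless it is [x0], which occurs only for the excluded
    [x]. *)
Let koszul_field x : ~~ rep x -> ~ (fidx x = (j0, true) /\ fmon x = mon (j0, true)) ->
  exists del : J -> {mpoly R[n]}, exists ev : K,
    der del Psi2 (ev%:MP *: Psi2) /\
    forall y, y \notin W -> (spec0 (del (fidx y)))@_(fmon y) = (x == y)%:R.
Proof.
move=> nrep nx1; pose a := partner (fidx x).
have [b bx bmax] : exists2 b, dv b (img x) & forall c, dv c (img x) -> (ix c <= ix b)%N.
  case: (@arg_maxnP _ a (fun c => dv c (img x)) (fun c => ix c : nat) (dv_img x)) => b bx bmax.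
  by exists b.
have ab : a == b = false.
  apply/negbTE; apply: contra nrep => /eqP ab; apply/forallP => c; apply/implyP.
  by rewrite -/a ab; apply: bmax.
have bm : dv b (fmon x) by move: bx; rewrite /dv /img mnmDE -/a monE ab addn0.
have [m mE mdE] := dvD bm; rewrite fmon_deg in mdE.
have da : (pdeg (fidx x) + pdeg a = d)%N by rewrite /a pdeg_partner.
have db := pdeg_partner b.
pose del c : {mpoly R[n]} := (if c == fidx x then 'X_[m] * G b else 0) -
  (if c == partner b then 'X_[m] * G a else 0).
have XG k c : (mdeg m + pdeg c = k)%N -> ('X_[m] * G c : {mpoly R[n]}) \is k.-homog.
  by move=> <-; apply: dhomogM; [rewrite dhomogX | apply: gen_homog].
have delh c : del c \is (pdeg c).-homog.
  apply: rpredB; first by case: eqP => [->|_]; [apply: XG; rewrite mdE|apply: rpred0].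
  by case: eqP => [->|_]; [apply: XG; lia|apply: rpred0].
have pick_sum (c0 : J) (F : {mpoly R[n]}) :
    \sum_c (if c == c0 then F else 0) * G (partner c) = F * G (partner c0).
  by rewrite (bigD1 c0) //= eqxx big1 ?addr0 // => c /negbTE ->; rewrite mul0r.
exists del, 0; split.
  have sumE : \sum_c del c * G (partner c) = 0.
    transitivity ('X_[m] * G b * G a - 'X_[m] * G a * G (partner (partner b))).
      apply: (etrans _ (f_equal2 (fun u v => u - v) (pick_sum (fidx x) _) (pick_sum (partner b) _))).
      apply: (etrans _ (sumrB _ _ _ _)).
      by apply: eq_bigr => c _; exact: mulrBl.
    by rewrite (partnerK b) subr_mulAC.
  by have := derPsi2 delh; rewrite sumE mpolyC0 scale0r.
have spec0X m' c : spec0 ('X_[m'] * G c : {mpoly R[n]}) = 'X_[(m' + mon c)%MM].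
  rewrite rmorphM /= (spec0_gen pdeg_le ph) mpolyXD; congr (_ * _); exact: map_mpolyX.
move=> y yW.
have Z2 : (spec0 (if fidx y == partner b then 'X_[m] * G a else 0 : {mpoly R[n]}))@_(fmon y) = 0.
  case: eqP => [yi|_]; last by rewrite rmorph0 mcoeff0.
  rewrite spec0X mcoeffX; case: eqP => // ym.
  have iy : img y = img x.
    by rewrite /img yi partnerK -ym mE -/a -!addmA; congr (_ + _)%MM; rewrite addmC.
  have ry : rep y.
    apply/forallP => c; apply/implyP; rewrite iy yi partnerK; exact: bmax.
  case: (dead yW) => [yx0|]; last by rewrite ry.
  move: yi ym; rewrite yx0 x0i x0m => bi ym.
  have bE : b = (j0, true) by rewrite -[b]partnerK -bi.
  have aE : a = (j0, false).
    apply/eqP; apply: contraT => ne.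
    have := congr1 (fun m' : 'X_{1..n} => m' (ix a)) ym.
    rewrite mnmDE !monE eqxx eq_sym (negbTE ne) => /eqP.
    by rewrite addn_eq0 (gtn_eqF (pdeg0 a)) andbF.
  case: nx1; split; first by rewrite -[fidx x]partnerK -/a aE.
  rewrite mE bE (_ : m = 0%MM) ?add0m //.
  by apply: (@addIm _ (mon a)); rewrite ym aE add0m.
have Z1 : (spec0 (if fidx y == fidx x then 'X_[m] * G b else 0 : {mpoly R[n]}))@_(fmon y) = (x == y)%:R.
  case: eqP => [yi|ne]; last first.
    by rewrite rmorph0 mcoeff0; case: eqP => // E; case: ne; rewrite E.
  rewrite spec0X -mE mcoeffX; congr (nat_of_bool _)%:R; apply/eqP/eqP => [ym|-> //].
  exact: fvar_inj.
rewrite /del rmorphB mcoeffB.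
apply: (etrans (f_equal2 (fun u v : K => u - v) Z1 Z2)); exact: subr0.
Qed.

(** A monomial divisible by no base power is the tangent monomial of no parameter. There are then
    fewer representatives than coordinates, and [W] omits [x0] besides. *)
Lemma pairs_chain_le (charK0 : [pchar K] =i pred0) (A B : pset K n) k :
  (forall F, B F -> exists2 g : J -> {mpoly K[n]}, (forall c, g c \is (pdeg c).-homog)
     & F = \sum_j g (j, false) * g (j, true)) ->
  psubset A (hull d B) ->
  (exists2 m : 'X_{1..n}, mdeg m = d & forall c, ~~ dv c m) ->
  krull_chain d A k -> (k + 2 <= #|{: monom_of_deg n d}|)%N.
Proof.
move=> BS AB [m md mbad] chA.
have ml : (mdeg m < d.+1)%N by rewrite md.
have Pm : mdeg (BMultinom ml) == d by apply/eqP.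
have cR : (#|[set x | rep x]| < #|{: monom_of_deg n d}|)%N.
  rewrite -(card_in_imset (f := imgm)); last first.
    move=> x y; rewrite !inE => rx ry /(congr1 (fun m => val (val m))) /=.
    exact: rep_inj.
  rewrite -cardsT; apply: proper_card; apply/properP; split; first exact: subsetT.
  exists (exist _ (BMultinom ml) Pm); first by rewrite inE.
  apply/imsetP => -[x _ /(congr1 (fun m => val (val m))) /= E].
  by have := mbad (partner (fidx x)); rewrite E dv_img.
have [x1 x1i x1m] := pick (j0, true).
have fields x : exists D : (J -> {mpoly R[n]}) * K, x \notin W ->
    der D.1 Psi2 (D.2%:MP *: Psi2) /\
    forall y, y \notin W -> (spec0 (D.1 (fidx y)))@_(fmon y) = (x == y)%:R.
  case: (boolP (x \in W)) => xW; first by exists (fun=> 0, 0).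
  suff [del [ev H]] : exists del : J -> {mpoly R[n]}, exists ev : K,
      der del Psi2 (ev%:MP *: Psi2) /\
      forall y, y \notin W -> (spec0 (del (fidx y)))@_(fmon y) = (x == y)%:R.
    by exists (del, ev).
  have goodW j : j != j0 -> exists2 y, y \in W & fidx y = (j, false) /\ fmon y = mon (j, false).
    move=> ne; have [y yi ym] := pick (j, false); exists y => //.
    rewrite inE (rep_base yi ym) /=; apply: contraNneq ne => E.
    by move: yi; rewrite E x0i => -[->].
  (* This parameter has the tangent monomial of [x0], which is not in [W], so the Koszul field would
     not be dual to it. Scaling the [true] factor of [j0] and the [false] factors of the other
     summands is. *)
  case: (classic (fidx x = (j0, true) /\ fmon x = mon (j0, true))) => [[xi xm]|nx1].
    apply: (@scale_field x (j0, true) (fun c => if c.2 then c.1 == j0 else c.1 != j0)) => //=.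
    - by move=> j; case: eqP.
    - move=> [j []] /=; first by move=> /eqP -> [].
      by move=> /goodW.
  case: (dead xW) => [xx0|nrep]; last exact: koszul_field nrep nx1.
  apply: (@scale_field x (j0, false) (fun c => ~~ c.2)) => //=; try by rewrite xx0.
  - move=> [j []] //= _ ne; apply: goodW.
    by apply/eqP => E; apply: ne; rewrite E.
have [D HD] := choice _ fields.
have : (k <= #|W|)%N.
  apply: (@family_chain_le _ _ _ _ _ Psi2 W A _ charK0 (fun x => (D x).1) (fun x => (D x).2) B) => //.
  - by move=> F /AB[].
  - by move=> x y xW yW; have [_ H] := HD x xW; apply: H.
  - by move=> x xW; have [] := HD x xW.
  move=> F /BS[g gh ->]; have [t tg] := spec_gen_surj pdeg_le ph gh.
  by exists t; rewrite spec_Psi2; apply: eq_bigr => j _; rewrite !tg.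
move: cR; rewrite cardW; lia.
Qed.

End Base.

Lemma pairs_full_chain (A : pset K n) : psubset A (ppoint d) ->
  (forall F, F != 0 -> (exists2 g : J -> {mpoly K[n]}, (forall c, g c \is (pdeg c).-homog)
     & F = \sum_j g (j, false) * g (j, true)) -> A F) ->
  (forall m : 'X_{1..n}, mdeg m = d ->
     exists c : J, exists2 i : 'I_n, i = (2 * c.1 + c.2)%N :> nat & (pdeg c <= m i)%N) ->
  krull_chain d A (#|{: monom_of_deg n d}| - 1).
Proof.
move=> Ap SA hit; have [x0 x0i x0m] := pick (j0, false).
apply: (pairs_chain x0i x0m Ap SA) => m /hit[c [i iE ci]]; exists c.
by rewrite /dv (_ : ix c = i) //; apply/val_inj.
Qed.

Lemma pairs_proper_chain_le (charK0 : [pchar K] =i pred0) (A B : pset K n) k :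
  (forall F, B F -> exists2 g : J -> {mpoly K[n]}, (forall c, g c \is (pdeg c).-homog)
     & F = \sum_j g (j, false) * g (j, true)) ->
  psubset A (hull d B) ->
  (exists2 m : 'X_{1..n}, mdeg m = d & forall (c : J) (i : 'I_n),
     i = (2 * c.1 + c.2)%N :> nat -> (m i < pdeg c)%N) ->
  krull_chain d A k -> (k + 2 <= #|{: monom_of_deg n d}|)%N.
Proof.
move=> BS AB [m md mbad]; have [x0 x0i x0m] := pick (j0, false).
apply: (pairs_chain_le x0i x0m charK0 BS AB); exists m => // c.
by rewrite /dv -ltnNge; apply: mbad.
Qed.

End Pairs.

(** * Filling and defectivity *)

Lemma sum_alternating l a b :
  (\sum_(i < 2 * l) (if odd i then b else a) = l * (a + b))%N.
Proof.
elim: l => [|l IH]; first by rewrite big_ord0.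
rewrite (_ : (2 * l.+1 = (2 * l).+2)%N); last lia.
by rewrite !big_ord_recr /= IH oddM /= mulSn -addnA addnC.
Qed.

Section Partition.
Variables (K : closedFieldType) (n : nat) (lam : seq nat).
Hypotheses (n1 : (1 < n)%N) (lam0 : (0 < size lam)%N) (lam1 : all (leq 1) lam).
Local Notation d := (sumn lam).
Local Notation X := (reducible_forms K n lam).
Local Notation r := (size lam).
Local Notation sigma l := (secant_variety d l X).

Let n0 : (0 < n)%N := ltnW n1.
Let i0 : 'I_r := Ordinal lam0.

Lemma sums_mono l l' : (l <= l')%N -> psubset (@sums K n lam l) (@sums K n lam l').
Proof.
move=> ll' F [nz [G Gh FE]]; split=> //.
pose G' (j : 'I_l') i := if insub (val j) is Some j' then G j' i else 0.
exists G' => [j i|].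
  by rewrite /G'; case: insubP => [j' _ _|_]; [apply: Gh|apply: rpred0].
rewrite FE (bigID (fun j : 'I_l' => (j < l)%N)) /= [X in _ = _ + X]big1 ?addr0.
  rewrite (big_ord_narrow ll') /=; apply: eq_bigr => j _; apply: eq_bigr => i _.
  by rewrite /G' /= valK.
by move=> j jl; rewrite (bigD1 i0) //= /G' insubN ?mul0r.
Qed.

Lemma sums_of_pairs l (g : 'I_l * bool -> {mpoly K[n]}) a b F : lam = [:: a; b] ->
  F != 0 -> (forall c, g c \is (pdeg a b c).-homog) ->
  F = \sum_j g (j, false) * g (j, true) -> sums lam l F.
Proof.
move=> lamE nz gh FE; rewrite lamE; split=> //.
exists (fun j i => g (j, i != ord0)) => [j i|].
  by have := gh (j, i != ord0); rewrite /pdeg /=; case: i => [[|[|]]].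
by rewrite FE; apply: eq_bigr => j _; rewrite big_ord_recl big_ord1.
Qed.

(** All factors after the first are multiplied together. The converse [sums_of_pairs] is for two
    parts, since a form of degree [s] need not factor further. *)
Lemma pairs_of_sums l (F : {mpoly K[n]}) : sums lam l F ->
  exists2 g : 'I_l * bool -> {mpoly K[n]},
    (forall c, g c \is (pdeg (head 0 lam) (sumn (behead lam)) c).-homog)
    & F = \sum_j g (j, false) * g (j, true).
Proof.
move=> [_ [G Gh ->]].
exists (fun c => if c.2 then \prod_(i | i != i0) G c.1 i else G c.1 i0).
  move=> [j []]; rewrite /pdeg /=; last by have := Gh j i0; rewrite nth0.
  have -> : sumn (behead lam) = (\sum_(i < r | i != i0) nth 0 lam i)%N.
    have E : d = (head 0 lam + sumn (behead lam))%N by case: (lam) lam0.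
    have E' : d = (nth 0 lam i0 + \sum_(i < r | i != i0) nth 0 lam i)%N.
      by rewrite sumnE (big_nth 0%N) big_mkord (bigD1 i0).
    by move: E'; rewrite E nth0 => /addnI.
  by elim/big_rec2: _ => [|i P k _ IH]; [exact: dhomog1|exact: dhomogM].
by apply: eq_bigr => j _; rewrite (bigD1 i0).
Qed.

(** By pigeonhole each monomial has an exponent at least [s], so [F] is a sum of terms [A_j x_j^s],
    and [x_j^s] splits into powers with the degrees of the remaining parts. *)
Lemma sums_powers (F : {mpoly K[n]}) : (n * (sumn (behead lam) - 1) < d)%N -> ppoint d F -> sums lam n F.
Proof.
set s := sumn (behead lam) => nd [nz Fh]; split=> //.
have hit m : m \in msupp F -> exists i : 'I_n, (s <= m i)%N.
  move=> mF; apply: NNPP => H; move: nd; rewrite -(dhomog_mf Fh mF) /= mdegE ltnNge => /negP; apply.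
  have <- : (\sum_(i < n) (s - 1) = n * (s - 1))%N by rewrite sum_nat_const card_ord.
  apply: leq_sum => i _.
  case: (leqP (s) (m i)) => si; first by case: H; exists i.
  by move: si; clear; lia.
pose ind (m : 'X_{1..n}) : 'I_n := odflt (Ordinal n0) [pick i : 'I_n | (s <= m i)%N].
have indP m : m \in msupp F -> (s <= m (ind m))%N.
  move=> /hit[i si]; rewrite /ind; case: pickP => //= H.
  by have := H i; rewrite si.
pose A j : {mpoly K[n]} := \sum_(m <- msupp F | ind m == j) F@_m *: 'X_[m - U_(j) *+ s].
have dE : d = (head 0 lam + s)%N by rewrite /s; case: (lam) lam0.
have powE m j : m \in msupp F -> ind m == j -> m = (m - U_(j) *+ s + U_(j) *+ s)%MM.
  move=> mF /eqP mj; rewrite submK //; apply/mnm_lepP => i; rewrite mulmnE mnm1E.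
  by case: eqP => [<-|_]; rewrite ?mul1n ?mul0n // -mj indP.
have Ah j : A j \is (head 0 lam).-homog.
  rewrite /A big_seq_cond; apply: rpred_sum => m /andP[mF mj]; apply: rpredZ.
  rewrite dhomogX /= -(eqn_add2r s) -dE -(dhomog_mf Fh mF) /= {2}(powE m j mF mj).
  by rewrite mdegD mdegMn mdeg1 mul1n.
exists (fun j i => if i == i0 then A j else 'X_j ^+ nth 0 lam i) => [j i|].
  case: eqP => [->|_]; first by rewrite nth0.
  have := @dhomogMn n K mdeg 1 'X_j (nth 0 lam i); rewrite mul1n; apply.
  by rewrite dhomogX /= mdeg1.
rewrite {1}(mpolyE F) (partition_big ind xpredT) //=; apply: eq_bigr => j _.
have restE : (\sum_(i < r | i != i0) nth 0 lam i)%N = s.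
  have E' : d = (nth 0 lam i0 + \sum_(i < r | i != i0) nth 0 lam i)%N.
    by rewrite sumnE (big_nth 0%N) big_mkord (bigD1 i0).
  by move: E'; rewrite dE nth0 => /addnI.
rewrite (bigD1 i0) //= (eq_bigr (fun i : 'I_r => 'X_j ^+ nth 0 lam i)) => [|i /negbTE -> //].
rewrite -expr_sum restE /A mulr_suml big_seq_cond [RHS]big_seq_cond.
apply: eq_bigr => m /andP[mF mj]; rewrite -scalerAl mpolyXn -mpolyXD.
by rewrite -(powE m j mF mj).
Qed.

Section SmallLength.
Hypotheses (charK0 : [pchar K] =i pred0) (lam2 : (2 <= r)%N).
Hypothesis lam_head : forall i, (nth 0%N lam i <= head 0%N lam)%N.
Variable l : nat.
Hypotheses (l2 : (2 <= l)%N) (ln : (2 * l <= n)%N).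
Local Notation D := (forms_dim n lam).
Local Notation S := (@sums K n lam l).
Local Notation N := (nforms n d).

Let dE : d = (head 0 lam + sumn (behead lam))%N.
Proof. by case: (lam) lam0. Qed.

Let head_gt0 : (0 < head 0 lam)%N.
Proof. by case: (lam) lam0 lam1 => //= a s _ /andP[]. Qed.

Let behead_gt0 : (0 < sumn (behead lam))%N.
Proof. by case: (lam) lam2 lam1 => [|a [|b s]] //= _ /and3P[_ b0 _]; rewrite addn_gt0 b0. Qed.

(** This selects the closure branch in the definition of [secant_variety]. *)
Let l_lt_nforms : (l < N)%N.
Proof.
have ln' : (l < n)%N by lia.
apply: leq_trans ln' _; rewrite /nforms.
have {1}<- : 'C(n, n - 1) = n by rewrite bin_sub ?bin1.
by apply: leq_bin2l; rewrite dE; move: head_gt0; lia.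
Qed.

Let N_card : #|{: monom_of_deg n d}| = N.
Proof. exact: card_monom_of_deg. Qed.

Let sigmaP F : sigma l F <-> hull d S F.
Proof. exact: secant_varietyP. Qed.

Let sigma_ppoint : psubset (sigma l) (ppoint d).
Proof. by move=> F /sigmaP[]. Qed.

Let sums_sigma : psubset S (sigma l).
Proof. by move=> F SF; apply/sigmaP; apply: sub_hull SF; apply: sums_ppoint. Qed.

Let sigma_closed : zariski_closed d (sigma l).
Proof.
have [G [Gh HG]] := hull_closed d S; exists G; split=> // F.
by split=> [/sigmaP/HG|/HG/sigmaP].
Qed.

Let reducible_chain (A : pset K n) : psubset A (ppoint d) ->
  psubset (@sums K n lam 1) A -> krull_chain d A D.
Proof.
move=> Ap SA; have := sums_chain charK0 (l := 1) (n := n) (lam := lam) _ _ lam0 lam_head (or_introl erefl) Ap SA.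
rewrite mul1n addnK; apply=> //; lia.
Qed.

Lemma pdim_reducible : pdim d X = D.
Proof.
have ch : krull_chain d X D.
  by apply: reducible_chain; [apply: reducible_ppoint|move=> F /reducibleP].
apply/eqP; rewrite eqn_leq (pdim_ge _ ch) ?andbT; last exact: reducible_ppoint.
by apply: (pdim_le ch) => k; apply: reducible_chain_le.
Qed.

Let sigma_chain : krull_chain d (sigma l) D.
Proof.
apply: reducible_chain => // F /(sums_mono (ltnW l2)).
exact: sums_sigma.
Qed.

(** A missed point would extend the chain beyond the dimension of the ambient space. *)
Lemma secant_fills_chain : krull_chain d (sigma l) (N - 1) -> fills d (sigma l).
Proof.
move=> ch F; split=> [/sigma_ppoint //|pF]; apply: NNPP => nF.
have := ambient_chain_le _ (chain_extend sigma_closed pF nF ch).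
rewrite N_card => /(_ (fun _ => id)); lia.
Qed.

Lemma secant_proper_pdim : ~ fills d (sigma l) -> (pdim d (sigma l) + 2 <= N)%N.
Proof.
move=> nf; have [F pF nF] : exists2 F, ppoint d F & ~ sigma l F.
  apply: NNPP => H; apply: nf => F; split=> [/sigma_ppoint //|pF].
  by apply: NNPP => nF; apply: H; exists F.
have le k : krull_chain d (sigma l) k -> (k <= N - 2)%N.
  move=> /(chain_extend sigma_closed pF nF)/(ambient_chain_le (fun _ => id)).
  rewrite N_card; lia.
have := pdim_le sigma_chain le.
have := ambient_chain_le (fun _ => id) (chain_extend sigma_closed pF nF sigma_chain).
rewrite N_card; lia.
Qed.

Lemma secant_chain : (head 0 lam < sumn (behead lam))%N ->
  krull_chain d (sigma l) (l * D + l - 1).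
Proof. by move=> sep; apply: sums_chain => //; [lia|right]. Qed.

Lemma not_defective_secant : (head 0 lam < sumn (behead lam))%N -> ~~ defective d l X.
Proof.
move=> sep; rewrite /defective /defect /expected_dim pdim_reducible -leqNgt leqn0 subn_eq0.
apply: leq_trans (geq_minr _ _) _; apply: pdim_ge => //.
exact: secant_chain.
Qed.

(** A filling variety reaches [N - 1], which bounds the expected dimension. Otherwise its dimension
    is below [N - 1] as that of a proper closed set, and below [l * D + l - 1] by the syzygy, hence
    below the minimum. *)
Lemma defective_secantP : (sumn (behead lam) <= head 0 lam)%N ->
  (defective d l X <-> ~ fills d (sigma l)).
Proof.
move=> sd; rewrite /defective /defect /expected_dim pdim_reducible subn_gt0.
split=> [lt fl|nf].
  have : (N - 1 <= pdim d (sigma l))%N.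
    by apply: pdim_ge => //; apply: full_chain => // F /fl.
  by move: lt; rewrite leq_min => /andP[/leq_trans H _] /H; rewrite ltnn.
have H1 := secant_proper_pdim nf.
have H2 : (pdim d (sigma l) <= l * D + l - 2)%N.
  apply: (pdim_le sigma_chain) => k chk.
  have AS : psubset (sigma l) (hull d S) by move=> F /sigmaP.
  by have := hull_sums_chain_le charK0 n0 lam0 l2 sd AS chk; lia.
by rewrite leq_min; apply/andP; split; lia.
Qed.

Lemma secant_fills_monomials : fills d (sigma l) ->
  ~ exists2 m : 'X_{1..n}, mdeg m = d & forall (c : 'I_l * bool) (i : 'I_n),
      i = (2 * c.1 + c.2)%N :> nat -> (m i < pdeg (head 0 lam) (sumn (behead lam)) c)%N.
Proof.
move=> fl bad.
have ch : krull_chain d (sigma l) (N - 1) by apply: full_chain => // F /fl.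
have AS : psubset (sigma l) (hull d S) by move=> F /sigmaP.
have := pairs_proper_chain_le ln (ltnW l2) head_gt0 behead_gt0 dE charK0 (@pairs_of_sums l) AS bad ch.
by rewrite N_card; lia.
Qed.

Lemma bounded_monomial (f : 'I_n -> nat) k : (k <= \sum_i f i)%N ->
  exists2 m : 'X_{1..n}, mdeg m = k & forall i, (m i <= f i)%N.
Proof.
elim: k => [|k IH] kf.
  by exists 0%MM => [|i]; rewrite ?mdeg0 ?mnm0E.
have [m mk mf] := IH (ltnW kf).
have [i mi] : exists i, (m i < f i)%N.
  apply: NNPP => H; move: kf; rewrite -mk mdegE ltnNge => /negP; apply.
  by apply: leq_sum => i _; rewrite leqNgt; apply/negP => lt; apply: H; exists i.
exists (m + U_(i))%MM => [|j]; first by rewrite mdegD mdeg1 mk addn1.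
by rewrite mnmDE mnm1E; case: eqP => [<-|_]; rewrite ?addn1 ?addn0.
Qed.

(** The [d]-th power of a variable outside all pairs is divisible by no base power, which forces
    [n = 2 * l]. Exponents at most [d1 - 1] and [s - 1] alternately also avoid all base powers, and
    reach every degree up to [l * (d - 2)]. *)
Lemma secant_fills_length : fills d (sigma l) -> n = (2 * l)%N /\ (l * (d - 2) < d)%N.
Proof.
move=> /secant_fills_monomials; move: head_gt0 behead_gt0 dE.
set d1 := head 0 lam; set s := sumn (behead lam) => d10 s0 d1s nobad.
have nl : n = (2 * l)%N.
  apply/eqP; rewrite eqn_leq ln andbT leqNgt; apply/negP => lt; apply: nobad.
  pose i1 : 'I_n := Ordinal lt.
  exists (U_(i1) *+ d)%MM => [|c i ic]; first by rewrite mdegMn mdeg1 mul1n.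
  rewrite mulmnE mnm1E (_ : (i1 == i) = false) ?mul0n.
    by rewrite /pdeg; case: ifP.
  apply/negbTE; rewrite -val_eqE /= ic.
  have := ltn_ord c.1; case: c.2 => /=; lia.
split=> //; rewrite ltnNge; apply/negP => le; apply: nobad.
have [|m md mf] := @bounded_monomial (fun i : 'I_n => if odd i then (s - 1)%N else (d1 - 1)%N) d.
  have d2E : (d - 2 = d1 - 1 + (s - 1))%N by rewrite d1s; lia.
  by move: le; rewrite d2E -sum_alternating -nl.
exists m => // c i ic; apply: (leq_ltn_trans (mf i)).
rewrite ic oddD oddM /= /pdeg; case: c.2 => /=; lia.
Qed.

Lemma secant_fills_pairs a b : lam = [:: a; b] -> n = (2 * l)%N ->
  (l * (d - 2) < d)%N -> fills d (sigma l).
Proof.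
move=> lamE nl ld; apply: secant_fills_chain; rewrite -N_card.
have [a0 b0] : (0 < a)%N /\ (0 < b)%N by move: lam1; rewrite lamE /= => /and3P[].
have dab : d = (a + b)%N by rewrite lamE /= addn0.
apply: (pairs_full_chain ln (ltnW l2) a0 b0 dab) => // [F nz [g gh FE]|m md].
  by apply: sums_sigma; apply: (sums_of_pairs lamE nz gh FE).
apply: NNPP => H; move: ld; rewrite ltnNge => /negP; apply.
rewrite (_ : (d - 2 = a - 1 + (b - 1))%N); last by rewrite dab; lia.
rewrite -sum_alternating -{1}md mdegE -nl; apply: leq_sum => i _.
have il : (i./2 < l)%N by have := ltn_ord i; rewrite [in X in (_ < X)%N]nl; lia.
rewrite leqNgt; apply/negP => lt; apply: H.
exists (Ordinal il, odd i); exists i; first by rewrite /= mul2n addnC odd_double_half.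
by move: lt; rewrite /pdeg /=; case: odd; lia.
Qed.

End SmallLength.
End Partition.

(** * Numerical classification *)

(** For [l = 2] the parameter count is [2 * 9 + 1 = 19], the dimension of the projective space of
    cubic forms in four variables. *)
Lemma forms_dim_111 : forms_dim 4 [:: 1; 1; 1] = 9%N.
Proof. by rewrite /forms_dim !big_ord_recl big_ord0. Qed.

Local Close Scope ring_scope.

Theorem theorem1p4 (K : closedFieldType) (charK0 : [pchar K]%R =i pred0)
    (n l : nat) (lam : seq nat) (hn : 3 <= n) (hl : 2 <= l)
    (hlam : is_partition lam) (hr : 2 <= size lam) :
  let d := sumn lam in
  let d1 := head 0 lam in
  let s := sumn (behead lam) in
  let X := reducible_forms K n lam in
  let sigma := secant_variety d l X in
  (* (a) *)
  (d1 < s -> 3 <= size lam /\ (2 * l <= n -> ~~ defective d l X)) /\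
  (* (b) *)
  (s <= d1 -> 2 * l <= n -> (defective d l X <-> ~ fills d sigma)) /\
  (* (c) *)
  (n <= l -> (n - 1) * (s - 1) <= d1 -> fills d sigma) /\
  (2 * l <= n ->
     (fills d sigma <->
        [/\ n = 4, l = 2 & lam \in [:: [:: 1; 1]; [:: 2; 1]; [:: 1; 1; 1]]] \/
        [/\ n = 2 * l, 6 <= n & lam = [:: 1; 1]])).
Proof.
move=> d d1 s X sigma.
have /andP[lam_sorted lam1] := hlam.
have lam0 : 0 < size lam := ltnW hr.
have n1 : 1 < n := ltnW hn.
have lam_head i : nth 0 lam i <= head 0 lam.
  case: (ltnP i (size lam)) => il; last by rewrite nth_default.
  rewrite -nth0; apply: (sorted_leq_nth (leT := geq)) => //.
  - by move=> x y z /= xy yz; apply: leq_trans yz xy.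
  - by move=> x /=.
have dE : d = d1 + s by rewrite /d /d1 /s; case: (lam) lam0.
have s0 : 0 < s.
  by rewrite /s; case: (lam) hr lam1 => [|a [|b t]] //= _ /and3P[_ b0 _]; rewrite addn_gt0 b0.
have d10 : 0 < d1.
  by rewrite /d1; case: (lam) lam0 lam1 => //= a t _ /andP[].
split; [|split; [|split]].
- move=> ds; split; last by move=> ln; apply: not_defective_secant.
  rewrite leqNgt; apply/negP => r2; move: ds lam_sorted; rewrite /d1 /s.
  case: (lam) hr r2 => [|a [|b [|]]] //= _ _; rewrite addn0 andbT.
  by rewrite ltnNge => /negP.
- by move=> sd ln; apply: defective_secantP.
- move=> nl ds; apply: fills_of_sums => // F pF; apply: (sums_mono lam0 nl).
  apply: sums_powers => //.
  (* From [(n - 1) * (s - 1) <= d1] follows [n * (s - 1) <= d1 + s - 1 = d - 1]. *)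
  rewrite -/s -/d dE; nia.
move=> ln; split.
  move=> /(secant_fills_length n1 lam0 lam1 charK0 hr hl ln)[nl lt].
  rewrite -/d in lt.
  (* With [l >= 2], the inequality [l * (d - 2) < d] gives [d < 4], and [l < 3] when [d = 3]. *)
  have d2 : d = 2 \/ d = 3 /\ l = 2.
    have le2 : 2 * (d - 2) <= l * (d - 2) by rewrite leq_mul2r hl orbT.
    have [E|[E|E]] : d = 2 \/ d = 3 \/ 3 < d by lia.
    - by left.
    - by right; move: lt; rewrite E; lia.
    - lia.
  have lamE : (d = 2 -> lam = [:: 1; 1]) /\
      (d = 3 -> lam \in [:: [:: 2; 1]; [:: 1; 1; 1]]).
    rewrite /d; case: (lam) hr lam1 lam_sorted => [|a [|b [|c [|e t]]]] //= _;
      rewrite ?addn0 ?andbT => /andP[a0]; [| |].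
    - move=> b0 ba; split=> E; first by congr [:: _; _]; lia.
      have [-> ->] : a = 2 /\ b = 1 by lia.
      by rewrite !inE eqxx.
    - move=> /andP[b0 c0] _; split=> E; first by exfalso; lia.
      have [-> -> ->] : [/\ a = 1, b = 1 & c = 1] by split; lia.
      by rewrite !inE eqxx orbT.
    - by move=> /and4P[b0 c0 e0 _] _; split=> E; exfalso; lia.
  case: d2 => [/lamE.1 E|[/lamE.2 E l2]].
    case: (leqP 6 n) => n6; [by right|left; split; [lia|lia|by rewrite E]].
  left; split; [lia|by []|].
  by move: E; rewrite !inE => /orP[] ->; rewrite ?orbT.
have fills2 a b : lam = [:: a; b] -> n = 2 * l -> l * (d - 2) < d -> fills d sigma.
  exact: secant_fills_pairs.
case=> [[n4 l2 lamI]|[nl n6 lamE]]; last first.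
  by apply: (fills2 1 1) => //; rewrite /d lamE muln0.
move: lamI; rewrite !inE => /or3P[] /eqP lamE.
- by apply: (fills2 1 1) => //; rewrite ?n4 ?l2 // /d lamE.
- by apply: (fills2 2 1) => //; rewrite ?n4 ?l2 // /d lamE.
(* For [[1, 1, 1]] one has [d1 = 1 < s = 2], so the chain of nondefectivity applies, and its length
   is that of the ambient space. *)
apply: secant_fills_chain => //.
rewrite (_ : nforms n (sumn lam) - 1 = l * forms_dim n lam + l - 1).
  by apply: secant_chain => //; rewrite lamE.
by rewrite n4 l2 lamE forms_dim_111.
Qed.
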